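(* Let $\mu,\nu$ be probability measures on $\mathbb{R}$ with bounded support such that $\operatorname{Ent}(\mu|\mathcal L^1)<\infty$ and $\operatorname{Ent}(\nu|\mathcal L^1)<\infty$ (in particular both are absolutely continuous). Assume: (H1) the set $A\cap\operatorname{supp}\mu$ has Lebesgue-negligible boundary, and its interior is $\bigcup_i(a_i,b_i)$ with pairwise disjoint intervals $(a_i,b_i)$ satisfying $$-\sum_i\int_{a_i}^{b_i}\log\big(\min\{x-a_i,\,b_i-x\}\big)\,d\mu(x)<+\infty;$$ (H2) there exists an optimal plan $\gamma\in\mathcal O_1(\mu,\nu)$ such that $\operatorname{Ent}\big(\gamma\llcorner(\mathbb{R}\setminus A)^2\,\big|\,\mu\otimes\nu\big)<\infty$. Then, on $\Pi(\mu,\nu)$ with the narrow topology, the functionals $$F_\varepsilon(\gamma)=\frac1\varepsilon\Big(\int|y-x|\,d\gamma-W_1(\mu,\nu)\Big)+\operatorname{Ent}(\gamma|\mu\otimes\nu)-|\log(2\varepsilon)|\,\mu(A)$$ $\Gamma$-converge as $\varepsilon\to0$ to the functional $F$ defined by $F(\gamma)=+\infty$ if $\gamma\notin\mathcal O_1(\mu,\nu)$ and $$F(\gamma)=\operatorname{Ent}\big(\gamma\llcorner(\mathbb{R}\setminus A)^2\,\big|\,\mu\otimes\nu\big)-\int_A\log\Big(\frac{d\mu}{d\mathcal L^1}\Big)\,d\mu\quad\text{if }\gamma\in\mathcal O_1(\mu,\nu).$$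
   Context: $F_\rho(x)=\rho((-\infty,x])$; $A=\{x: F_\mu(x)=F_\nu(x)\}$. $\Pi(\mu,\nu)$ is the set of probability measures on $\mathbb{R}^2$ with marginals $\mu,\nu$; $W_1(\mu,\nu)=\min_{\gamma\in\Pi(\mu,\nu)}\int|y-x|\,d\gamma$ and $\mathcal O_1(\mu,\nu)$ is the set of minimizers. $\operatorname{Ent}(\gamma|\rho)=\int\log\frac{d\gamma}{d\rho}\,d\gamma$ if $\gamma\ll\rho$, $+\infty$ otherwise. $\gamma\llcorner E$ denotes restriction to $E$. $\Gamma$-convergence: liminf inequality along every converging family and existence of a recovery family satisfying the limsup inequality. *)

(* Defs.v *)
From HB Require Import structures.
From mathcomp Require Import all_boot all_order all_algebra.
From mathcomp Require Import all_classical all_reals all_analysis.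

Set Implicit Arguments.
Unset Strict Implicit.
Unset Printing Implicit Defensive.
Import Order.TTheory GRing.Theory Num.Theory.
Import numFieldNormedType.Exports.

Local Open Scope classical_set_scope.
Local Open Scope ring_scope.
Local Open Scope ereal_scope.

Section Defs.
Context {R : realType}.
Local Notation Rm := (measurableTypeR R).

Definition cdf (rho : set Rm -> \bar R) (x : R) : \bar R := rho `]-oo, x]%classic.

Definition Aset (mu nu : set Rm -> \bar R) : set R := [set x | cdf mu x = cdf nu x].

Definition supp (mu : set Rm -> \bar R) : set R :=
  [set x | forall r : R, (0 < r)%R -> 0 < mu (ball x r)].

Definition is_density d (T : measurableType d) (rho : {measure set T -> \bar R})
    (gam : set T -> \bar R) (f : T -> R) : Prop :=
  [/\ measurable_fun setT f, (forall x, (0 <= f x)%R) &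
      forall B, measurable B -> gam B = \int[rho]_(x in B) (f x)%:E].

(* gam << rho (in the sense of having a density, i.e. Radon-Nikodym) *)
Definition has_density d (T : measurableType d) (rho : {measure set T -> \bar R})
    (gam : set T -> \bar R) : Prop := exists f, is_density rho gam f.

Definition dens d (T : measurableType d) (rho : {measure set T -> \bar R})
    (gam : set T -> \bar R) : T -> R :=
  match pselect (has_density rho gam) with
  | left h => projT1 (cid h)
  | right _ => fun _ => 0%R
  end.

(* relative entropy Ent(gam | rho) = int log(dgam/drho) dgam
   = int (dgam/drho) log (dgam/drho) drho, +oo if gam is not << rho *)
Definition Ent d (T : measurableType d) (gam : set T -> \bar R)
    (rho : {measure set T -> \bar R}) : \bar R :=
  if pselect (has_density rho gam)
  then \int[rho]_x (dens rho gam x * ln (dens rho gam x))%:E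
  else +oo.

Definition restr d (T : measurableType d) (gam : set T -> \bar R) (E : set T)
  : set T -> \bar R := fun B => gam (B `&` E).

Definition Plans (mu nu : probability Rm R) : set (probability (Rm * Rm)%type R) :=
  [set g | (forall B : set Rm, measurable B -> g (B `*` setT) = mu B) /\
           (forall B : set Rm, measurable B -> g (setT `*` B) = nu B)].

Definition cost (g : probability (Rm * Rm)%type R) : \bar R :=
  \int[g]_p (`| p.2 - p.1 |)%:E.

Definition W1 (mu nu : probability Rm R) : \bar R :=
  ereal_inf [set cost g | g in Plans mu nu].

Definition Opt1 (mu nu : probability Rm R) : set (probability (Rm * Rm)%type R) :=
  [set g | Plans mu nu g /\ cost g = W1 mu nu].

Definition narrow_cvg0 (G : R -> probability (Rm * Rm)%type R)
    (g : probability (Rm * Rm)%type R) : Prop :=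
  forall phi : R * R -> R, continuous phi -> (exists M : R, forall p, (`|phi p| <= M)%R) ->
    (fun eps => \int[G eps]_p (phi p)%:E) @ 0%R^'+ --> \int[g]_p (phi p)%:E.

Definition liminf0 (h : R -> \bar R) : \bar R :=
  ereal_sup [set ereal_inf [set h e | e in `]0%R, d[%classic] | d in `]0%R, +oo[%classic].
Definition limsup0 (h : R -> \bar R) : \bar R :=
  ereal_inf [set ereal_sup [set h e | e in `]0%R, d[%classic] | d in `]0%R, +oo[%classic].

Definition Gamma_cvg0 (X : set (probability (Rm * Rm)%type R))
    (Fe : R -> probability (Rm * Rm)%type R -> \bar R)
    (F : probability (Rm * Rm)%type R -> \bar R) : Prop :=
  (forall g, X g -> forall G : R -> probability (Rm * Rm)%type R,
      (forall e, (0 < e)%R -> X (G e)) -> narrow_cvg0 G g ->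
      F g <= liminf0 (fun e => Fe e (G e))) /\
  (forall g, X g -> exists G : R -> probability (Rm * Rm)%type R,
      [/\ forall e, (0 < e)%R -> X (G e), narrow_cvg0 G g &
          limsup0 (fun e => Fe e (G e)) <= F g]).

Definition Feps (mu nu : probability Rm R) (eps : R) (g : probability (Rm * Rm)%type R)
  : \bar R :=
  (eps^-1)%:E * (cost g - W1 mu nu) + Ent g (mu \x nu)
  - (`| ln (2 * eps) |)%:E * mu (Aset mu nu).

Definition Flim (mu nu : probability Rm R) (g : probability (Rm * Rm)%type R) : \bar R :=
  if pselect (Opt1 mu nu g) then
    Ent (restr g (~` Aset mu nu `*` ~` Aset mu nu)) (mu \x nu)
    - \int[mu]_(x in Aset mu nu) (ln (dens (@lebesgue_measure R) mu x))%:E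
  else +oo.

End Defs.

(* Main.v *)
Require Import Defs.
From HB Require Import structures.
From mathcomp Require Import all_boot all_order all_algebra.
From mathcomp Require Import all_classical all_reals all_analysis.
From mathcomp Require Import measurable_realfun.
From mathcomp Require Import ring lra.
Import Order.TTheory GRing.Theory Num.Theory.
Import numFieldNormedType.Exports.
Local Open Scope classical_set_scope.
Local Open Scope ring_scope.
Local Open Scope ereal_scope.
Import HBNNSimple.
Set Implicit Arguments.
Unset Strict Implicit.
Unset Printing Implicit Defensive.

(** For a plan [g] let [gap A p] be the Lebesgue measure of the part of [A]
    crossed between the coordinates of [p]. Crossing counts give
    [W1 + int gap <= cost], so optimal plans sit on the diagonal over [A].

    Lower bound: Young's inequality tested against
    [1_A(x) (- ln (2 eps) - ln f(x)) - gap / eps] (plus an arbitrary test function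
    off [A]) absorbs the singular term [|ln (2 eps)| mu(A)] exactly, because
    [int_A exp (- gap (x, y) / eps) dx <= 2 eps]. The same bound gives uniform
    integrability off [A], hence setwise convergence of the restricted plans, and
    the entropy of the limit is recovered by duality.

    Upper bound: keep an optimal plan off [A] and replace its diagonal part by
    the Laplace kernel [exp (- |x - y| / eps) / (2 eps)] divided by
    [max (f x) (f y)]. Its first marginal is at most [mu]; the missing mass tends
    to zero and is spread as a product measure inside cells of size [eps]. The
    distance to the endpoints of the intervals of (H1) controls the entropy of
    this correction. *)


(** Two obstacles shape the proof. Narrow convergence does not by itself control plans on [~A x ~A],
    since mass may gather at the boundary of [A]. All plans share their marginals, however, so they
    converge on every measurable rectangle, and the entropy bound extends this to all measurable
    sets. Moreover entropies may be infinite and logarithms change sign; inequalities are therefore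
    kept between nonnegative integrals, with [phi t = t ln t - t + 1] for [t ln t] and with the two
    parts of [ln f] on opposite sides.

    In the recovery plan, [max (f x) (f y)] makes the kernel symmetric, so that one marginal
    computation serves both sides, and [ln max >= ln (f x)] has the sign needed for the entropy. A
    correction at scale [eps] has bounded cost after division by [eps], but its entropy contains
    [- ln] of the missing mass of a cell, which has no lower bound. That mass is compared with the
    Lebesgue size of the cell: size over mass has mean at most [leb U], and the size falls below
    [eps] only in cells that [U], the interior of [A] within the support, does not fill. There (H1)
    pays. *)

Section density.
Context d (T : measurableType d) (R : realType).

Section dmeas.
Variables (rho : {measure set T -> \bar R}) (q : T -> R).
Hypotheses (mq : measurable_fun setT q) (q0 : forall x, (0 <= q x)%R).

(** The two proofs are phantom arguments: a term [dmeas rho mq q0] then carries all that unification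
    needs to find the measure structure attached below. *)
Definition dmeas of measurable_fun setT q & (forall x, (0 <= q x)%R) :=
  fun B : set T => \int[rho]_(x in B) (q x)%:E.

Local Notation m := (dmeas mq q0).

Let m0 : m set0 = 0. Proof. exact: integral_set0. Qed.

Let m_ge0 B : 0 <= m B.
Proof. by apply: integral_ge0 => x _; rewrite lee_fin. Qed.

Let m_sigma : semi_sigma_additive m.
Proof.
move=> F mF tF mUF; rewrite /dmeas ge0_integral_bigcup//=; last first.
- by move=> x _; rewrite lee_fin.
- by apply/measurable_EFinP; apply: measurable_funTS.
apply: is_cvg_nneseries => n _ _.
exact: m_ge0.
Qed.

HB.instance Definition _ := isMeasure.Build _ _ _ m m0 m_ge0 m_sigma.

End dmeas.

(** Both sides are limits, by monotone convergence, along the same increasing simple functions. The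
    identity therefore also covers infinite [rho] such as Lebesgue measure. *)
Lemma ge0_integral_dmeas (rho : {measure set T -> \bar R}) (q : T -> R)
    (mq : measurable_fun setT q) (q0 : forall x, (0 <= q x)%R)
    (D : set T) (h : T -> \bar R) :
  measurable D -> measurable_fun D h -> (forall x, D x -> 0 <= h x) ->
  \int[dmeas rho mq q0]_(x in D) h x = \int[rho]_(x in D) (h x * (q x)%:E).
Proof.
move=> mD mh h0.
set m := dmeas rho mq q0.
pose a := nnsfun_approx mD mh.
have mqE : measurable_fun D (EFin \o q).
  by apply/measurable_EFinP; apply: measurable_funTS.
have -> : \int[m]_(x in D) h x =
    lim (\int[m]_(x in D) (EFin \o a n) x @[n --> \oo]).
  have hE x : D x -> h x = lim ((EFin \o a n) x @[n --> \oo]).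
    by move=> Dx; apply/esym/cvg_lim => //; exact: cvg_nnsfun_approx.
  under eq_integral => x /[!inE] /hE -> //.
  apply: monotone_convergence => //.
  - by move=> n; apply/measurable_EFinP; apply: measurable_funTS.
  - by move=> n x Dx /=; rewrite lee_fin.
  - by move=> x Dx b c bc; rewrite lee_fin; exact/lefP/nd_nnsfun_approx.
have -> : \int[rho]_(x in D) (h x * (q x)%:E) =
    lim (\int[rho]_(x in D) ((EFin \o a n) x * (q x)%:E) @[n --> \oo]).
  have hE x : D x -> h x * (q x)%:E = lim (((EFin \o a n) x * (q x)%:E) @[n --> \oo]).
    move=> Dx; apply/esym/cvg_lim => //; apply: cvgeZr; first by [].
    exact: cvg_nnsfun_approx.
  under eq_integral => x /[!inE] /hE -> //.
  apply: monotone_convergence => //.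
  - move=> n; apply/emeasurable_funM => //.
    by apply/measurable_EFinP; apply: measurable_funTS.
  - by move=> n x Dx /=; rewrite mule_ge0 ?lee_fin.
  - move=> x Dx b c bc /=; rewrite lee_wpmul2r ?lee_fin//.
    exact/lefP/nd_nnsfun_approx.
suff suf n : \int[m]_(x in D) (EFin \o a n) x =
    \int[rho]_(x in D) ((EFin \o a n) x * (q x)%:E).
  by under eq_fun do rewrite suf.
have indich r : measurable_fun D (fun x => (r * \1_(a n @^-1` [set r]) x)%:E).
  by apply: (measurable_comp measurableT) => //; exact: measurable_funM.
transitivity (\int[m]_(x in D)
   (\sum_(y \in range (a n)) (y * \1_(a n @^-1` [set y]) x)%:E)).
  by apply: eq_integral => t tE; rewrite /= fimfunE -fsumEFin.
rewrite ge0_integral_fsum//; last by move=> y x _; exact: nnfun_muleindic_ge0.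
transitivity (\int[rho]_(x in D) (\sum_(y \in range (a n))
    (y * \1_(a n @^-1` [set y]) x)%:E * (q x)%:E)); last first.
  under eq_integral => x xE.
    rewrite -ge0_mule_fsuml => [|y]; last exact: nnfun_muleindic_ge0.
    rewrite fsumEFin // -(fimfunE _ x); over.
  by [].
rewrite ge0_integral_fsum//; last 2 first.
  - by move=> y; apply: emeasurable_funM => //; apply: measurable_funTS.
  - by move=> y x Dx; apply: mule_ge0; [exact: nnfun_muleindic_ge0|rewrite lee_fin].
apply: eq_fsbigr => r; rewrite inE => -[t _ ra].
have r0 : (0 <= r)%R by rewrite -ra.
have mi : measurable_fun D (EFin \o (\1_(a n @^-1` [set r]) : T -> R)).
  by apply/measurable_EFinP; apply: measurable_funTS; exact: measurable_indic.
under eq_integral do rewrite EFinM.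
rewrite ge0_integralZl//.
under [RHS]eq_integral do rewrite EFinM -muleA.
rewrite ge0_integralZl//; last 2 first.
  - exact: emeasurable_funM.
  - by move=> x _; rewrite mule_ge0 ?lee_fin.
congr (_ * _).
rewrite integral_indic//= /dmeas setIC integral_mkcondr.
apply: eq_integral => x _; rewrite restrict_EFin /= patchE indicE.
by case: ifPn => _; rewrite ?mul1e ?mul0e.
Qed.

Lemma ge0_integral_density (rho gam : {measure set T -> \bar R}) (q : T -> R)
    (D : set T) (h : T -> \bar R) :
  is_density rho gam q ->
  measurable D -> measurable_fun D h -> (forall x, D x -> 0 <= h x) ->
  \int[gam]_(x in D) h x = \int[rho]_(x in D) (h x * (q x)%:E).
Proof.
move=> [mq q0 gE] mD mh h0.
rewrite -(ge0_integral_dmeas rho mq q0 mD mh h0).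
by apply: eq_measure_integral => A mA _; exact: gE.
Qed.

End density.

(** * Relative entropy: pointwise inequalities and representation by densities *)

Section entropy_function.
Context {R : realType}.
Implicit Types t h : R.
Local Open Scope ring_scope.

(** Adding [1 - t] to [t ln t] makes the integrand nonnegative, so that entropies can be added and
    compared in the extended reals without integrability conditions. Since [ln 0 = 0], the value at
    0 is 1. *)
Definition phi t : R := t * ln t - t + 1.

(** Fenchel-Young inequality: the convex conjugate of [phi] on the half-line is [exp h - 1]. For
    [t > 0] it is [1 + u <= exp u] at [u = h - ln t], multiplied by [t]. *)
Lemma young_phi t h : 0 <= t -> t * h + 1 <= phi t + expR h.
Proof.
rewrite le_eqVlt /phi => /predU1P[<-|t0].
  by rewrite !mul0r subr0 !add0r lerDl expR_ge0.
have -> : expR h = t * expR (h - ln t).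
  by rewrite expRB lnK ?posrE// mulrCA divff ?mulr1// gt_eqF.
have := expR_ge1Dx (h - ln t); rewrite -(ler_pM2l t0) => H.
by lra.
Qed.

Lemma phi_ge0 t : 0 <= t -> 0 <= phi t.
Proof. by move=> /(@young_phi t 0); rewrite mulr0 add0r expR0 lerDr. Qed.

Lemma measurable_phi : measurable_fun setT phi.
Proof.
apply: measurable_funD => //; apply: measurable_funB => //.
by apply: measurable_funM => //; exact: measurable_ln.
Qed.

(** Tangent line of [ln] at [exp l], with its constant -1 dropped. It trades the logarithm of a
    quantity of bounded mean for a constant and an arbitrarily small multiple of that mean. *)
Lemma ln_le_lin t l : 0 < t -> ln t <= l + expR (- l) * t.
Proof.
move=> t0; have := expR_ge1Dx (ln t - l).
rewrite addrC expRD lnK ?posrE// mulrC; lra.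
Qed.

(* Splitting the entropy of a sum costs only [t (1 + l) + (s + t) exp (- l)]:
   no factor of the entropies themselves is lost. *)
Lemma xlnx_add s t l : 0 <= s -> 0 <= t -> 0 <= l ->
  (s + t) * ln (s + t) <= s * ln s + t * ln t + t * (l + 1) + expR (- l) * (s + t).
Proof.
move=> s0 t0 l0.
have [->|tn] := eqVneq t 0.
  by rewrite !mul0r !addr0 lerDl mulr_ge0 ?expR_ge0.
have tp : 0 < t by rewrite lt_neqAle eq_sym tn.
have [->|sn] := eqVneq s 0.
  rewrite !mul0r !add0r -addrA lerDl addr_ge0 ?mulr_ge0 ?expR_ge0 ?addr_ge0//.
have sp : 0 < s by rewrite lt_neqAle eq_sym sn.
have stp : 0 < s + t by rewrite addr_gt0.
have e1 : ln (s + t) <= ln s + t / s.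
  have -> : s + t = s * (1 + t / s) by rewrite mulrDr mulr1 mulrCA divff ?mulr1.
  rewrite lnM ?posrE// ?addr_gt0 ?divr_gt0// lerD2l le_ln1Dx//.
  by rewrite (lt_le_trans (ltrN10 _))// divr_ge0.
(* The ratio [(s + t) / t] is unbounded for small [t]; after multiplication by [t] the tangent
   inequality turns it into [expR (- l) * (s + t)]. *)
have e2 : ln (s + t) <= ln t + (l + expR (- l) * ((s + t) / t)).
  have {1}-> : s + t = t * ((s + t) / t) by rewrite mulrCA divff ?mulr1.
  rewrite lnM ?posrE// ?divr_gt0// lerD2l ln_le_lin// divr_gt0//.
have e1' : s * ln (s + t) <= s * ln s + t.
  have -> : s * ln s + t = s * (ln s + t / s) by field.
  by rewrite ler_pM2l.
have e2' : t * ln (s + t) <= t * ln t + t * l + expR (- l) * (s + t).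
  have -> : t * ln t + t * l + expR (- l) * (s + t) =
     t * (ln t + (l + expR (- l) * ((s + t) / t))) by field.
  by rewrite ler_pM2l.
rewrite mulrDl; lra.
Qed.

End entropy_function.

Section Ent_density.
Context d (T : measurableType d) (R : realType).
Implicit Types (rho : {measure set T -> \bar R}) (gam : set T -> \bar R).

Lemma is_density_uniq rho gam (q1 q2 : T -> R) : gam setT < +oo ->
  is_density rho gam q1 -> is_density rho gam q2 ->
  ae_eq rho setT (EFin \o q1) (EFin \o q2).
Proof.
move=> goo [m1 p1 e1] [m2 p2 e2]; apply: integral_ae_eq => //.
- apply/integrableP; split; first exact/measurable_EFinP.
  under eq_integral do rewrite /= ger0_norm//.
  by rewrite -e1.
- exact/measurable_EFinP.
- by move=> E _ mE; rewrite -[LHS]e1// -[RHS]e2.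
Qed.

Lemma density_dens rho gam : has_density rho gam ->
  is_density rho gam (dens rho gam).
Proof. by move=> h; rewrite /dens; case: pselect => // h'; case: cid. Qed.

(** [Ent] is defined through a chosen density. Almost everywhere uniqueness, valid because [gam] is
    finite, allows it to be computed from any explicit one. *)
Lemma Ent_density rho gam (q : T -> R) : gam setT < +oo ->
  is_density rho gam q -> Ent gam rho = \int[rho]_x (q x * ln (q x))%:E.
Proof.
move=> goo dq; rewrite /Ent; case: pselect => [h|]; last by case; exists q.
have dd := density_dens h.
have [md _ _] := dd; have [mq _ _] := dq.
have ml (f : T -> R) : measurable_fun setT f ->
    measurable_fun setT (fun x => (f x * ln (f x))%:E).
  move=> mf; apply/measurable_EFinP; apply: measurable_funM => //.
  by apply: measurableT_comp => //; exact: measurable_ln.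
apply: ae_eq_integral => //; [exact: ml|exact: ml|].
have := is_density_uniq goo dd dq.
by move/(ae_eq_comp (fun z => (fine z * ln (fine z))%:E)).
Qed.

Lemma has_density_Ent rho gam : Ent gam rho < +oo -> has_density rho gam.
Proof. by rewrite /Ent; case: pselect. Qed.

End Ent_density.

(** The delicate case is an infinite integral of [f]: the positive part of [f + g] then has infinite
    integral while its negative part is dominated by [|g|], so no indeterminate difference
    arises. *)
Lemma ge0_integralD_integrable d (T : measurableType d) (R : realType)
    (m : {measure set T -> \bar R}) (f : T -> R) (g : T -> R) :
  measurable_fun setT f -> (forall x, (0 <= f x)%R) ->
  m.-integrable setT (EFin \o g) ->
  \int[m]_x (f x + g x)%:E = \int[m]_x (f x)%:E + \int[m]_x (g x)%:E.
Proof.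
move=> mf f0 ig.
have mg : measurable_fun setT g by apply/measurable_EFinP; exact: measurable_int ig.
have [foo|] := boolP (\int[m]_x (f x)%:E < +oo).
  have if' : m.-integrable setT (EFin \o f).
    apply/integrableP; split; first exact/measurable_EFinP.
    by under eq_integral do rewrite /= ger0_norm//.
  by rewrite -integralD_EFin.
rewrite -leNgt leye_eq => /eqP foo; rewrite foo addye; last first.
  by have := integrable_fin_num measurableT ig; rewrite fin_numE => /andP[].
have mfg : measurable_fun setT (f \+ g)%R by exact: measurable_funD.
have ign : \int[m]_x (`|g x|)%:E < +oo by case/integrableP : ig.
have pos : \int[m]_x ((EFin \o (f \+ g)%R)^\+ x) = +oo.
  apply/eqP; rewrite -leye_eq leNgt; apply/negP => lt.
  suff : \int[m]_x (f x)%:E < +oo by rewrite foo ltxx.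
  apply: (@le_lt_trans _ _ (\int[m]_x ((EFin \o (f \+ g)%R)^\+ x + (`|g x|)%:E))).
    apply: ge0_le_integral => //.
    - by move=> x _; rewrite lee_fin.
    - exact/measurable_EFinP.
    - apply: emeasurable_funD.
        by apply: measurable_funepos; exact/measurable_EFinP.
      by apply/measurable_EFinP; exact: measurableT_comp.
    - move=> x _; rewrite funeposE /= -EFin_max -EFinD lee_fin.
      have := ler_norm (- g x)%R; rewrite normrN.
      have : (f x + g x <= Num.max (f x + g x) 0)%R by rewrite le_max lexx.
      lra.
  rewrite ge0_integralD//; last 2 first.
  - by apply: measurable_funepos; exact/measurable_EFinP.
  - by apply/measurable_EFinP; exact: measurableT_comp.
  by rewrite lte_add_pinfty.
have neg : \int[m]_x ((EFin \o (f \+ g)%R)^\- x) < +oo.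
  apply: le_lt_trans ign; apply: ge0_le_integral => //.
  - by apply: measurable_funeneg; exact/measurable_EFinP.
  - by apply/measurable_EFinP; exact: measurableT_comp.
  - move=> x _; rewrite funenegE /= -EFin_max lee_fin.
    rewrite ge_max normr_ge0 andbT.
    have := ler_norm (- g x)%R; rewrite normrN; have := f0 x; lra.
rewrite [LHS]integralE pos addye//.
have : - (\int[m]_x ((EFin \o (f \+ g)%R)^\- x)) \is a fin_num.
  by rewrite fin_numN ge0_fin_numE// integral_ge0.
by rewrite fin_numE => /andP[].
Qed.

(** The linear part of [phi] integrates to [gam setT - 1] up to sign. That quantity is finite while
    the entropy may not be, which is why the identity is written additively. *)
Lemma Ent_phi d (T : measurableType d) (R : realType)
    (rho : {measure set T -> \bar R}) (gam : set T -> \bar R) (q : T -> R) :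
  rho setT = 1 -> gam setT < +oo -> is_density rho gam q ->
  Ent gam rho + 1 = \int[rho]_x (phi (q x))%:E + gam setT.
Proof.
move=> r1 goo dq; rewrite (Ent_density goo dq).
have [mq q0 gE] := dq.
have iq : rho.-integrable setT (EFin \o q).
  apply/integrableP; split; first exact/measurable_EFinP.
  by under eq_integral do rewrite /= ger0_norm//; rewrite -gE.
have i1 : rho.-integrable setT (EFin \o cst 1%R).
  apply/integrableP; split; first exact/measurable_EFinP/measurable_cst.
  by under eq_integral do rewrite /= normr1; rewrite integral_cst// mul1e r1 ltry.
have -> : \int[rho]_x (q x * ln (q x))%:E =
    \int[rho]_x (phi (q x) + (q x - 1))%:E.
  by apply: eq_integral => x _; congr EFin; rewrite /phi; lra.
rewrite ge0_integralD_integrable//; last 3 first.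
- by apply: measurableT_comp => //; exact: measurable_phi.
- by move=> x; exact: phi_ge0.
- have := integrableB measurableT iq i1.
  by apply: eq_integrable => // x _; rewrite /= EFinB.
have -> : \int[rho]_x (q x - 1)%:E = gam setT - 1.
  under eq_integral do rewrite EFinB.
  by rewrite integralB_EFin// -gE// integral_cst// r1 mul1e.
by rewrite -addeA subeK.
Qed.

Section measure_to_probability.
Context d (T : measurableType d) (R : realType).
Variable m : {measure set T -> \bar R}.

Definition measure_prob of m setT = 1 : set T -> \bar R := m.

Hypothesis m1 : m setT = 1.

HB.instance Definition _ := Measure.copy (measure_prob m1) m.
HB.instance Definition _ :=
  Measure_isProbability.Build _ _ _ (measure_prob m1) m1.

Lemma measure_probability : exists P : probability T R, forall B, P B = m B.
Proof. by exists (measure_prob m1 : probability T R). Qed.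

End measure_to_probability.

(** * Distribution functions and quantiles *)

Section rays.
Context {R : realType}.
Local Notation Rm := (measurableTypeR R).

Definition ray : set (set Rm) := [set `]-oo, x]%classic | x in setT].

Lemma measurable_ray : @measurable _ Rm = <<s ray >>.
Proof.
rewrite [LHS](RGenCInfty.measurableE R) eqEsubset; split => A.
  apply: smallest_sub; first exact: smallest_sigma_algebra.
  move=> _ [x ->]; rewrite -setCitvl; apply: sigma_algebraC.
  rewrite (_ : `]-oo, x[%classic = \bigcup_k `]-oo, (x - k.+1%:R^-1)%R]%classic).
    apply: sigma_algebra_bigcup => k.
    by apply: sub_sigma_algebra; exists (x - k.+1%:R^-1)%R.
  rewrite eqEsubset; split => y /=.
    rewrite in_itv/= => yx.
    have [k kxy] := ltr_add_invr yx.
    by exists k => //=; rewrite in_itv/= lerBrDr ltW.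
  move=> [k _]/=; rewrite !in_itv/= => /le_lt_trans; apply.
  by rewrite ltrBlDr ltrDl.
apply: smallest_sub; first exact: smallest_sigma_algebra.
move=> _ [x _ <-]; rewrite -setCitvr; apply: sigma_algebraC.
rewrite (_ : `]x, +oo[%classic = \bigcup_k `[(x + k.+1%:R^-1)%R, +oo[%classic).
  apply: sigma_algebra_bigcup => k.
  by apply: sub_sigma_algebra; exists (x + k.+1%:R^-1)%R.
rewrite eqEsubset; split => y /=.
  rewrite in_itv/= andbT => xy.
  have [k kxy] := ltr_add_invr xy.
  by exists k => //=; rewrite in_itv/= andbT ltW.
move=> [k _]/=; rewrite !in_itv/= !andbT; apply: lt_le_trans.
by rewrite ltrDl.
Qed.

Lemma setI_closed_ray : setI_closed ray.
Proof.
move=> _ _ [x _ <-] [y _ <-]; exists (Num.min x y) => //.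
by apply/seteqP; split => z /=; rewrite !in_itv/= le_min => /andP.
Qed.

Lemma ray_measure_unique (m1 m2 : {measure set Rm -> \bar R}) :
  (forall x, m1 `]-oo, x]%classic = m2 `]-oo, x]%classic) ->
  (forall x, m1 `]-oo, x]%classic < +oo) ->
  forall B, measurable B -> m1 B = m2 B.
Proof.
move=> e oo; apply: (measure_unique ray (fun n => `]-oo, n%:R]%classic)).
- exact: measurable_ray.
- exact: setI_closed_ray.
- by move=> i; exists i%:R.
- rewrite eqEsubset; split => // x _.
  exists (Num.trunc `|x|).+1 => //=; rewrite in_itv/=.
  by rewrite (le_trans (ler_norm _))// ltW// truncnS_gt.
- by move=> _ [x _ <-].
- by [].
Qed.

End rays.

Section quantile.
Context {R : realType}.
Local Notation Rm := (measurableTypeR R).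
Variable P : probability Rm R.

(** The identity seen as a random variable: the limits and the right continuity known for
    distribution functions of random variables then apply to [P] itself. *)
Let idTR : Rm -> R := idfun.

#[local] HB.instance Definition _ :=
  @isMeasurableFun.Build _ _ _ _ idTR (@measurable_id _ _ setT).

Definition rcdf (t : R) : R := fine (P `]-oo, t]%classic).

Lemma rcdfE t : (rcdf t)%:E = P `]-oo, t]%classic.
Proof. by rewrite fineK// fin_num_measure. Qed.

Lemma rcdf_nd s t : (s <= t)%R -> (rcdf s <= rcdf t)%R.
Proof.
move=> st; rewrite -lee_fin !rcdfE; apply: le_measure; rewrite ?inE//.
by apply: subset_itvl; rewrite bnd_simp.
Qed.

Lemma rcdf_ge0 t : (0 <= rcdf t)%R.
Proof. by rewrite -lee_fin rcdfE. Qed.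

Lemma rcdf_le1 t : (rcdf t <= 1)%R.
Proof. by rewrite -lee_fin rcdfE probability_le1. Qed.

Definition quantile (u : R) : R := inf [set t | (u <= rcdf t)%R].

Lemma cvg_rcdf0 u : (0 < u)%R -> exists t, (rcdf t < u)%R.
Proof.
move=> u0.
have /fine_cvgP[_] := @cvg_cdfNy0 _ _ _ P (idTR : {RV P >-> R}).
move=> /cvgrPdist_lt/(_ _ u0)[M [_ Mu]].
exists (M - 1)%R; have := Mu (M - 1)%R.
by rewrite ltrBlDr ltrDl ltr01 sub0r normrN /= => /(_ isT); apply: le_lt_trans; exact: ler_norm.
Qed.

Lemma cvg_rcdf1 u : (u < 1)%R -> exists t, (u < rcdf t)%R.
Proof.
rewrite -subr_gt0 => u0.
have /fine_cvgP[_] := @cvg_cdfy1 _ _ _ P (idTR : {RV P >-> R}).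
move=> /cvgrPdist_lt/(_ _ u0)[M [_ Mu]].
exists (M + 1)%R; have := Mu (M + 1)%R.
rewrite ltrDl ltr01 /= => /(_ isT).
rewrite ltr_norml => /andP[_]; rewrite -[X in (_ < X -> _)%R]/(1 - u)%R.
rewrite ltrD2l ltrN2; exact.
Qed.

(** Galois connection between quantile and distribution function. From left to right, right
    continuity is essential: were [rcdf t < u], it would stay below [u] on a right neighbourhood of
    [t], yet that neighbourhood contains points of the set whose infimum is at most [t]. *)
Lemma quantileP u t : (0 < u < 1)%R -> (quantile u <= t)%R = (u <= rcdf t)%R.
Proof.
move=> /andP[u0 u1].
have [s su] := cvg_rcdf0 u0; have [r ru] := cvg_rcdf1 u1.
have S0 : has_inf [set t | (u <= rcdf t)%R].
  split; first by exists r => /=; exact: ltW.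
  exists s => z /= uz; rewrite leNgt; apply/negP => /ltW/rcdf_nd.
  by move=> /(le_trans uz); rewrite leNgt su.
apply/idP/idP; last first.
  by move=> ut; apply: ge_inf => //; case: S0.
move=> qt; rewrite leNgt; apply/negP => tu.
have rc : cdf (idTR : {RV P >-> R}) x @[x --> t^'+] --> (rcdf t)%:E.
  by rewrite rcdfE; exact: (@cdf_right_continuous _ _ _ P (idTR : {RV P >-> R})).
have ut0 : (0 < u - rcdf t)%R by rewrite subr_gt0.
move/fine_cvgP : rc => [_ /cvgrPdist_lt/(_ _ ut0)[e /= e0 He]].
have [z /= uz zt] : exists2 z, (u <= rcdf z)%R & (z < t + e)%R.
  have [z uz zq] := inf_adherent e0 S0; exists z => //.
  by rewrite (lt_le_trans zq)// lerD2r.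
have tz : (t < z)%R.
  rewrite ltNge; apply/negP => /rcdf_nd zz.
  by move: tu; rewrite ltNge (le_trans uz zz).
have := He z; rewrite /ball_/= distrC ger0_norm ?subr_ge0 ?(ltW tz)//.
rewrite ltrBlDl => /(_ zt tz).
rewrite distrC ltr_norml => /andP[_].
rewrite -[X in (X - _ < _ -> _)%R]/(rcdf z) ltrD2r ltNge.
by rewrite uz.
Qed.

End quantile.

(** * Crossing counts, the monotone plan and the gap inequality *)

Section crossing.
Context {R : realType}.
Local Notation Rm := (measurableTypeR R).
Local Notation leb := (@lebesgue_measure R).

(** Half-open on the right: [p] crosses [t] exactly when one and only one coordinate belongs to
    []-oo, t]]. This matches the convention of [cdf], so no exceptional [t] has to be removed. *)
Definition crosses (p : R * R) : set R :=
  [set t | (p.1 <= t < p.2)%R \/ (p.2 <= t < p.1)%R].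

Definition gapA (A : set R) (p : R * R) : \bar R := leb (A `&` crosses p).

Lemma measurable_crosses p : measurable (crosses p : set Rm).
Proof.
rewrite (_ : crosses p = `[p.1, p.2[%classic `|` `[p.2, p.1[%classic).
  exact: measurableU.
by apply/seteqP; split => t /=; rewrite !in_itv.
Qed.

Lemma leb_crosses p : leb (crosses p) = (`|p.2 - p.1|)%:E.
Proof.
wlog p12 : p / (p.1 <= p.2)%R.
  move=> H; have [/H//|/ltW p21] := leP p.1 p.2.
  have := H (p.2, p.1) p21; rewrite /= distrC => <-.
  by congr (leb _); apply/seteqP; split => t [?|?]; by [left|right].
rewrite (_ : crosses p = `[p.1, p.2[%classic).
  rewrite lebesgue_measure_itv/= lte_fin ger0_norm ?subr_ge0// -EFinD.
  case: ifPn => //; rewrite -leNgt => p21.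
  by congr EFin; apply/esym/eqP; rewrite subr_eq0 eq_le p12 p21.
apply/seteqP; split => t /=; rewrite in_itv/=; last by left.
case=> // /andP[a b].
by move: (le_lt_trans (le_trans p12 a) b); rewrite ltxx.
Qed.

Lemma measurable_crossing (A : set Rm) : measurable A ->
  measurable [set z : (Rm * Rm) * Rm | A z.2 /\ crosses z.1 z.2].
Proof.
move=> mA.
have m11 : measurable_fun setT (fun z : (Rm * Rm) * Rm => z.1.1 : R).
  exact: (measurableT_comp measurable_fst measurable_fst).
have m12 : measurable_fun setT (fun z : (Rm * Rm) * Rm => z.1.2 : R).
  exact: (measurableT_comp measurable_snd measurable_fst).
have m2 : measurable_fun setT (fun z : (Rm * Rm) * Rm => z.2 : R).
  exact: measurable_snd.
rewrite (_ : [set _ | _] = (setT `&` snd @^-1` A) `&`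
  ((setT `&` (fun z : (Rm * Rm) * Rm => (z.1.1 <= z.2)%R && (z.2 < z.1.2)%R) @^-1` [set true]) `|`
  (setT `&` (fun z : (Rm * Rm) * Rm => (z.1.2 <= z.2)%R && (z.2 < z.1.1)%R) @^-1` [set true]))).
  apply: measurableI; first exact: (@measurable_snd _ _ (Rm * Rm)%type Rm).
  apply: measurableU.
    apply: (_ : measurable_fun _ _) => //; apply: measurable_and.
      exact: measurable_fun_ler.
    exact: measurable_fun_ltr.
  apply: (_ : measurable_fun _ _) => //; apply: measurable_and.
    exact: measurable_fun_ler.
  exact: measurable_fun_ltr.
apply/seteqP; split => -[[x y] t] /=; first by case=> At [H|H]; split => //; [left|right].
by case=> [[_ At]] [[_ H]|[_ H]]; split => //; [left|right].
Qed.

Variable g : probability (Rm * Rm)%type R.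

Lemma measurable_crossed (t : R) : measurable [set p : Rm * Rm | crosses p t].
Proof.
rewrite (_ : [set _ | _] = ysection [set z : (Rm * Rm) * Rm | setT z.2 /\ crosses z.1 z.2] t).
  by apply: measurable_ysection; exact: measurable_crossing.
by apply/seteqP; split => p /=; [move=> H; apply/ysectionP|move/ysectionP => -[]].
Qed.

Lemma measurable_gapA (A : set Rm) : measurable A ->
  measurable_fun setT (gapA A : Rm * Rm -> \bar R).
Proof.
move=> mA; have := measurable_fun_xsection leb (measurable_crossing mA).
congr (measurable_fun _ _); apply/funext => p; congr (leb _).
by apply/seteqP; split => t /=; [move/xsectionP|move=> H; apply/xsectionP].
Qed.

Lemma measurable_crossed_fun :
  measurable_fun setT (fun t : Rm => g [set p | crosses p t]).
Proof.
have := measurable_fun_ysection g (measurable_crossing measurableT).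
congr (measurable_fun _ _); apply/funext => t; congr (g _).
by apply/seteqP; split => p /=; [move/ysectionP => -[]|move=> H; apply/ysectionP].
Qed.

Lemma crossing_tonelli (A : set Rm) : measurable A ->
  \int[g]_p gapA A p = \int[leb]_(t in A) g [set p | crosses p t].
Proof.
move=> mA; have mC := measurable_crossing mA.
transitivity (\int[g]_p fubini_F leb (EFin \o \1_[set z : (Rm * Rm) * Rm | A z.2 /\ crosses z.1 z.2]) p).
  rewrite indic_fubini_tonelli_FE//; apply: eq_integral => p _ /=.
  congr (leb _); apply/seteqP; split => t /=.
    by move=> [At H]; apply/xsectionP.
  by move/xsectionP.
rewrite indic_fubini_tonelli// indic_fubini_tonelli_GE// [RHS]integral_mkcond.
apply: eq_integral => t _ /=; rewrite patchE.
case: ifPn => [|] tA.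
  congr (g _); apply/seteqP; split => p /=.
    by move/ysectionP => -[].
  by move=> H; apply/ysectionP; split => //; rewrite inE in tA.
rewrite (_ : ysection _ _ = set0) ?measure0//.
apply/seteqP; split => // p /ysectionP[/= At _].
by move: tA; rewrite notin_setE.
Qed.

Lemma cost_crossing : cost g = \int[leb]_t g [set p | crosses p t].
Proof.
rewrite -crossing_tonelli//; apply: eq_integral => p _.
by rewrite /gapA setTI leb_crosses.
Qed.

Variables mu nu : probability Rm R.

(** A pair whose first coordinate is at most [t] either has its second coordinate there too, or
    crosses [t]; the same holds with the coordinates exchanged. *)
Lemma rcdf_crossed t : Plans mu nu g ->
  (`|rcdf mu t - rcdf nu t|)%:E <= g [set p | crosses p t].
Proof.
move=> [gm gn]; have mc := measurable_crossed t.
have H1 : (rcdf mu t)%:E <= (rcdf nu t)%:E + g [set p | crosses p t].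
  rewrite !rcdfE -gm// -gn//.
  apply: le_trans (measureU2 _ _ _); [|exact: measurableX|by []].
  apply: le_measure; rewrite ?inE.
  - exact: measurableX.
  - by apply: measurableU => //; exact: measurableX.
  - move=> [x y] /=; rewrite !in_itv/= => -[xt _].
    by have [yt|ty] := leP y t; [left|right; left; rewrite xt].
have H2 : (rcdf nu t)%:E <= (rcdf mu t)%:E + g [set p | crosses p t].
  rewrite !rcdfE -gm// -gn//.
  apply: le_trans (measureU2 _ _ _); [|exact: measurableX|by []].
  apply: le_measure; rewrite ?inE.
  - exact: measurableX.
  - by apply: measurableU => //; exact: measurableX.
  - move=> [x y] /=; rewrite !in_itv/= => -[_ yt].
    by have [xt|tx] := leP x t; [left|right; right; rewrite yt].
move: H1 H2; have : g [set p | crosses p t] \is a fin_num by rewrite fin_num_measure.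
case: (g _) => // r _; rewrite -!EFinD !lee_fin => H1 H2.
by rewrite ler_norml; lra.
Qed.

End crossing.

Lemma pushforward_measure d1 d2 (T1 : measurableType d1) (T2 : measurableType d2)
    (R : realType) (m : {measure set T1 -> \bar R}) (f : T1 -> T2) :
  measurable_fun setT f ->
  exists m' : {measure set T2 -> \bar R}, forall B, m' B = m (f @^-1` B).
Proof.
move=> mf; unshelve eexists (pushforward m f : measure _ _); first by [].
by [].
Qed.

Section monotone_plan.
Context {R : realType}.
Local Notation Rm := (measurableTypeR R).
Local Notation leb := (@lebesgue_measure R).

(** Extended by 0 outside the open unit interval, the range in which [quantileP] governs the
    infimum. *)
Definition quantile01 (P : probability Rm R) : Rm -> Rm :=
  quantile P \_ `]0%R, 1%R[%classic.

Lemma quantile01P (P : probability Rm R) (u t : R) : (0 < u < 1)%R ->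
  (quantile01 P u <= t)%R = (u <= rcdf P t)%R.
Proof.
move=> u01; rewrite /quantile01 patchE ifT ?quantileP//.
by rewrite inE /= in_itv.
Qed.

Lemma measurable_quantile01 (P : probability Rm R) :
  measurable_fun setT (quantile01 P).
Proof.
apply/(measurable_restrict (T1 := Rm) (T2 := Rm) (D := `]0%R, 1%R[%classic) (quantile P)) => //.
rewrite setTI; apply: (measurability ray); first exact: measurable_ray.
move=> _ [_ [t _ <-] <-].
rewrite (_ : _ `&` _ = `]0%R, 1%R[%classic `&` `]-oo, rcdf P t]%classic).
  exact: measurableI.
by apply/seteqP; split => u /=; rewrite !in_itv/= => -[u01];
  rewrite quantileP.
Qed.

Lemma leb_oc01 (s : R) : (0 <= s <= 1)%R ->
  leb (`]0%R, 1%R[%classic `&` `]-oo, s]%classic) = s%:E.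
Proof.
move=> /andP[s0 s1].
have : leb `]0%R, s[%classic <= leb (`]0%R, 1%R[%classic `&` `]-oo, s]%classic)
   <= leb `]0%R, s]%classic.
  apply/andP; split; apply: le_measure; rewrite ?inE//; try exact: measurableI.
    move=> u /=; rewrite !in_itv/= => /andP[u0 us].
    by rewrite u0 (lt_le_trans us s1) (ltW us).
  by move=> u /=; rewrite !in_itv/= => -[/andP[-> _] ->].
rewrite !lebesgue_measure_itv/= lte_fin.
have -> : (if (0 < s)%R then s%:E - 0%:E else 0) = s%:E.
  case: ifPn; rewrite ?sube0// -leNgt => s0'.
  by congr EFin; apply/le_anti; rewrite s0 s0'.
by move=> h; apply/esym/le_anti; exact: h.
Qed.

(** The plan is the image of Lebesgue measure on the unit interval under the pair of quantile
    functions. By the Galois connection the pair crosses [t] only when [u] lies between the two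
    distribution functions at [t]. *)
Lemma exists_monotone_plan (mu nu : probability Rm R) :
  exists2 g : probability (Rm * Rm)%type R, Plans mu nu g &
    forall t, g [set p | crosses p t] <= (`|rcdf mu t - rcdf nu t|)%:E.
Proof.
pose D : set Rm := `]0%R, 1%R[%classic.
have mD : measurable D by exact: measurable_itv.
pose f : Rm -> (Rm * Rm)%type := fun u => (quantile01 mu u, quantile01 nu u).
have mf : measurable_fun setT f.
  by apply: measurable_fun_pair; exact: measurable_quantile01.
have [m mE0] := pushforward_measure (mrestr leb mD) mf.
have mE B : m B = leb (f @^-1` B `&` D) by exact: mE0.
have m1 : m setT = 1.
  by rewrite mE preimage_setT setTI lebesgue_measure_itv/= lte_fin ltr01 sube0.
have [g gm] := measure_probability m1.
exists g.
  split => B mB.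
  - pose f1 : Rm -> Rm := quantile01 mu.
    have mf1 : measurable_fun setT f1 by exact: measurable_quantile01.
    have [m' m'E0] := pushforward_measure (mrestr leb mD) mf1.
    transitivity (m' B); first rewrite m'E0.
      rewrite gm mE; congr (leb (_ `&` _)).
      by apply/seteqP; split => u /=; [case|].
    have m'E x : m' `]-oo, x]%classic = mu `]-oo, x]%classic.
      rewrite -rcdfE -(leb_oc01 (s := rcdf mu x)) ?rcdf_ge0 ?rcdf_le1//.
      transitivity (leb (f1 @^-1` `]-oo, x]%classic `&` D)); first exact: m'E0.
      congr (leb _); apply/seteqP; split => u /=; rewrite !in_itv/= => -[].
        by move=> /[swap] u01; rewrite quantile01P.
      by move=> u01; rewrite -quantile01P.
    apply: ray_measure_unique => // x.
    by rewrite m'E -ge0_fin_numE// fin_num_measure.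
  - pose f1 : Rm -> Rm := quantile01 nu.
    have mf1 : measurable_fun setT f1 by exact: measurable_quantile01.
    have [m' m'E0] := pushforward_measure (mrestr leb mD) mf1.
    transitivity (m' B); first rewrite m'E0.
      rewrite gm mE; congr (leb (_ `&` _)).
      by apply/seteqP; split => u /=; [case|].
    have m'E x : m' `]-oo, x]%classic = nu `]-oo, x]%classic.
      rewrite -rcdfE -(leb_oc01 (s := rcdf nu x)) ?rcdf_ge0 ?rcdf_le1//.
      transitivity (leb (f1 @^-1` `]-oo, x]%classic `&` D)); first exact: m'E0.
      congr (leb _); apply/seteqP; split => u /=; rewrite !in_itv/= => -[].
        by move=> /[swap] u01; rewrite quantile01P.
      by move=> u01; rewrite -quantile01P.
    apply: ray_measure_unique => // x.
    by rewrite m'E -ge0_fin_numE// fin_num_measure.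
move=> t; rewrite gm mE.
pose a := Num.min (rcdf mu t) (rcdf nu t); pose b := Num.max (rcdf mu t) (rcdf nu t).
have ab : (a <= b)%R by rewrite ge_min le_max lexx.
have -> : `|rcdf mu t - rcdf nu t|%:E = leb `]a, b]%classic.
  rewrite lebesgue_measure_itv/= lte_fin -EFinD.
  rewrite /a /b; case: (ltgtP (rcdf mu t) (rcdf nu t)) => h.
  - by rewrite h distrC gtr0_norm// subr_gt0.
  - by rewrite h gtr0_norm// subr_gt0.
  - by rewrite h ltxx subrr normr0.
apply: le_measure; rewrite ?inE//.
  apply: measurableI => //; rewrite -[X in measurable X]setTI.
  by apply: mf => //; exact: measurable_crossed.
move=> u /= [H]; rewrite !in_itv/= /a /b gt_min le_max => u01.
move: H; rewrite /crosses/= ![(t < _)%R]ltNge !quantile01P// -!ltNge.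
by case=> /andP[-> ->]; rewrite ?orbT.
Qed.

Lemma AsetE (mu nu : probability Rm R) :
  Aset mu nu = [set x | rcdf mu x = rcdf nu x].
Proof.
apply/seteqP; split => x; rewrite /Aset /Defs.cdf /= -!rcdfE.
  by case.
by move=> ->.
Qed.

Lemma measurable_rcdf (P : probability Rm R) : measurable_fun setT (rcdf P).
Proof. by apply: nondecreasing_measurable => // s t; exact: rcdf_nd. Qed.

Lemma measurable_Aset (mu nu : probability Rm R) : measurable (Aset mu nu : set Rm).
Proof.
rewrite AsetE -[X in measurable X]setTI.
rewrite (_ : _ `&` _ = setT `&` (fun x => rcdf mu x == rcdf nu x) @^-1` [set true]).
  by apply: (measurable_fun_eqr (measurable_rcdf mu) (measurable_rcdf nu)).
by apply/seteqP; split => x /= [_ /eqP].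
Qed.

(** Off [A] every plan crosses [t] at least as much as the monotone plan, by [rcdf_crossed]. On [A]
    the monotone plan does not cross at all, so the crossings of [g] there are pure excess, and by
    Tonelli they integrate to the gap. *)
Lemma W1_gap (mu nu : probability Rm R) (g : probability (Rm * Rm)%type R) :
  Plans mu nu g ->
  W1 mu nu + \int[g]_p gapA (Aset mu nu) p <= cost g.
Proof.
move=> gP; have mA := measurable_Aset mu nu; set A := Aset mu nu in mA *.
have mAC : measurable (~` A : set Rm) by exact: measurableC.
have mg := measurable_crossed_fun g.
have TE : [set: Rm] = (~` A : set Rm) `|` A by rewrite setvU.
rewrite cost_crossing crossing_tonelli//.
rewrite [in leRHS]TE ge0_integral_setU//=; last 2 first.
- by rewrite -TE.
- by apply/disj_setPS; rewrite setICl.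
rewrite leeD2r//.
have [M MP MA] := exists_monotone_plan mu nu.
apply: (@le_trans _ _ (cost M)).
  by apply: ereal_inf_lbound; exists M.
rewrite cost_crossing.
have md : measurable_fun setT (fun t : Rm => (`|rcdf mu t - rcdf nu t|)%:E).
  apply/measurable_EFinP; apply: measurableT_comp => //.
  by apply: measurable_funB; exact: measurable_rcdf.
apply: (@le_trans _ _ (\int[leb]_t (`|rcdf mu t - rcdf nu t|)%:E)).
  by apply: ge0_le_integral => //; exact: measurable_crossed_fun.
rewrite [in leLHS]TE ge0_integral_setU//=; last 2 first.
- by rewrite -TE.
- by apply/disj_setPS; rewrite setICl.
rewrite [X in _ + X](_ : _ = 0) ?adde0; last first.
  apply: integral0_eq => x; rewrite /A AsetE /= => ->.
  by rewrite subrr normr0.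
apply: ge0_le_integral => //.
- exact: measurable_funTS.
- exact: measurable_funTS.
- by move=> t _; exact: rcdf_crossed.
Qed.

End monotone_plan.

(** * Integrals of exponentials of the gap *)

Section exponential_tail.
Context {R : realType}.
Local Notation Rm := (measurableTypeR R).
Local Notation leb := (@lebesgue_measure R).
Variable c : R.
Hypothesis c0 : (0 < c)%R.

Lemma exponential_probability :
  exists P : probability Rm R, forall B, P B = exponential_prob c B.
Proof. by unshelve eexists (exponential_prob c : probability Rm R). Qed.

Lemma exponential_tail (t : R) : (0 <= t)%R ->
  exponential_prob c `]t, +oo[%classic = (expR (- c * t))%:E.
Proof.
move=> t0; have [P PE] := exponential_probability.
have P0 : P `]-oo, 0%R[%classic = 0.
  rewrite PE /exponential_prob; apply: integral0_eq => x /=.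
  by rewrite in_itv/= => x0; rewrite lt0_exponential_pdf.
have Pt : P `[0%R, t]%classic = 1 - (expR (- c * t))%:E.
  move: t0; rewrite le_eqVlt => /predU1P[<-|t0]; last first.
    by rewrite PE exponential_prob_itv0c.
  rewrite PE /exponential_prob set_itv1 integral_set1 mulr0 expR0.
  by rewrite subee.
have : P setT = 1 by exact: probability_setT.
have -> : [set: Rm] = `]-oo, 0%R[%classic `|` (`[0%R, t]%classic `|` `]t, +oo[%classic).
  apply/esym/seteqP; split => // x _ /=; rewrite !in_itv/= andbT.
  by have [x0|x0] := ltP x 0%R; [left|right; rewrite leNgt; case: (t < x)%R; [right|left]].
rewrite measureU//; last 2 first.
- exact: measurableU.
- apply/seteqP; split => // x /=; rewrite !in_itv/= andbT => -[x0 [/andP[]|tx]].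
    by rewrite leNgt x0.
  by move: (lt_trans x0 (le_lt_trans t0 tx)); rewrite ltxx.
rewrite [X in _ + X]measureU//; last first.
  apply/seteqP; split => // x /=; rewrite !in_itv/= andbT => -[/andP[_ xt] tx].
  by move: (le_lt_trans xt tx); rewrite ltxx.
rewrite [X in X + _]P0 [X in _ + (X + _)]Pt add0e -PE.
move=> H; have {H} : 1 - (expR (- c * t))%:E + P `]t, +oo[%classic = 1 := H.
have : P `]t, +oo[%classic \is a fin_num by rewrite fin_num_measure.
case: (P _) => // r _; rewrite -EFinB -EFinD => -[H].
by congr EFin; move: H; lra.
Qed.

Lemma integral_exp_itv0y :
  \int[leb]_(u in `]0%R, +oo[) (expR (- c * u))%:E = (c^-1)%:E.
Proof.
have mE D : measurable_fun D (fun u : R => (expR (- c * u))%:E).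
  apply/measurable_EFinP; apply: measurable_funTS.
  by apply: measurableT_comp => //; exact: measurable_funM.
have := exponential_tail (lexx 0%R).
rewrite mulr0 expR0 /exponential_prob.
rewrite (eq_integral (fun x : Rm => c%:E * (expR (- c * x))%:E)); last first.
  move=> x; rewrite inE/= in_itv/= andbT => x0.
  by rewrite exponential_pdfE ?EFinM// ltW.
rewrite ge0_integralZl_EFin//; [|exact: mE|exact: ltW].
move=> H; rewrite -[LHS]mul1e -(mulVf (lt0r_neq0 c0)) EFinM -muleA H.
by rewrite mule1.
Qed.

(** Layer-cake formula: [exp (- c t)] is the probability that an exponential variable of rate [c]
    exceeds [t], so the integral is the mean measure of a sublevel set at a random height. *)
Lemma tail_tonelli (P : probability Rm R) (B : set Rm) (t : Rm -> R) :
  (forall D, P D = exponential_prob c D) -> measurable B ->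
  measurable_fun setT t -> (forall x, (0 <= t x)%R) ->
  \int[leb]_(x in B) (expR (- c * t x))%:E =
  \int[P]_s leb (B `&` [set x | (t x < s)%R]).
Proof.
move=> PE mB mt t0.
pose C : set (Rm * Rm) := [set z | B z.1 /\ (t z.1 < z.2)%R].
have mC : measurable C.
  rewrite (_ : C = (setT `&` fst @^-1` B) `&`
     (setT `&` (fun z : Rm * Rm => (t z.1 < z.2)%R) @^-1` [set true])).
    apply: measurableI; first exact: (@measurable_fst _ _ Rm Rm).
    apply: (_ : measurable_fun _ _) => //.
    apply: measurable_fun_ltr; last exact: measurable_snd.
    exact: (measurableT_comp mt measurable_fst).
  by apply/seteqP; split => z /=; [case|case=> -[_ ?] [_ ?]].
transitivity (\int[leb]_x fubini_F P (EFin \o \1_C) x).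
  rewrite indic_fubini_tonelli_FE// integral_mkcond; apply: eq_integral => x _ /=.
  rewrite patchE; case: ifPn => xB.
    rewrite -exponential_tail// -PE; congr (P _); apply/seteqP; split => s /=.
      by rewrite in_itv/= andbT => ts; apply/xsectionP; split => //; rewrite inE in xB.
    by move/xsectionP => -[_ /=]; rewrite in_itv/= andbT.
  rewrite (_ : xsection _ _ = set0) ?measure0//.
  by apply/seteqP; split => // s /xsectionP[/=]; rewrite notin_setE in xB.
rewrite indic_fubini_tonelli// indic_fubini_tonelli_GE//.
apply: eq_integral => s _ /=; congr (leb _); apply/seteqP; split => x /=.
  by move/ysectionP => -[].
by move=> H; apply/ysectionP.
Qed.

Lemma measurable_sublevel (B : set Rm) (t : Rm -> R) (s : R) : measurable B ->
  measurable_fun setT t -> measurable (B `&` [set x | (t x < s)%R]).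
Proof.
move=> mB mt; apply: measurableI => //.
rewrite (_ : [set _ | _] = setT `&` t @^-1` `]-oo, s[%classic).
  exact: mt.
by apply/seteqP; split => x /=; rewrite in_itv//= => -[].
Qed.

Lemma measurable_sublevel_fun (B : set Rm) (t : Rm -> R) : measurable B ->
  measurable_fun setT t ->
  measurable_fun setT (fun s : Rm => leb (B `&` [set x | (t x < s)%R])).
Proof.
move=> mB mt.
pose C : set (Rm * Rm) := [set z | B z.1 /\ (t z.1 < z.2)%R].
have mC : measurable C.
  rewrite (_ : C = (setT `&` fst @^-1` B) `&`
     (setT `&` (fun z : Rm * Rm => (t z.1 < z.2)%R) @^-1` [set true])).
    apply: measurableI; first exact: (@measurable_fst _ _ Rm Rm).
    apply: (_ : measurable_fun _ _) => //.
    apply: measurable_fun_ltr; last exact: measurable_snd.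
    exact: (measurableT_comp mt measurable_fst).
  by apply/seteqP; split => z /=; [case|case=> -[_ ?] [_ ?]].
have := measurable_fun_ysection leb mC.
congr (measurable_fun _ _); apply/funext => s; congr (leb _).
by apply/seteqP; split => p /=; [move/ysectionP => -[]|move=> H; apply/ysectionP].
Qed.

(** By the layer-cake formula only the measures of the sublevel sets matter. They are dominated by
    those of the identity on the half-line, whose exponential has integral [1 / c]. *)
Lemma integral_exp_le (B : set Rm) (t : Rm -> R) : measurable B ->
  measurable_fun setT t -> (forall x, (0 <= t x)%R) ->
  (forall s, (0 < s)%R -> leb (B `&` [set x | (t x < s)%R]) <= s%:E) ->
  \int[leb]_(x in B) (expR (- c * t x))%:E <= (c^-1)%:E.
Proof.
move=> mB mt t0 H; have [P PE] := exponential_probability.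
rewrite (tail_tonelli PE)//.
(* The absolute value replaces the identity because [tail_tonelli] asks for nonnegativity on the
   whole line. *)
have mn : measurable_fun setT (fun x : Rm => `|x|%R : R) by exact: measurableT_comp.
have -> : (c^-1)%:E = \int[leb]_(x in `]0%R, +oo[) (expR (- c * `|x|))%:E.
  rewrite -integral_exp_itv0y; apply: eq_integral => x.
  by rewrite inE/= in_itv/= andbT => x0; rewrite gtr0_norm.
rewrite (tail_tonelli PE)//; apply: ge0_le_integral => //.
- exact: measurable_sublevel_fun.
- exact: measurable_sublevel_fun.
- move=> s _; have [s0|s0] := ltP 0%R s.
    apply: le_trans (H _ s0) _.
    rewrite (_ : _ `&` _ = `]0%R, s[%classic).
      by rewrite lebesgue_measure_itv/= lte_fin s0 sube0.
    apply/seteqP; split => x /=; rewrite !in_itv/= andbT.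
      by move=> [x0]; rewrite gtr0_norm// x0.
    by move=> /andP[x0]; rewrite gtr0_norm.
  rewrite (_ : B `&` _ = set0) ?measure0//.
  apply/seteqP; split => // x /= [_ tx].
  by move: (le_lt_trans (t0 x) (lt_le_trans tx s0)); rewrite ltxx.
Qed.

End exponential_tail.

Section gap_kernel.
Context {R : realType}.
Local Notation Rm := (measurableTypeR R).
Local Notation leb := (@lebesgue_measure R).
Variable A : set Rm.
Hypothesis mA : measurable A.

Definition gap (p : R * R) : R := fine (gapA A p).

Lemma gapA_le p : gapA A p <= (`|p.2 - p.1|)%:E.
Proof.
rewrite -leb_crosses; apply: le_measure; rewrite ?inE.
- by apply: measurableI => //; exact: measurable_crosses.
- exact: measurable_crosses.
- by move=> x [].
Qed.

Lemma gapE p : (gap p)%:E = gapA A p.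
Proof.
rewrite fineK// ge0_fin_numE; last exact: measure_ge0.
by apply: le_lt_trans (gapA_le p) _; rewrite ltry.
Qed.

Lemma gap_ge0 p : (0 <= gap p)%R.
Proof. by rewrite -lee_fin gapE; exact: measure_ge0. Qed.

Lemma measurable_gap : measurable_fun setT (gap : Rm * Rm -> R).
Proof.
apply/measurable_EFinP; rewrite [X in measurable_fun _ X](_ : _ = gapA A).
  exact: measurable_gapA.
by apply/funext => p /=; rewrite gapE.
Qed.

Lemma gapC x y : gap (x, y) = gap (y, x).
Proof.
rewrite /gap /gapA; congr (fine (leb (_ `&` _))).
by apply/seteqP; split => t /= [?|?]; by [left|right].
Qed.

Lemma measurable_gapl (y : R) : measurable_fun setT (fun x : Rm => gap (x, y)).
Proof.
by apply: (measurableT_comp measurable_gap); exact: measurable_fun_pair.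
Qed.

(** Inner regularity: a compact subset contains its extreme points, and it is at an extreme point
    that the gap is evaluated below. *)
Lemma compact_le_measure (B : set R) (s : \bar R) : measurable (B : set Rm) ->
  (forall K, compact K -> K `<=` B -> K !=set0 -> leb K <= s) -> 0 <= s -> leb B <= s.
Proof.
move=> mB H s0; rewrite lebesgue_regularity_inner_sup//.
apply: ge_ereal_sup => _ [K [cK KB] <-].
have [->|/set0P K0] := eqVneq K set0; first by rewrite measure0.
exact: H.
Qed.

(** Let [z] be the largest point of a compact subset [K]. Apart from [z], all of [K] is a part of
    [A] crossed between [y] and [z], so its measure is at most [gap (z, y) < s]. *)
Lemma sublevel_gap_right (y s : R) : (0 < s)%R ->
  leb ((A `&` `[y, +oo[%classic) `&` [set x | (gap (x, y) < s)%R]) <= s%:E.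
Proof.
move=> s0.
have mS : measurable ((A `&` `[y, +oo[%classic) `&` [set x : Rm | (gap (x, y) < s)%R]).
  apply: measurable_sublevel; last exact: measurable_gapl.
  exact: measurableI.
apply: compact_le_measure => //; last by rewrite lee_fin ltW.
move=> K cK KB K0.
have cid : {within K, continuous (@id R)}.
  by apply: continuous_subspaceT => x; exact: cvg_id.
have [z zK Kz] := @compact_EVT_max R R id K K0 cK cid.
have [[/= Az]] := KB _ (set_mem zK); rewrite in_itv/= andbT => yz zs.
have mK : measurable (K : set Rm) by exact: compact_measurable.
(* [crosses] leaves out its right endpoint, here [z], hence the added singleton. On the other side
   of [y] the extreme point is the left endpoint and is included. *)
apply: (@le_trans _ _ (gapA A (z, y) + leb [set z])).
  apply: le_trans (measureU2 _ _ _) => //; last first.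
    by apply: measurableI => //; exact: measurable_crosses.
  apply: le_measure; rewrite ?inE//.
    by apply: measurableU => //; apply: measurableI => //; exact: measurable_crosses.
  move=> x Kx; have [[/= Ax]] := KB _ Kx; rewrite in_itv/= andbT => yx _.
  have := Kz x (mem_set Kx); rewrite le_eqVlt => /predU1P[->|xz]; first by right.
  by left; split => //; right; rewrite /= yx xz.
by rewrite lebesgue_measure_set1 adde0 -gapE lee_fin ltW.
Qed.

Lemma sublevel_gap_left (y s : R) : (0 < s)%R ->
  leb ((A `&` `]-oo, y[%classic) `&` [set x | (gap (x, y) < s)%R]) <= s%:E.
Proof.
move=> s0.
have mS : measurable ((A `&` `]-oo, y[%classic) `&` [set x : Rm | (gap (x, y) < s)%R]).
  apply: measurable_sublevel; last exact: measurable_gapl.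
  exact: measurableI.
apply: compact_le_measure => //; last by rewrite lee_fin ltW.
move=> K cK KB K0.
have cid : {within K, continuous (@id R)}.
  by apply: continuous_subspaceT => x; exact: cvg_id.
have [z zK Kz] := @compact_EVT_min R R id K K0 cK cid.
have [[/= Az]] := KB _ (set_mem zK); rewrite in_itv/= => yz zs.
have mK : measurable (K : set Rm) by exact: compact_measurable.
apply: (@le_trans _ _ (gapA A (z, y))).
  apply: le_measure; rewrite ?inE//.
    by apply: measurableI => //; exact: measurable_crosses.
  move=> x Kx; have [[/= Ax]] := KB _ Kx; rewrite in_itv/= => yx _.
  by split => //; left; rewrite /= yx andbT; exact: Kz (mem_set Kx).
by rewrite -gapE lee_fin ltW.
Qed.

(** Each side of [y] contributes [1 / c]. With [c = 1 / eps] this is the [2 eps] inside the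
    logarithm of [Feps]. *)
Lemma gap_kernel_le (c y : R) : (0 < c)%R ->
  \int[leb]_(x in A) (expR (- c * gap (x, y)))%:E <= (2 / c)%:E.
Proof.
move=> c0.
have mt := measurable_gapl y.
have AE : A = (A `&` `[y, +oo[%classic) `|` (A `&` `]-oo, y[%classic).
  rewrite -setIUr (_ : _ `|` _ = setT) ?setIT//; apply/seteqP; split => // x _ /=.
  by rewrite !in_itv/= andbT; case: leP; [left|right].
have m1 : measurable (A `&` `[y, +oo[%classic) by exact: measurableI.
have m2 : measurable (A `&` `]-oo, y[%classic) by exact: measurableI.
rewrite [X in \int[leb]_(_ in X) _]AE ge0_integral_setU//=; last 2 first.
- apply/measurable_EFinP; apply: measurable_funTS; apply: measurableT_comp => //.
  exact: measurable_funM.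
- apply/disj_setPS => x [[_ /=]]; rewrite in_itv/= andbT => yx [_ /=].
  by rewrite in_itv/= ltNge yx.
have -> : (2 / c)%R = (c^-1 + c^-1)%R by lra.
rewrite EFinD; apply: leeD; apply: integral_exp_le => //.
- by move=> x; exact: gap_ge0.
- by move=> s; exact: sublevel_gap_right.
- by move=> x; exact: gap_ge0.
- by move=> s; exact: sublevel_gap_left.
Qed.

End gap_kernel.

(** * Optimal plans over [A] *)

Section optimal_structure.
Context {R : realType}.
Local Notation Rm := (measurableTypeR R).
Local Notation leb := (@lebesgue_measure R).
Variable A : set Rm.
Hypothesis mA : measurable A.

Lemma measurable_gap_level (r : R) : measurable [set x : Rm | gap A (x, r) = 0%R].
Proof.
rewrite (_ : [set _ | _] = setT `&` (fun x : Rm => gap A (x, r)) @^-1` [set 0%R]).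
  by apply: measurable_gapl.
by apply/seteqP; split => x /=; [split|case].
Qed.

Let leb_flat r : leb (A `&` [set x | gap A (x, r) = 0%R]) = 0.
Proof.
apply/le_anti/andP; split; last exact: measure_ge0.
apply/lee_addgt0Pr => e e0; rewrite add0e.
have e2 : (0 < e / 2)%R by rewrite divr_gt0.
have m1 := measurable_sublevel (e / 2)%R (measurableI _ _ mA (measurable_itv `[r, +oo[)) (measurable_gapl mA r).
have m2 := measurable_sublevel (e / 2)%R (measurableI _ _ mA (measurable_itv `]-oo, r[)) (measurable_gapl mA r).
have m0 : measurable (A `&` [set x : Rm | gap A (x, r) = 0%R]).
  by apply: measurableI => //; exact: measurable_gap_level.
rewrite [e]splitr EFinD.
apply: le_trans (leeD (sublevel_gap_right mA r e2) (sublevel_gap_left mA r e2)).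
apply: le_trans (measureU2 _ _ _) => //.
apply: le_measure; rewrite ?inE//; first exact: measurableU.
move=> x [Ax /= x0].
by have [rx|xr] := leP r x; [left|right]; split; rewrite /= ?x0//; split => //=;
  rewrite in_itv/= ?andbT.
Qed.

Lemma gap_le_sub x y z : (x <= z <= y)%R -> (gap A (x, z) <= gap A (x, y))%R.
Proof.
move=> /andP[xz zy]; rewrite -lee_fin !gapE//; apply: le_measure; rewrite ?inE.
- by apply: measurableI => //; exact: measurable_crosses.
- by apply: measurableI => //; exact: measurable_crosses.
- move=> t [At H]; split => //; case: H => /= /andP[a b]; last first.
    by move: (le_lt_trans (le_trans xz a) b); rewrite ltxx.
  by left; rewrite /= a (lt_le_trans b zy).
Qed.

Lemma gap_le_sub' x y z : (y <= z <= x)%R -> (gap A (x, z) <= gap A (x, y))%R.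
Proof.
move=> /andP[yz zx]; rewrite -lee_fin !gapE//; apply: le_measure; rewrite ?inE.
- by apply: measurableI => //; exact: measurable_crosses.
- by apply: measurableI => //; exact: measurable_crosses.
- move=> t [At H]; split => //; case: H => /= /andP[a b].
    by move: (le_lt_trans (le_trans zx a) b); rewrite ltxx.
  by right; rewrite /= (le_trans yz a) b.
Qed.

(** If [gap (x, y) = 0], monotonicity gives gap 0 from [x] to every point between, in particular to
    a rational one. The uncountable union over [y] thus reduces to the countably many null sets of
    [leb_flat]. *)
Lemma flat_negligible :
  leb.-negligible (A `&` [set x | exists2 y, gap A (x, y) = 0%R & x <> y]).
Proof.
pose F n : set Rm := if unpickle n is Some q then
   A `&` [set x | gap A (x, ratr (q : rat)) = 0%R] else set0.
apply: (@negligibleS _ _ _ _ (\bigcup_n F n)); last first.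
  apply: negligible_bigcup => n; rewrite /F; case: (unpickle n) => [q|].
    exists (A `&` [set x | gap A (x, ratr q) = 0%R]); split.
    - by apply: measurableI => //; exact: measurable_gap_level.
    - exact: leb_flat.
    - by [].
  exact: negligible_set0.
move=> x /= [Ax [y xy0 xy]].
suff [q Hq] : exists q : rat, gap A (x, ratr q) = 0%R.
  have [n nE] : exists n, unpickle n = Some q :> option rat.
    by exists (pickle q); exact: pickleK.
  by exists n; [exact: I|rewrite /F nE].
have [lt|lt|//] := ltgtP x y.
  have [q] := rat_in_itvoo lt; rewrite in_itv/= => /andP[xq qy].
  exists q; apply/le_anti; rewrite gap_ge0// andbT -xy0.
  by apply: gap_le_sub; rewrite (ltW xq) (ltW qy).
have [q] := rat_in_itvoo lt; rewrite in_itv/= => /andP[yq qx].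
exists q; apply/le_anti; rewrite gap_ge0// andbT -xy0.
by apply: gap_le_sub'; rewrite (ltW yq) (ltW qx).
Qed.

Variable g : probability (Rm * Rm)%type R.
Variables mu nu : probability Rm R.
Hypothesis gP : Plans mu nu g.
Hypothesis mu_leb : forall B : set Rm, measurable B -> leb B = 0 -> mu B = 0.
Hypothesis nu_leb : forall B : set Rm, measurable B -> leb B = 0 -> nu B = 0.
Hypothesis g0 : \int[g]_p gapA A p = 0.

(** A vanishing integral forces [gap = 0] almost surely. An off-diagonal pair with zero gap and a
    coordinate in [A] has that coordinate in the null set of [flat_negligible], which the absolutely
    continuous marginals do not charge. *)
Lemma plan_diagonal :
  g.-negligible [set p : Rm * Rm | (A p.1 \/ A p.2) /\ p.1 <> p.2].
Proof.
have [N [mN N0 AN]] := flat_negligible.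
have [Z [mZ Z0 gZ]] : g.-negligible [set p | gap A p <> 0%R].
  have mg : measurable_fun setT (EFin \o gap A : Rm * Rm -> \bar R).
    by apply/measurable_EFinP; exact: measurable_gap.
  have : \int[g]_(x in setT) `|(EFin \o gap A) x| = 0.
    rewrite -[RHS]g0; apply: eq_integral => p _ /=.
    by rewrite ger0_norm ?gap_ge0// gapE//.
  move/(ae_eq_integral_abs _ measurableT mg) => [Z [mZ Z0 H]].
  exists Z; split => // p /= gp; apply: H => /= /(_ I) [].
  exact: gp.
exists (Z `|` (N `*` setT `|` setT `*` N)); split.
- by apply: measurableU => //; apply: measurableU; exact: measurableX.
- have NT0 : g (N `*` setT) = 0 by rewrite gP.1// mu_leb.
  have TN0 : g (setT `*` N) = 0 by rewrite gP.2// nu_leb.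
  have mNT : measurable (N `*` [set: Rm]) by exact: measurableX.
  have mTN : measurable ([set: Rm] `*` N) by exact: measurableX.
  apply/le_anti/andP; split; last exact: measure_ge0.
  apply: le_trans (measureU2 _ _ _) _ => //; first exact: measurableU.
  rewrite [X in X + _]Z0 add0e.
  apply: le_trans (measureU2 _ _ _) _ => //.
  by rewrite [X in X + _]NT0 [X in _ + X]TN0 add0e.
- move=> [x y] /= [Axy xy].
  have [gp|gp] := pselect (gap A (x, y) = 0%R); last by left; exact: gZ.
  right; case: Axy => [Ax|Ay].
    by left; split => //; apply: AN; split => //; exists y.
  right; split => //; apply: AN; split => //; exists x.
    by rewrite gapC.
  by move=> yx; apply: xy.
Qed.

(** Up to a null set, pairs touching [A] lie on the diagonal, so the mass of a set is decided by its
    diagonal points over [A] and by the pairs avoiding [A]. The statements on mixed rectangles and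
    on marginals are instances. *)
Lemma plan_diag_eq (B C : set (Rm * Rm)) : measurable B -> measurable C ->
  (forall p, (A p.1 \/ A p.2) -> p.1 = p.2 -> B p <-> C p) ->
  (forall p, ~ (A p.1 \/ A p.2) -> B p <-> C p) ->
  g B = g C.
Proof.
move=> mB mC H1 H2; have [Z [mZ Z0 gZ]] := plan_diagonal.
have sub (B' C' : set (Rm * Rm)) : measurable B' -> measurable C' ->
   (B' `<=` C' `|` Z) -> g B' <= g C'.
  move=> mB' mC' BC; apply: (@le_trans _ _ (g (C' `|` Z))).
    by apply: le_measure; rewrite ?inE//; exact: measurableU.
  by apply: le_trans (measureU2 _ _ _) _ => //; rewrite [X in _ + X]Z0 adde0.
have key p : ~ Z p -> (B p <-> C p).
  move=> Zp; have [Ap|Ap] := pselect (A p.1 \/ A p.2); last exact: H2.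
  apply: H1 => //; apply: contrapT => pp; apply: Zp.
  by apply: gZ.
by apply/le_anti/andP; split; apply: sub => // p Bp;
  have [Zp|/key[h1 h2]] := pselect (Z p); [right|left; tauto|right|left; tauto].
Qed.

Lemma plan_mixed1 : g (A `*` ~` A) = 0.
Proof.
have mAC : measurable (~` A) by exact: measurableC.
rewrite -[RHS](measure0 g); apply: plan_diag_eq => //; first exact: measurableX.
  by move=> [x y] /= _ <-; split => // -[].
by move=> [x y] /= h; split => // -[Ax _]; exfalso; apply: h; left.
Qed.

Lemma plan_mixed2 : g (~` A `*` A) = 0.
Proof.
have mAC : measurable (~` A) by exact: measurableC.
rewrite -[RHS](measure0 g); apply: plan_diag_eq => //; first exact: measurableX.
  by move=> [x y] /= _ <-; split => // -[].
by move=> [x y] /= h; split => // -[_ Ax]; exfalso; apply: h; right.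
Qed.

Lemma plan_marginal_eq (B : set Rm) : measurable B -> B `<=` A -> mu B = nu B.
Proof.
move=> mB BA; rewrite -gP.1// -gP.2//; apply: plan_diag_eq; try exact: measurableX.
  by move=> [x y] /= _ <-; split => -[].
move=> [x y] /= h; split => [[Bx _]|[_ By]]; exfalso; apply: h.
  by left; exact: BA.
by right; exact: BA.
Qed.

End optimal_structure.

(** * Young's inequality tested on plans *)

Lemma gibbs_inequality d (T : measurableType d) (R : realType)
    (rho gam : {measure set T -> \bar R}) (q H1 H2 C : T -> R) :
  rho setT = 1 -> is_density rho gam q ->
  measurable_fun setT H1 -> (forall x, (0 <= H1 x)%R) ->
  measurable_fun setT H2 -> (forall x, (0 <= H2 x)%R) ->
  measurable_fun setT C -> (forall x, (0 <= C x)%R) ->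
  \int[gam]_x (H1 x)%:E + 1 <=
  \int[gam]_x (H2 x)%:E + \int[gam]_x (C x)%:E + \int[rho]_x (phi (q x))%:E +
  \int[rho]_x (expR (H1 x - H2 x - C x))%:E.
Proof.
move=> r1 dq mH1 H10 mH2 H20 mC C0; have [mq q0 _] := dq.
have mqH (H : T -> R) : measurable_fun setT H ->
    measurable_fun setT (fun x => (H x * q x)%:E).
  by move=> mH; apply/measurable_EFinP; exact: measurable_funM.
have E (H : T -> R) : measurable_fun setT H -> (forall x, (0 <= H x)%R) ->
    \int[gam]_x (H x)%:E = \int[rho]_x (H x * q x)%:E.
  move=> mH H0; have mHE : measurable_fun setT (fun x => (H x)%:E).
    exact/measurable_EFinP.
  rewrite (ge0_integral_density dq)//.
  by move=> x _; rewrite lee_fin.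
have p0 (H : T -> R) x : (forall x, (0 <= H x)%R) -> 0 <= (H x * q x)%:E.
  by move=> H0; rewrite lee_fin mulr_ge0.
have mphi : measurable_fun setT (fun x => (phi (q x))%:E).
  by apply/measurable_EFinP; apply: measurableT_comp => //; exact: measurable_phi.
have mexp : measurable_fun setT (fun x => (expR (H1 x - H2 x - C x))%:E).
  apply/measurable_EFinP; apply: measurableT_comp => //.
  by apply: measurable_funB => //; exact: measurable_funB.
have phi0 x : 0 <= (phi (q x))%:E by rewrite lee_fin phi_ge0.
have m1 : measurable_fun setT (cst 1 : T -> \bar R) by exact: measurable_cst.
have -> : 1 = \int[rho]_x (cst 1 x) by rewrite integral_cst// mul1e r1.
have add (a b : T -> \bar R) : measurable_fun setT a -> measurable_fun setT b ->
    (forall x, 0 <= a x) -> (forall x, 0 <= b x) ->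
    \int[rho]_x a x + \int[rho]_x b x = \int[rho]_x (a \+ b) x.
  by move=> ma mb a0 b0; rewrite ge0_integralD.
have madd (a b : T -> \bar R) : measurable_fun setT a -> measurable_fun setT b ->
    measurable_fun setT (a \+ b) by exact: emeasurable_funD.
have pos (a b : T -> \bar R) : (forall x, 0 <= a x) -> (forall x, 0 <= b x) ->
    (forall x, 0 <= (a \+ b) x) by move=> a0 b0 x; exact: adde_ge0.
have mq1 := mqH _ mH1; have mq2 := mqH _ mH2; have mqc := mqH _ mC.
have p1 x := p0 _ x H10; have p2 x := p0 _ x H20; have pc x := p0 _ x C0.
have pe x : 0 <= (expR (H1 x - H2 x - C x))%:E by rewrite lee_fin expR_ge0.
rewrite !E//.
rewrite (add _ (cst 1))// (add _ _ mq2 mqc)//.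
rewrite (add _ _ (madd _ _ mq2 mqc) mphi (pos _ _ p2 pc))//.
rewrite (add _ _ (madd _ _ (madd _ _ mq2 mqc) mphi) mexp (pos _ _ (pos _ _ p2 pc) phi0))//.
apply: ge0_le_integral => //.
- by move=> x _; exact: (pos _ (cst 1) p1).
- exact: (madd _ (cst 1)).
- exact: (madd _ _ (madd _ _ (madd _ _ mq2 mqc) mphi) mexp).
(* Pointwise Young inequality with exponent [H1 - H2 - C]. The negative terms have been moved to the
   right, so that all integrands are nonnegative; the constant 1 integrates to the mass of [rho]. *)
- move=> x _ /=; rewrite -!EFinD lee_fin.
  by have := young_phi (H1 x - H2 x - C x)%R (q0 x); lra.
Qed.

Section plan_integrals.
Context {R : realType}.
Local Notation Rm := (measurableTypeR R).
Variables (mu nu : probability Rm R) (g : probability (Rm * Rm)%type R).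
Hypothesis gP : Plans mu nu g.

Lemma plan_integral1 (h : Rm -> \bar R) : measurable_fun setT h ->
  (forall x, 0 <= h x) -> \int[g]_p h p.1 = \int[mu]_x h x.
Proof.
move=> mh h0; have [m mE] := pushforward_measure g (@measurable_fst _ _ Rm Rm).
have -> : \int[mu]_x h x = \int[pushforward g fst]_x h x.
  apply: eq_measure_integral => B mB _ /=; rewrite -gP.1//.
  by rewrite /pushforward; congr (g _); apply/seteqP; split => p /=; [case|].
by rewrite ge0_integral_pushforward.
Qed.

Lemma prodT : (mu \x nu) setT = 1.
Proof.
by rewrite -setXTT product_measure1E// ![_ setT]probability_setT mul1e.
Qed.

End plan_integrals.

Lemma integral_indicM d (T : measurableType d) (R : realType)
    (m : {measure set T -> \bar R}) (B : set T) (h : T -> R) : measurable B ->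
  \int[m]_x (\1_B x * h x)%:E = \int[m]_(x in B) (h x)%:E.
Proof.
move=> mB; rewrite [RHS]integral_mkcond; apply: eq_integral => x _.
by rewrite patchE indicE; case: ifPn => _; rewrite ?mul1r ?mul0r.
Qed.

Section ln_parts.
Context {R : realType}.
Local Open Scope ring_scope.

(** Real-valued positive and negative parts of the logarithm; both vanish at arguments [t <= 0],
    where [ln] is 0 by convention. *)
Definition lnpos (t : R) : R := Num.max (ln t) 0.
Definition lnneg (t : R) : R := Num.max (- ln t) 0.

Lemma lnposneg t : lnpos t - lnneg t = ln t.
Proof.
rewrite /lnpos /lnneg; case: (leP (ln t) 0) => h.
  by rewrite max_l ?sub0r ?opprK// oppr_ge0.
by rewrite max_r ?subr0// oppr_le0 ltW.
Qed.

Lemma lnpos_ge0 t : 0 <= lnpos t. Proof. by rewrite le_max lexx orbT. Qed.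
Lemma lnneg_ge0 t : 0 <= lnneg t. Proof. by rewrite le_max lexx orbT. Qed.

Lemma measurable_lnpos : measurable_fun setT lnpos.
Proof. by apply: measurable_maxr => //; exact: measurable_ln. Qed.

Lemma measurable_lnneg : measurable_fun setT lnneg.
Proof.
by apply: measurable_maxr => //; apply: measurableT_comp => //; exact: measurable_ln.
Qed.

End ln_parts.

Section gibbs_plan.
Context {R : realType}.
Local Notation Rm := (measurableTypeR R).
Local Notation leb := (@lebesgue_measure R).
Variables (mu nu : probability Rm R) (A : set Rm) (f : Rm -> R).
Hypothesis mA : measurable A.
Hypothesis df : is_density leb mu f.
Variable eps : R.
Hypothesis eps0 : (0 < eps)%R.

Let L := (- ln (2 * eps))%R.
(** Exponential of the test function over [A]. Multiplied by [f] it is at most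
    [exp (- gap / eps) / (2 eps)], so its [mu]-integral in the first variable is at most 1 for every
    [y]. *)
Let G (p : Rm * Rm) : R := (\1_A p.1 * expR (L - ln (f p.1) - eps^-1 * gap A p))%R.

Let mf : measurable_fun setT f. Proof. by case: df. Qed.
Let mlnf : measurable_fun setT (fun x => ln (f x)).
Proof. by apply: measurableT_comp => //; exact: measurable_ln. Qed.

Let mi : measurable_fun setT (\1_A : Rm -> R).
Proof. exact: measurable_indic. Qed.

Let mG : measurable_fun setT G.
Proof.
apply: measurable_funM.
  exact: (measurableT_comp mi measurable_fst).
apply: measurableT_comp => //; apply: measurable_funB.
  by apply: measurable_funB => //; exact: (measurableT_comp mlnf measurable_fst).
by apply: measurable_funM => //; exact: measurable_gap.
Qed.

Let G0 p : (0 <= G p)%R.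
Proof. by rewrite mulr_ge0 ?expR_ge0. Qed.

Let G_le1 y : \int[mu]_x (G (x, y))%:E <= 1.
Proof.
have mGy : measurable_fun setT (fun x => (G (x, y))%:E).
  by apply/measurable_EFinP; apply: (measurableT_comp mG); exact: measurable_fun_pair.
rewrite (ge0_integral_density df)//; last by move=> x _; rewrite lee_fin.
have mk : measurable_fun setT (fun x => (expR (- eps^-1 * gap A (x, y)))%:E).
  apply/measurable_EFinP; apply: measurableT_comp => //.
  by apply: measurable_funM => //; exact: measurable_gapl.
apply: (@le_trans _ _ (\int[leb]_x ((expR L)%:E *
    (\1_A x * expR (- eps^-1 * gap A (x, y)))%:E))).
  apply: ge0_le_integral => //.
  - by move=> x _; rewrite mule_ge0 ?lee_fin//; case: df.
  - by apply: emeasurable_funM => //; exact/measurable_EFinP.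
  - apply: measurable_funeM; apply/measurable_EFinP; apply: measurable_funM => //.
    exact/measurable_EFinP.
  move=> x _; rewrite -!EFinM lee_fin /G /=.
  have -> : expR (L - ln (f x) - eps^-1 * gap A (x, y)) =
      (expR L * expR (- eps^-1 * gap A (x, y)) * expR (- ln (f x)))%R.
    by rewrite -!expRD; congr expR; ring.
  (* An inequality only: where [f] vanishes, [expR (- ln 0)] is 1 and the product is 0. *)
  have key : (expR (- ln (f x)) * f x <= 1)%R.
    case: df => _ /(_ x); rewrite le_eqVlt => /predU1P[<-|fx] _.
      by rewrite mulr0.
    by rewrite expRN lnK ?posrE// mulVf// gt_eqF.
  set a := (\1_A x : R); set b := expR (- ln (f x)) in key *.
  set c := expR (- eps^-1 * _).
  rewrite (_ : a * _ * f x = (expR L * (a * c)) * (b * f x))%R; last by ring.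
  by rewrite ler_piMr// mulr_ge0 ?mulr_ge0 ?expR_ge0// /a indicE.
have mk2 : measurable_fun setT
    (fun x => (\1_A x * expR (- eps^-1 * gap A (x, y)))%:E).
  by apply/measurable_EFinP; apply: measurable_funM => //; exact/measurable_EFinP.
rewrite ge0_integralZl_EFin ?expR_ge0//.
rewrite integral_indicM//.
have ei : (0 < eps^-1)%R by rewrite invr_gt0.
apply: (@le_trans _ _ ((expR L)%:E * (2 / eps^-1)%:E)).
  by apply: lee_wpmul2l; rewrite ?lee_fin ?expR_ge0// gap_kernel_le.
rewrite -EFinM lee_fin /L invrK expRN lnK ?posrE ?mulr_gt0//.
by rewrite mulVf// mulf_neq0// gt_eqF.
Qed.

Let lnp x := lnpos (f x).
Let lnm x := lnneg (f x).

Let lnp_ge0 x : (0 <= lnp x)%R. Proof. exact: lnpos_ge0. Qed.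
Let lnm_ge0 x : (0 <= lnm x)%R. Proof. exact: lnneg_ge0. Qed.

Let measurable_lnp : measurable_fun setT lnp.
Proof. exact: (measurableT_comp measurable_lnpos). Qed.

Let measurable_lnm : measurable_fun setT lnm.
Proof. exact: (measurableT_comp measurable_lnneg). Qed.

Let E : set (Rm * Rm) := ~` A `*` ~` A.
Let mix : set (Rm * Rm) := (A `*` ~` A) `|` (~` A `*` A).

Variables (g : probability (Rm * Rm)%type R) (q : Rm * Rm -> R).
Hypothesis gP : Plans mu nu g.
Hypothesis dq : is_density (mu \x nu) g q.
Hypothesis eps1 : (2 * eps <= 1)%R.
Variables (K : R) (h1 h2 : Rm * Rm -> R).
Hypothesis K0 : (0 <= K)%R.
Hypothesis mh1 : measurable_fun setT h1.
Hypothesis mh2 : measurable_fun setT h2.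
Hypothesis h10 : forall p, (0 <= h1 p)%R.
Hypothesis h20 : forall p, (0 <= h2 p)%R.

Let L0 : (0 <= L)%R. Proof. by rewrite oppr_ge0 ln_le0. Qed.
Let mAC : measurable (~` A). Proof. exact: measurableC. Qed.
Let mE : measurable E. Proof. exact: measurableX. Qed.
Let mmix : measurable mix. Proof. by apply: measurableU; exact: measurableX. Qed.

(** Together with [H2] and [C]: the test function [H1 - H2 - C] is [L - ln f - gap / eps] when [x]
    is in [A], is lowered by [K] on the mixed rectangles, and contains the free [h1 - h2] on [E]. A
    large [K] makes the exponential on the mixed rectangles negligible, while [K * g mix] disappears
    when the limit plan does not charge them. *)
Let H1 (p : Rm * Rm) : R := (\1_A p.1 * (L + lnm p.1) + \1_E p * h1 p)%R.
Let H2 (p : Rm * Rm) : R := (\1_A p.1 * lnp p.1 + (K * \1_mix p + \1_E p * h2 p))%R.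
Let C (p : Rm * Rm) : R := (eps^-1 * gap A p)%R.

Let mi1 : measurable_fun setT (fun p : Rm * Rm => \1_A p.1 : R).
Proof. exact: (measurableT_comp mi measurable_fst). Qed.
Let miE : measurable_fun setT (\1_E : Rm * Rm -> R).
Proof. exact: measurable_indic. Qed.
Let mim : measurable_fun setT (\1_mix : Rm * Rm -> R).
Proof. exact: measurable_indic. Qed.
Let mp1 : measurable_fun setT (fun p : Rm * Rm => lnp p.1).
Proof. exact: (measurableT_comp measurable_lnp measurable_fst). Qed.
Let mm1 : measurable_fun setT (fun p : Rm * Rm => lnm p.1).
Proof. exact: (measurableT_comp measurable_lnm measurable_fst). Qed.

Let m11 : measurable_fun setT (fun p : Rm * Rm => \1_A p.1 * (L + lnm p.1))%R.
Proof. by apply: measurable_funM => //; exact: measurable_funD. Qed.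
Let m12 : measurable_fun setT (fun p => \1_E p * h1 p)%R.
Proof. exact: measurable_funM. Qed.
Let m21 : measurable_fun setT (fun p : Rm * Rm => \1_A p.1 * lnp p.1)%R.
Proof. exact: measurable_funM. Qed.
Let m22 : measurable_fun setT (fun p => K * \1_mix p)%R.
Proof. exact: measurable_funM. Qed.
Let m23 : measurable_fun setT (fun p => \1_E p * h2 p)%R.
Proof. exact: measurable_funM. Qed.

Let p11 (p : Rm * Rm) : (0 <= \1_A p.1 * (L + lnm p.1))%R.
Proof. by rewrite mulr_ge0 ?addr_ge0 ?lnm_ge0. Qed.
Let p12 p : (0 <= \1_E p * h1 p)%R. Proof. by rewrite mulr_ge0. Qed.
Let p21 (p : Rm * Rm) : (0 <= \1_A p.1 * lnp p.1)%R.
Proof. by rewrite mulr_ge0 ?lnp_ge0. Qed.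
Let p22 p : (0 <= K * \1_mix p)%R. Proof. by rewrite mulr_ge0. Qed.
Let p23 p : (0 <= \1_E p * h2 p)%R. Proof. by rewrite mulr_ge0. Qed.

Let intD (m : {measure set (Rm * Rm)%type -> \bar R}) (u v : Rm * Rm -> R) :
  measurable_fun setT u -> measurable_fun setT v ->
  (forall p, (0 <= u p)%R) -> (forall p, (0 <= v p)%R) ->
  \int[m]_p (u p + v p)%:E = \int[m]_p (u p)%:E + \int[m]_p (v p)%:E.
Proof.
move=> mu' mv u0 v0; under eq_integral do rewrite EFinD.
have mu2 : measurable_fun setT (EFin \o u) by exact/measurable_EFinP.
have mv2 : measurable_fun setT (EFin \o v) by exact/measurable_EFinP.
by apply: ge0_integralD => //; move=> p _; rewrite lee_fin.
Qed.

Let int1 : \int[g]_p (H1 p)%:E =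
  L%:E * mu A + \int[mu]_(x in A) (lnm x)%:E + \int[g]_(p in E) (h1 p)%:E.
Proof.
rewrite (intD g m11 m12 p11 p12) (integral_indicM g h1 mE); congr (_ + _).
have ma : measurable_fun setT (fun x => (\1_A x * (L + lnm x))%:E).
  apply/measurable_EFinP; apply: measurable_funM => //.
  by apply: measurable_funD => //; exact: measurable_lnm.
rewrite (plan_integral1 gP ma); last by move=> x; rewrite lee_fin (p11 (x, x)).
rewrite integral_indicM//; under eq_integral do rewrite EFinD.
have ml : measurable_fun A (fun x => (lnm x)%:E).
  by apply: measurable_funTS; apply/measurable_EFinP; exact: measurable_lnm.
rewrite ge0_integralD//; last by move=> x _; rewrite lee_fin lnm_ge0.
by rewrite integral_cst.
Qed.

Let int2 : \int[g]_p (H2 p)%:E =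
  \int[mu]_(x in A) (lnp x)%:E + (K%:E * g mix + \int[g]_(p in E) (h2 p)%:E).
Proof.
have m223 := measurable_funD m22 m23.
have p223 p : (0 <= K * \1_mix p + \1_E p * h2 p)%R by rewrite addr_ge0.
rewrite (intD g m21 m223 p21 p223) (intD g m22 m23 p22 p23).
rewrite (integral_indicM g h2 mE); congr (_ + (_ + _)).
  have ma : measurable_fun setT (fun x => (\1_A x * lnp x)%:E).
    by apply/measurable_EFinP; apply: measurable_funM => //; exact: measurable_lnp.
  rewrite (plan_integral1 gP ma); last by move=> x; rewrite lee_fin (p21 (x, x)).
  by rewrite integral_indicM.
have mim' : measurable_fun setT (fun p => (\1_mix p : R)%:E).
  exact/measurable_EFinP.
under eq_integral do rewrite EFinM.
by rewrite ge0_integralZl_EFin// integral_indic// setIT.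
Qed.

Let intC : \int[g]_p (C p)%:E = (eps^-1)%:E * \int[g]_p gapA A p.
Proof.
under eq_integral do rewrite EFinM gapE//.
have ei : (0 <= eps^-1)%R by rewrite invr_ge0 ltW.
by rewrite ge0_integralZl_EFin//; exact: measurable_gapA.
Qed.

Let B1 (p : Rm * Rm) : R := (\1_A p.2 * G p)%R.
Let B2 (p : Rm * Rm) : R := (expR (- K) * G p)%R.
Let B4 (p : Rm * Rm) : R := (\1_E p * expR (h1 p - h2 p))%R.

(** One summand for each quadrant: [B1] on [A x A], [B2] on [A x ~A], the constant [expR (- K)] on
    [~A x A], and [B4] on [E]. *)
Let exp_le p : (expR (H1 p - H2 p - C p) <= B1 p + (B2 p + (expR (- K) + B4 p)))%R.
Proof.
have gp := gap_ge0 mA p.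
have ei : (0 < eps^-1)%R by rewrite invr_gt0.
have cg : (0 <= C p)%R by rewrite mulr_ge0 // ltW.
have eK := expR_ge0 (- K)%R.
have b1 : (0 <= B1 p)%R by rewrite mulr_ge0.
have b2 : (0 <= B2 p)%R by rewrite mulr_ge0.
have b4 : (0 <= B4 p)%R by rewrite mulr_ge0 ?expR_ge0.
move: p gp cg b1 b2 b4 => [x y] gp cg b1 b2 b4.
have i1 (T : Type) (S : set T) z : S z -> \1_S z = 1%R :> R.
  by move=> Sz; rewrite indicE mem_set.
have i0 (T : Type) (S : set T) z : ~ S z -> \1_S z = 0%R :> R.
  by move=> Sz; rewrite indicE memNset.
have lpm := lnposneg (f x).
have lnE a b : (\1_A x * (L + lnm x) + a - (\1_A x * lnp x + b) =
    \1_A x * (L - ln (f x)) + a - b)%R by rewrite -lpm /lnm /lnp; ring.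
have [Ax|Ax] := pselect (A x); have [Ay|Ay] := pselect (A y).
- have -> : (H1 (x, y) - H2 (x, y) - C (x, y) = L - ln (f x) - C (x, y))%R.
    rewrite /H1 /H2 /= lnE (@i1 Rm A x)// (@i0 _ E)//; last by case.
    by rewrite (@i0 _ mix) ?mul1r ?mul0r ?mulr0 ?addr0 ?subr0// => -[[]|[]].
  have -> : expR (L - ln (f x) - C (x, y)) = B1 (x, y).
    by rewrite /B1 /G /= !i1// !mul1r.
  by rewrite lerDl !addr_ge0.
- have -> : (H1 (x, y) - H2 (x, y) - C (x, y) = - K + (L - ln (f x) - C (x, y)))%R.
    rewrite /H1 /H2 /= lnE (@i1 Rm A x)// (@i0 _ E)//; last by case.
    by rewrite (@i1 _ mix) ?mul1r ?mul0r ?mulr1 ?addr0; [ring|left].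
  have -> : expR (- K + (L - ln (f x) - C (x, y))) = B2 (x, y).
    by rewrite expRD /B2 /G /= i1// mul1r.
  by rewrite addrCA lerDl !addr_ge0.
- have -> : (H1 (x, y) - H2 (x, y) - C (x, y) = - K - C (x, y))%R.
    rewrite /H1 /H2 /= lnE (@i0 Rm A x)// (@i0 _ E)//; last by case.
    by rewrite (@i1 _ mix) ?mul1r ?mul0r ?mulr1 ?addr0 ?add0r//; right.
  have : (expR (- K - C (x, y)) <= expR (- K))%R by rewrite ler_expR gerBl.
  lra.
- have -> : (H1 (x, y) - H2 (x, y) - C (x, y) = h1 (x, y) - h2 (x, y) - C (x, y))%R.
    rewrite /H1 /H2 /= lnE (@i0 Rm A x)// (@i1 _ E)//.
    by rewrite (@i0 _ mix) ?mul1r ?mul0r ?mulr0 ?addr0 ?add0r// => -[[]|[]].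
  have -> : B4 (x, y) = expR (h1 (x, y) - h2 (x, y)) by rewrite /B4 i1// mul1r.
  have : (expR (h1 (x, y) - h2 (x, y) - C (x, y)) <= expR (h1 (x, y) - h2 (x, y)))%R.
    by rewrite ler_expR gerBl.
  lra.
Qed.

Let mB1 : measurable_fun setT B1.
Proof.
by apply: measurable_funM => //; exact: (measurableT_comp mi measurable_snd).
Qed.
Let mB2 : measurable_fun setT B2. Proof. exact: measurable_funM. Qed.
Let mB4 : measurable_fun setT B4.
Proof.
by apply: measurable_funM => //; apply: measurableT_comp => //; exact: measurable_funB.
Qed.
Let pB1 p : (0 <= B1 p)%R. Proof. by rewrite mulr_ge0. Qed.
Let pB2 p : (0 <= B2 p)%R. Proof. by rewrite mulr_ge0 ?expR_ge0. Qed.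
Let pB4 p : (0 <= B4 p)%R. Proof. by rewrite mulr_ge0 ?expR_ge0. Qed.

Let intG y : 0 <= \int[mu]_x (G (x, y))%:E <= 1.
Proof. by rewrite G_le1 andbT integral_ge0// => x _; rewrite lee_fin. Qed.

Let mGE : measurable_fun setT (EFin \o G). Proof. exact/measurable_EFinP. Qed.
Let GE0 p : 0 <= (EFin \o G) p. Proof. by rewrite lee_fin. Qed.

Let mGint : measurable_fun setT (fun y => \int[mu]_x (G (x, y))%:E).
Proof. exact: (@measurable_fun_fubini_tonelli_G _ _ _ _ _ mu (EFin \o G)). Qed.

Let mGy y : measurable_fun setT (fun x => (G (x, y))%:E).
Proof.
by apply/measurable_EFinP; apply: (measurableT_comp mG); exact: measurable_fun_pair.
Qed.

Let int_exp : \int[mu \x nu]_p (expR (H1 p - H2 p - C p))%:E <=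
  nu A + (expR (- K))%:E + (expR (- K))%:E +
  \int[mu \x nu]_(p in E) (expR (h1 p - h2 p))%:E.
Proof.
have mK : measurable_fun setT (fun p => expR (- K) + B4 p)%R by exact: measurable_funD.
have pK p : (0 <= expR (- K) + B4 p)%R by rewrite addr_ge0 ?expR_ge0.
have m3 := measurable_funD mB2 mK.
have p3 p : (0 <= B2 p + (expR (- K) + B4 p))%R by rewrite addr_ge0.
apply: (@le_trans _ _ (\int[mu \x nu]_p (B1 p + (B2 p + (expR (- K) + B4 p)))%:E)).
  apply: ge0_le_integral => //.
  - apply/measurable_EFinP; apply: measurableT_comp => //.
    apply: measurable_funB; last by apply: measurable_funM => //; exact: measurable_gap.
    by apply: measurable_funB; apply: measurable_funD => //; exact: measurable_funD.
  - by apply/measurable_EFinP; exact: measurable_funD.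
  - by move=> p _; rewrite lee_fin.
rewrite (intD (mu \x nu) mB1 m3 pB1 p3) (intD (mu \x nu) mB2 mK pB2 pK).
rewrite (intD (mu \x nu) (measurable_cst (expR (- K))) mB4 (fun=> expR_ge0 _) pB4).
have -> : \int[mu \x nu]_p (cst (expR (- K)) p)%:E = (expR (- K))%:E.
  transitivity (\int[mu \x nu]_p (cst (expR (- K))%:E p)) => //.
  by rewrite integral_cst// [X in _ * X](_ : _ = 1) ?mule1//; exact: prodT.
rewrite (integral_indicM _ (fun p => expR (h1 p - h2 p)) mE).
have HB1 : \int[mu \x nu]_p (B1 p)%:E <= nu A.
  rewrite (fubini_tonelli2 (EFin \o B1)); last 2 first.
  + exact/measurable_EFinP.
  + by move=> p; rewrite lee_fin.
  rewrite /fubini_G -[leRHS](_ : \int[nu]_y (\1_A y)%:E = _); last first.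
    by rewrite integral_indic// setIT.
  apply: ge0_le_integral => //.
  + by move=> y _; apply: integral_ge0 => x _; rewrite lee_fin.
  + apply: (@measurable_fun_fubini_tonelli_G _ _ _ _ _ mu (EFin \o B1)).
      exact/measurable_EFinP.
    by move=> p; rewrite lee_fin.
  + exact/measurable_EFinP.
  + move=> y _; rewrite /B1 /=; under eq_integral do rewrite EFinM.
    rewrite ge0_integralZl_EFin//; last by move=> x _; rewrite lee_fin.
    have /andP[_ G1] := intG y; rewrite -[leRHS]mule1.
    by rewrite lee_wpmul2l// lee_fin.
have HB2 : \int[mu \x nu]_p (B2 p)%:E <= (expR (- K))%:E.
  rewrite (fubini_tonelli2 (EFin \o B2)); last 2 first.
  + exact/measurable_EFinP.
  + by move=> p; rewrite lee_fin.
  have <- : \int[nu]_y (cst (expR (- K))%:E y) = (expR (- K))%:E.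
    by rewrite integral_cst// [X in _ * X](_ : _ = 1) ?mule1//; exact: probability_setT.
  rewrite /fubini_G; apply: ge0_le_integral => //.
  + by move=> z _; apply: integral_ge0 => x _; rewrite lee_fin.
  + apply: (@measurable_fun_fubini_tonelli_G _ _ _ _ _ mu (EFin \o B2)).
      exact/measurable_EFinP.
    by move=> p; rewrite lee_fin.
  + move=> z _; rewrite /B2 /=; under eq_integral do rewrite EFinM.
    rewrite ge0_integralZl_EFin ?expR_ge0//; last by move=> x _; rewrite lee_fin.
    have /andP[_ G1] := intG z; rewrite -[leRHS]mule1.
    by rewrite lee_wpmul2l// lee_fin expR_ge0.
move: HB1 HB2; move: (\int[mu \x nu]_p (B1 p)%:E) (\int[mu \x nu]_p (B2 p)%:E).
move: (\int[mu \x nu]_(p in E) _) => I4 I1 I2 HB1 HB2.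
by rewrite -!addeA; exact: leeD HB1 (leeD2r _ HB2).
Qed.

(** Integrating first in [x], the exponential over [A x A] costs at most [nu A], and each mixed
    rectangle at most [expR (- K)]. The 1 on the left is the mass of [mu x nu]; later it balances
    [nu A] and the mass left over [E]. *)
Lemma gibbs_plan :
  L%:E * mu A + \int[mu]_(x in A) (lnneg (f x))%:E + \int[g]_(p in E) (h1 p)%:E + 1 <=
  \int[mu]_(x in A) (lnpos (f x))%:E + (K%:E * g mix + \int[g]_(p in E) (h2 p)%:E) +
  (eps^-1)%:E * \int[g]_p gapA A p + \int[mu \x nu]_p (phi (q p))%:E +
  (nu A + (expR (- K))%:E + (expR (- K))%:E +
   \int[mu \x nu]_(p in E) (expR (h1 p - h2 p))%:E).
Proof.
have mH1 : measurable_fun setT H1 by exact: measurable_funD.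
have pH1 p : (0 <= H1 p)%R by rewrite addr_ge0.
have mH2 : measurable_fun setT H2.
  by apply: measurable_funD => //; exact: measurable_funD.
have pH2 p : (0 <= H2 p)%R by rewrite addr_ge0// addr_ge0.
have mC : measurable_fun setT C.
  by apply: measurable_funM => //; exact: measurable_gap.
have pC p : (0 <= C p)%R by rewrite mulr_ge0 ?invr_ge0 ?(ltW eps0) ?gap_ge0.
have H := @gibbs_inequality _ _ _ (mu \x nu) g q H1 H2 C (prodT mu nu) dq
  mH1 pH1 mH2 pH2 mC pC.
by rewrite -int1 -int2 -intC; apply: (le_trans H); rewrite leeD2l// int_exp.
Qed.

End gibbs_plan.

(** * From narrow convergence to convergence on all measurable sets *)

Section setwise_convergence.
Context d (T : measurableType d) (R : realType).
Variables (m : nat -> {measure set T -> \bar R}) (m0 rho : {measure set T -> \bar R}).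
Hypothesis moo : forall n, m n setT < +oo.
Hypothesis m0oo : m0 setT < +oo.
Hypothesis rhooo : rho setT < +oo.
Hypothesis equi : forall e : R, (0 < e)%R -> exists2 d : R, (0 < d)%R &
  forall S, measurable S -> rho S < d%:E -> forall n, m n S <= e%:E.

Let cv S := (fun n => fine (m n S)) @ \oo --> fine (m0 S).

Let mfin n S : measurable S -> m n S \is a fin_num.
Proof.
move=> mS; rewrite ge0_fin_numE//; apply: le_lt_trans (moo n).
by apply: le_measure; rewrite ?inE.
Qed.

Let m0fin S : measurable S -> m0 S \is a fin_num.
Proof.
move=> mS; rewrite ge0_fin_numE//; apply: le_lt_trans m0oo.
by apply: le_measure; rewrite ?inE.
Qed.

Let cvU A B : measurable A -> measurable B -> A `&` B = set0 ->
  cv A -> cv B -> cv (A `|` B).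
Proof.
move=> mA mB AB cA cB; rewrite /cv.
have -> : fine (m0 (A `|` B)) = (fine (m0 A) + fine (m0 B))%R.
  by rewrite measureU// fineD//; exact: m0fin.
rewrite (_ : (fun n => _) = (fun n => fine (m n A) + fine (m n B))%R).
  exact: cvgD.
by apply/funext => n; rewrite measureU// fineD//; exact: mfin.
Qed.

Let cvC A : measurable A -> cv setT -> cv A -> cv (~` A).
Proof.
move=> mA cT cA; rewrite /cv.
have mAC := measurableC mA.
have E (k : {measure set T -> \bar R}) : (forall S, measurable S -> k S \is a fin_num) ->
    fine (k (~` A)) = (fine (k setT) - fine (k A))%R.
  move=> kf; rewrite -(setvU A) measureU ?setICl// fineD ?kf//.
  by rewrite addrK.
rewrite E// (_ : (fun n => _) = (fun n => fine (m n setT) - fine (m n A))%R).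
  exact: cvgB.
by apply/funext => n; rewrite E//; exact: mfin.
Qed.

(** The sets on which convergence holds form a Dynkin class. For a countable disjoint union, the
    tail has small [rho]-measure, hence by [equi] a mass under [m n] that is small uniformly in [n],
    and only finitely many pieces remain. *)
Lemma setwise_cvg (G : set (set T)) : @measurable _ T = <<s G >> -> setI_closed G ->
  cv setT -> (forall S, G S -> cv S) -> forall S, measurable S -> cv S.
Proof.
move=> mG GI cT GS S mS.
have mS' : <<s G >> S by rewrite -mG.
move: mS'; apply: (dynkin_induction (P := cv) mG GI) => //.
  by move=> A mA cA; exact: cvC.
move=> F mF tF cF.
pose U N := \big[setU/set0]_(k < N) F k.
pose tl N := \bigcup_k F k `\` U N.
have mbig : measurable (\bigcup_k F k) by exact: bigcup_measurable.
have mU N : measurable (U N) by exact: bigsetU_measurable.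
have mtl N : measurable (tl N) by exact: measurableD.
have cU N : cv (U N).
  elim: N => [|N IH].
    rewrite /cv /U big_ord0 measure0.
    rewrite (_ : (fun n => _) = cst 0%R); first exact: cvg_cst.
    by apply/funext => n; rewrite measure0.
  rewrite /U big_ord_recr /=; apply: (cvU (mU N) (mF N) _ IH (cF N)).
  by apply: (@trivIset_bigsetUI _ xpredT F) => // i j _ _; exact: tF.
have cvtl (k : {measure set T -> \bar R}) : k setT < +oo ->
    (k \o tl) x @[x --> \oo] --> 0.
  move=> koo; have t0 : \bigcap_n tl n = set0.
    apply/seteqP; split => // x tx.
    have [[i _ Fix] _] := tx 0%N I.
    have [_] := tx i.+1 I; apply.
    by rewrite /U -bigcup_mkord; exists i => //=.
  rewrite -(measure0 k) -t0; apply: nonincreasing_cvg_mu => //.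
  - by apply: le_lt_trans koo; apply: le_measure; rewrite ?inE.
  - by rewrite t0.
  - move=> i j ij; apply/subsetPset => x [Fx nUx]; split => // Uix; apply: nUx.
    move: Uix; rewrite /U -!bigcup_mkord => -[l /= li Fl]; exists l => //=.
    exact: leq_trans li ij.
rewrite /cv; apply/cvgrPdist_le => e e0.
have e3 : (0 < e / 3)%R by rewrite divr_gt0.
have [de de0 He] := equi e3.
have [N [N1 N2]] : exists N, rho (tl N) < de%:E /\ m0 (tl N) < (e / 3)%:E.
  have /fine_cvgP[H1 /cvgrPdist_lt/(_ _ de0) H2] := cvtl _ rhooo.
  have /fine_cvgP[H3 /cvgrPdist_lt/(_ _ e3) H4] := cvtl _ m0oo.
  have [N [[/= h1 h2] [h3 h4]]] := filter_ex (filterI (filterI H1 H2) (filterI H3 H4)).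
  exists N; split.
    rewrite -(fineK h1) lte_fin; move: h2; rewrite sub0r normrN.
    exact: le_lt_trans (ler_norm _).
  rewrite -(fineK h3) lte_fin; move: h4; rewrite sub0r normrN.
  exact: le_lt_trans (ler_norm _).
have split (k : {measure set T -> \bar R}) : (forall S, measurable S -> k S \is a fin_num) ->
    fine (k (\bigcup_k F k)) = (fine (k (U N)) + fine (k (tl N)))%R.
  move=> kf; have UE : \bigcup_k F k = U N `|` tl N.
    rewrite /tl setDUK// => x.
    by rewrite /U -bigcup_mkord => -[i _ Fi]; exists i.
  rewrite [in LHS]UE measureU ?fineD ?kf//.
  by apply/seteqP; split => // x [Ux [_]].
have tn n : (0 <= fine (m n (tl N)) <= e / 3)%R.
  by rewrite fine_ge0//= -lee_fin fineK ?mfin//; exact: He.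
have t0' : (0 <= fine (m0 (tl N)) <= e / 3)%R.
  by rewrite fine_ge0//= -lee_fin fineK ?m0fin// ltW.
move/cvgrPdist_le : (cU N) => /(_ _ e3) [K _ HK].
exists K => // n Kn /=; rewrite split//; rewrite (split (m n)); last exact: mfin.
have := HK n Kn; rewrite !ler_norml => /= /andP[h1 h2].
move: (tn n) t0' => /andP[a1 a2] /andP[b1 b2].
by apply/andP; split; lra.
Qed.

End setwise_convergence.

Section narrow_rectangles.
Context {R : realType}.
Local Notation Rm := (measurableTypeR R).

Definition ramp (s dl x : R) : R := (Num.min 1 (Num.max 0 (1 - (x - s) / dl)))%R.

Lemma continuous_ramp s dl : continuous (ramp s dl).
Proof.
move=> x; apply: (@continuous_min R R (cst 1%R) (fun x => Num.max 0 (1 - (x - s) / dl))%R).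
  exact: cst_continuous.
apply: (@continuous_max R R (cst 0%R) (fun x => 1 - (x - s) / dl)%R).
  exact: cst_continuous.
apply: (@continuousB _ R^o R^o (cst 1%R)); first exact: cst_continuous.
apply: (@continuousM R R^o (fun x => x - s)%R); last exact: cst_continuous.
by apply: (@continuousB _ R^o R^o id); [exact: cvg_id|exact: cst_continuous].
Qed.

Lemma ramp_ge0 s dl x : (0 <= ramp s dl x)%R.
Proof. by rewrite /ramp le_min ler01 le_max lexx. Qed.

Lemma ramp_le1 s dl x : (ramp s dl x <= 1)%R.
Proof. by rewrite /ramp ge_min lexx. Qed.

Lemma ramp_eq1 s dl x : (0 < dl)%R -> (x <= s)%R -> ramp s dl x = 1%R.
Proof.
move=> d0 xs; rewrite /ramp min_l// le_max; apply/orP; right.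
by rewrite lerBrDr gerDl mulr_le0_ge0 ?subr_le0// invr_ge0 ltW.
Qed.

Lemma ramp_eq0 s dl x : (0 < dl)%R -> (s + dl <= x)%R -> ramp s dl x = 0%R.
Proof.
move=> d0 xs; rewrite /ramp max_l ?min_r ?ler01//.
by rewrite subr_le0 ler_pdivlMr// mul1r lerBrDl.
Qed.

Lemma small_right_interval (P : probability Rm R) (s e : R) : (0 < e)%R ->
  exists2 dl : R, (0 < dl)%R & P `]s, (s + dl)%R]%classic < e%:E.
Proof.
move=> e0; pose F (k : nat) : set Rm := `]s, (s + k.+1%:R^-1)%R]%classic.
have F0 : \bigcap_k F k = set0.
  apply/seteqP; split => // x Fx.
  have := Fx 0%N I; rewrite /F /= in_itv/= => /andP[sx _].
  have [k] := ltr_add_invr sx.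
  have := Fx k I; rewrite /F /= in_itv/= => /andP[_ xk].
  by move=> /(le_lt_trans xk); rewrite ltxx.
have : (P \o F) x @[x --> \oo] --> P (\bigcap_k F k).
  apply: nonincreasing_cvg_mu => //.
  - by rewrite -ge0_fin_numE// fin_num_measure//; exact: measurable_itv.
  - by move=> i; exact: measurable_itv.
  - by rewrite F0.
  - move=> i j ij; apply/subsetPset; apply: subset_itvl; rewrite bnd_simp.
    by rewrite lerD2l lef_pV2 ?posrE// ler_nat.
rewrite F0 [X in _ --> X](_ : _ = 0); last exact: measure0.
move=> /fine_cvgP[H1 /cvgrPdist_lt/(_ _ e0) H2].
have [k [h1 h2]] := filter_ex (filterI H1 H2).
exists (k.+1%:R^-1)%R; first by rewrite invr_gt0.
rewrite -[X in X < _](fineK h1) lte_fin; move: h2; rewrite sub0r normrN.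
exact: le_lt_trans (ler_norm _).
Qed.

Variables (mu nu : probability Rm R).

Let Q (s t : R) : set (Rm * Rm) := `]-oo, s]%classic `*` `]-oo, t]%classic.

Let mQ s t : measurable (Q s t). Proof. exact: measurableX. Qed.

Let bump (s t dl : R) (p : R * R) : R := (ramp s dl p.1 * ramp t dl p.2)%R.

Lemma continuous_bump s t dl : continuous (bump s t dl).
Proof.
move=> p; apply: (@continuousM R (R * R)%type).
  apply: (@continuous_comp _ _ _ fst (ramp s dl)); first exact: cvg_fst.
  exact: continuous_ramp.
apply: (@continuous_comp _ _ _ snd (ramp t dl)); first exact: cvg_snd.
exact: continuous_ramp.
Qed.

Let bump_ge0 s t dl p : (0 <= bump s t dl p)%R.
Proof. by rewrite mulr_ge0 ?ramp_ge0. Qed.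

Let mbump s t dl : measurable_fun setT (bump s t dl : Rm * Rm -> R).
Proof.
have mr a : measurable_fun setT (ramp a dl : Rm -> R).
  by apply: continuous_measurable_fun; exact: continuous_ramp.
by apply: measurable_funM;
  [exact: (measurableT_comp (mr s) measurable_fst)|exact: (measurableT_comp (mr t) measurable_snd)].
Qed.

(** The error is the mass of two strips. It depends on the plan only through its marginals, so it is
    the same for all plans and can be made small before passing to the limit. *)
Lemma bump_bounds (g : probability (Rm * Rm)%type R) (s t dl : R) : (0 < dl)%R ->
  Plans mu nu g ->
  g (Q s t) <= \int[g]_p (bump s t dl p)%:E <=
  g (Q s t) + (mu `]s, (s + dl)%R]%classic + nu `]t, (t + dl)%R]%classic).
Proof.
move=> d0 gP; apply/andP; split.
  rewrite -[leLHS](_ : \int[g]_p (\1_(Q s t) p)%:E = _); last first.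
    by rewrite integral_indic// setIT.
  apply: ge0_le_integral => //.
  - exact/measurable_EFinP.
  - exact/measurable_EFinP.
  - move=> [x y] _; rewrite lee_fin indicE; have [|] := boolP (_ \in _); last first.
      by rewrite bump_ge0.
    rewrite inE => -[/=]; rewrite !in_itv/= => xs yt.
    by rewrite /bump/= !ramp_eq1// mulr1.
have mI : measurable (`]s, (s + dl)%R]%classic `*` [set: Rm]) by exact: measurableX.
have mJ : measurable ([set: Rm] `*` `]t, (t + dl)%R]%classic) by exact: measurableX.
have mIJ := measurableU _ _ mI mJ.
apply: (@le_trans _ _ (g (Q s t `|` (`]s, (s + dl)%R]%classic `*` setT `|`
     setT `*` `]t, (t + dl)%R]%classic)))).
  have mU := measurableU _ _ (mQ s t) mIJ.
  rewrite -[leRHS](_ : \int[g]_p (\1_(Q s t `|` (`]s, (s + dl)%R]%classic `*` setT `|`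
     setT `*` `]t, (t + dl)%R]%classic)) p)%:E = _); last first.
    by rewrite integral_indic// setIT.
  apply: ge0_le_integral => //.
  - by move=> p _; rewrite lee_fin.
  - exact/measurable_EFinP.
  - exact/measurable_EFinP.
  - move=> [x y] _; rewrite lee_fin indicE.
    have [_|] := boolP (_ \in _).
      by rewrite /bump mulr_ile1 ?ramp_ge0 ?ramp_le1.
    rewrite notin_setE => /= H.
    have [xs|xs] := leP (s + dl)%R x; first by rewrite /bump/= ramp_eq0// mul0r.
    have [yt|yt] := leP (t + dl)%R y; first by rewrite /bump/= [X in (_ * X)%R]ramp_eq0// mulr0.
    exfalso; apply: H; rewrite /Q /= !in_itv/=.
    have [xs'|xs'] := leP x s; have [yt'|yt'] := leP y t.
    - by left.
    - by right; right; split => //; exact: ltW.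
    - by right; left; split => //; exact: ltW.
    - by right; left; split => //; exact: ltW.
apply: le_trans (measureU2 _ (mQ s t) mIJ) _.
have e1 : g (`]s, (s + dl)%R]%classic `*` setT) = mu `]s, (s + dl)%R]%classic by exact: gP.1.
have e2 : g (setT `*` `]t, (t + dl)%R]%classic) = nu `]t, (t + dl)%R]%classic by exact: gP.2.
have H : g (`]s, (s + dl)%R]%classic `*` setT `|` setT `*` `]t, (t + dl)%R]%classic) <=
    mu `]s, (s + dl)%R]%classic + nu `]t, (t + dl)%R]%classic.
  by rewrite -e1 -e2; exact: (measureU2 g mI mJ).
exact: (leeD2l _ H).
Qed.

Variables (G : nat -> probability (Rm * Rm)%type R) (g : probability (Rm * Rm)%type R).
Hypothesis GP : forall n, Plans mu nu (G n).
Hypothesis gP : Plans mu nu g.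
Hypothesis Gg : forall phi : R * R -> R, continuous phi ->
  (exists M : R, forall p, (`|phi p| <= M)%R) ->
  (fun n => \int[G n]_p (phi p)%:E) @ \oo --> \int[g]_p (phi p)%:E.

Lemma narrow_quadrant s t : (fun n => fine (G n (Q s t))) @ \oo --> fine (g (Q s t)).
Proof.
apply/cvgrPdist_le => e e0.
have e4 : (0 < e / 4)%R by rewrite divr_gt0.
have [d1 d10 D1] := small_right_interval mu s e4.
have [d2 d20 D2] := small_right_interval nu t e4.
pose dl := Num.min d1 d2.
have d0 : (0 < dl)%R by rewrite lt_min d10.
have H : mu `]s, (s + dl)%R]%classic + nu `]t, (t + dl)%R]%classic <= (e / 4 + e / 4)%:E.
  rewrite EFinD; apply: leeD; [apply: le_trans (ltW D1)|apply: le_trans (ltW D2)].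
    apply: le_measure; rewrite ?inE//; apply: subset_itvl; rewrite bnd_simp.
    by rewrite lerD2l ge_min lexx.
  apply: le_measure; rewrite ?inE//; apply: subset_itvl; rewrite bnd_simp.
  by rewrite lerD2l ge_min lexx orbT.
have bb : exists M : R, forall p, (`|bump s t dl p| <= M)%R.
  by exists 1%R => p; rewrite ger0_norm// /bump mulr_ile1 ?ramp_ge0 ?ramp_le1.
have key (h : probability (Rm * Rm)%type R) : Plans mu nu h ->
   \int[h]_p (bump s t dl p)%:E \is a fin_num /\
   (fine (h (Q s t)) <= fine (\int[h]_p (bump s t dl p)%:E) <=
    fine (h (Q s t)) + (e / 4 + e / 4))%R.
  move=> hP; have /andP[b1 b2] := bump_bounds s t d0 hP.
  have f1 : h (Q s t) \is a fin_num by rewrite fin_num_measure.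
  have b3 := le_trans b2 (leeD2l _ H).
  have f2 : \int[h]_p (bump s t dl p)%:E \is a fin_num.
    rewrite ge0_fin_numE; last by apply: integral_ge0 => p _; rewrite lee_fin.
    apply: le_lt_trans b3 _; rewrite lte_add_pinfty ?ltry//.
    by rewrite -ge0_fin_numE.
  by split => //; rewrite -!lee_fin EFinD !fineK// b1 b3.
have [fg /andP[a1 a2]] := key _ gP.
have := Gg (@continuous_bump s t dl) bb.
rewrite -(fineK fg) => /fine_cvgP[_ /cvgrPdist_le/(_ _ e4)[N _ HN]].
exists N => // n Nn; have := HN n Nn => /=.
have [_ /andP[a3 a4]] := key _ (GP n).
rewrite !ler_norml => /andP[a5 a6].
by apply/andP; split; lra.
Qed.

Lemma plan_section1 (h : probability (Rm * Rm)%type R) (C : set Rm) :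
  measurable C -> exists m : {measure set Rm -> \bar R}, forall B, m B = h (B `*` C).
Proof.
move=> mC; have mTC : measurable ([set: Rm] `*` C) by exact: measurableX.
have [m mE] := pushforward_measure (mrestr h mTC) (@measurable_fst _ _ Rm Rm).
exists m => B; rewrite mE; congr (h _).
by apply/seteqP; split => -[x y] /=; [case=> ? []|case].
Qed.

Lemma plan_section2 (h : probability (Rm * Rm)%type R) (B : set Rm) :
  measurable B -> exists m : {measure set Rm -> \bar R}, forall C, m C = h (B `*` C).
Proof.
move=> mB; have mTB : measurable (B `*` [set: Rm]) by exact: measurableX.
have [m mE] := pushforward_measure (mrestr h mTB) (@measurable_snd _ _ Rm Rm).
exists m => C; rewrite mE; congr (h _).
by apply/seteqP; split => -[x y] /=; [case=> ? []|case].
Qed.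

Let prob_lty d (T : measurableType d) (P : probability T R) S : measurable S -> P S < +oo.
Proof. by move=> mS; rewrite -ge0_fin_numE// fin_num_measure. Qed.

(** One side is treated at a time: for fixed [C] the map [B |-> G n (B x C)] is a measure below the
    common marginal [mu], so uniform absolute continuity holds with [d = e]. Quadrants extend to a
    measurable first side against a ray, then to a measurable second side using [nu]. *)
Lemma narrow_rectangle (B C : set Rm) : measurable B -> measurable C ->
  (fun n => fine (G n (B `*` C))) @ \oo --> fine (g (B `*` C)).
Proof.
have rayC t : measurable (`]-oo, t]%classic : set Rm) by [].
have stepA t B' : measurable B' ->
    (fun n => fine (G n (B' `*` `]-oo, t]%classic))) @ \oo -->
    fine (g (B' `*` `]-oo, t]%classic)).
  move=> mB'.
  have [m mE] := choice (fun n => plan_section1 (G n) (rayC t)).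
  have [m0 m0E] := plan_section1 g (rayC t).
  have -> : (fun n => fine (G n (B' `*` `]-oo, t]%classic))) = (fun n => fine (m n B')).
    by apply/funext => n; rewrite mE.
  rewrite -m0E; apply: (@setwise_cvg _ _ _ m m0 mu _ _ _ _ ray) => //.
  - by move=> n; rewrite mE prob_lty//; exact: measurableX.
  - by rewrite m0E prob_lty//; exact: measurableX.
  - exact: prob_lty.
  - move=> e e0; exists e => // S mS Se n; rewrite mE.
    apply: (@le_trans _ _ (G n (S `*` setT))); last by rewrite (GP n).1// ltW.
    by apply: le_measure; rewrite ?inE; [exact: measurableX..|move=> x []].
  - exact: measurable_ray.
  - exact: setI_closed_ray.
  - rewrite (_ : (fun n => _) = cst (fine (nu `]-oo, t]%classic))).
      by rewrite m0E gP.2//; exact: cvg_cst.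
    by apply/funext => n; rewrite mE (GP n).2.
  - move=> _ [s _ <-]; rewrite (_ : (fun n => _) = (fun n => fine (G n (Q s t)))).
      by rewrite m0E; exact: narrow_quadrant.
    by apply/funext => n; rewrite mE.
move=> mB mC.
have [m mE] := choice (fun n => plan_section2 (G n) mB).
have [m0 m0E] := plan_section2 g mB.
have -> : (fun n => fine (G n (B `*` C))) = (fun n => fine (m n C)).
  by apply/funext => n; rewrite mE.
rewrite -m0E; apply: (@setwise_cvg _ _ _ m m0 nu _ _ _ _ ray) => //.
- by move=> n; rewrite mE prob_lty//; exact: measurableX.
- by rewrite m0E prob_lty//; exact: measurableX.
- exact: prob_lty.
- move=> e e0; exists e => // S mS Se n; rewrite mE.
  apply: (@le_trans _ _ (G n (setT `*` S))); last by rewrite (GP n).2// ltW.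
  by apply: le_measure; rewrite ?inE; [exact: measurableX..|move=> x []].
- exact: measurable_ray.
- exact: setI_closed_ray.
- rewrite (_ : (fun n => _) = cst (fine (mu B))).
    by rewrite m0E gP.1//; exact: cvg_cst.
  by apply/funext => n; rewrite mE (GP n).1.
- move=> _ [s _ <-]; rewrite (_ : (fun n => _) = (fun n => fine (G n (B `*` `]-oo, s]%classic)))).
    by rewrite m0E; exact: stepA.
  by apply/funext => n; rewrite mE.
Qed.

End narrow_rectangles.

(** * Consequences of bounded supports and finite entropy *)

Section support.
Context {R : realType}.
Local Notation Rm := (measurableTypeR R).
Local Notation leb := (@lebesgue_measure R).

(** The complement of the support is covered by the null balls with rational centre and radius. If
    [ball x r] is null, a radius between [r / 4] and [r / 2] and a centre within [r / 4] of [x] give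
    a ball that contains [x] and stays inside. *)
Lemma supp_null (mu : probability Rm R) : mu.-negligible (~` supp mu).
Proof.
pose F n : set Rm := if unpickle n is Some q then
  let c := ratr (q : rat * rat).1 : R in let r := ratr q.2 : R in
  if mu (ball c r) == 0 then ball c r else set0 else set0.
apply: (@negligibleS _ _ _ _ (\bigcup_n F n)); last first.
  apply: negligible_bigcup => n; rewrite /F; case: (unpickle n) => [q|].
    case: ifPn => [/eqP b0|_]; last exact: negligible_set0.
    by exists (ball (ratr q.1 : R) (ratr q.2 : R)); split => //; exact: measurable_ball.
  exact: negligible_set0.
move=> x /= nsx.
have [r r0 mr0] : exists2 r : R, (0 < r)%R & mu (ball x r) = 0.
  apply: contrapT => H; apply: nsx => r r0.
  rewrite lt0e measure_ge0 andbT; apply/eqP => mr; apply: H; by exists r.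
have r4 : (r / 4 < r / 2)%R by rewrite ltr_pM2l// ltf_pV2 ?posrE// ltr_nat.
have [p] := rat_in_itvoo r4; rewrite in_itv/= => /andP[p4 p2].
have xl : (x - r / 4 < x + r / 4)%R by rewrite ltrD2l gtrN// divr_gt0.
have [c] := rat_in_itvoo xl; rewrite in_itv/= => /andP[cl cr].
have sub : ball (ratr c : R) (ratr p) `<=` ball x r.
  move=> y; rewrite /ball/= !ltr_norml => /andP[h1 h2].
  by apply/andP; split; lra.
have b0 : mu (ball (ratr c : R) (ratr p)) = 0.
  apply/le_anti/andP; split; last exact: measure_ge0.
  by rewrite -mr0; apply: le_measure; rewrite ?inE//; exact: measurable_ball.
have [n nE] : exists n, unpickle n = Some (c, p) :> option (rat * rat).
  by exists (pickle (c, p)); exact: pickleK.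
exists n; first exact: I.
rewrite /F nE; cbv zeta; rewrite ifT; last by apply/eqP.
rewrite /ball /=; move: cl cr p4 {b0 sub nE}.
move: (ratr c : R) (ratr p : R) => c' p' cl cr p4.
by rewrite ltr_norml; apply/andP; split; lra.
Qed.

Lemma supp_bounded_null (mu : probability Rm R) (M : R) :
  supp mu `<=` `[(- M)%R, M]%classic -> mu (~` `[(- M)%R, M]%classic) = 0.
Proof.
move=> sM; have [N [mN N0 sN]] := supp_null mu.
have mI : measurable (~` `[(- M)%R, M]%classic : set Rm) by exact: measurableC.
apply/le_anti/andP; split; last exact: measure_ge0.
rewrite -[leRHS]N0; apply: le_measure; rewrite ?inE//.
by apply: subset_trans sN; exact: subsetC.
Qed.

Lemma density_null (m : {measure set Rm -> \bar R}) (mu : probability Rm R) (f : Rm -> R) :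
  is_density m mu f -> forall B, measurable B -> m B = 0 -> mu B = 0.
Proof.
move=> [mf f0 fE] B mB B0; rewrite fE//; apply: null_set_integral => //.
by apply/measurable_EFinP; exact: measurable_funTS.
Qed.

End support.

Section finite_log.
Context {R : realType}.
Local Notation Rm := (measurableTypeR R).
Local Notation leb := (@lebesgue_measure R).
Variables (mu : probability Rm R) (f : Rm -> R) (M : R).
Hypothesis df : is_density leb mu f.
Hypothesis M0 : (0 <= M)%R.
Hypothesis muM : mu (~` `[(- M)%R, M]%classic) = 0.
Hypothesis Emu : Ent mu leb < +oo.

Let I : set Rm := `[(- M)%R, M]%classic.
Let mI : measurable I. Proof. exact: measurable_itv. Qed.
Let mf : measurable_fun setT f. Proof. by case: df. Qed.
Let f0 x : (0 <= f x)%R. Proof. by case: df. Qed.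

Let mlm : measurable_fun setT (fun x => (lnneg (f x))%:E).
Proof. by apply/measurable_EFinP; exact: (measurableT_comp measurable_lnneg). Qed.
Let mlp : measurable_fun setT (fun x => (lnpos (f x))%:E).
Proof. by apply/measurable_EFinP; exact: (measurableT_comp measurable_lnpos). Qed.

Lemma lnnegM_le1 (t : R) : (0 <= t)%R -> (lnneg t * t <= 1)%R.
Proof.
rewrite le_eqVlt => /predU1P[<-|t0]; first by rewrite mulr0.
have := @phi_ge0 R _ (ltW t0); rewrite /phi /lnneg => h.
have [k|/ltW k] := leP (- ln t)%R 0%R; first by rewrite mul0r ler01.
by lra.
Qed.

(** Against Lebesgue measure the integrand is [f] times the negative part of [ln f], at most 1, on a
    bounded interval. *)
Lemma integral_lnneg_lty : \int[mu]_x (lnneg (f x))%:E < +oo.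
Proof.
have mIC := measurableC mI.
have lm0 x : 0 <= (lnneg (f x))%:E by rewrite lee_fin lnneg_ge0.
have mlmI : measurable_fun I (fun x => (lnneg (f x))%:E) by exact: measurable_funTS.
rewrite (@ge0_negligible_integral _ _ _ mu setT (~` I))//.
rewrite setTD setCK (ge0_integral_density df)//.
apply: (@le_lt_trans _ _ (\int[leb]_(x in I) cst 1 x)).
  apply: ge0_le_integral => //.
  - by move=> x _; rewrite mule_ge0 ?lee_fin ?lnneg_ge0.
  - apply: emeasurable_funM; apply: measurable_funTS => //.
    exact/measurable_EFinP.
  - by move=> x _; rewrite -EFinM lee_fin lnnegM_le1.
have leI : leb `[(- M)%R, M]%classic < +oo.
  by rewrite lebesgue_measure_itv/=; case: ifPn => _; rewrite ?ltry.
by rewrite integral_cst// mul1e; exact: leI.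
Qed.

(** The negative part of the entropy is finite by [integral_lnneg_lty]; finite entropy then forces a
    finite positive part. *)
Lemma integral_lnpos_lty : \int[mu]_x (lnpos (f x))%:E < +oo.
Proof.
have mu1 : mu setT < +oo by rewrite [X in X < _]probability_setT ltry.
have := Emu; rewrite (Ent_density mu1 df) integralE.
have posE : \int[mu]_x (lnpos (f x))%:E =
   \int[leb]_x ((fun x => (f x * ln (f x))%:E)^\+ x).
  rewrite (ge0_integral_density df)//; last by move=> x _; rewrite lee_fin lnpos_ge0.
  apply: eq_integral => x _; rewrite funeposE -EFin_max -EFinM; congr EFin.
  by rewrite /lnpos mulrC maxr_pMr// mulr0.
have negE : \int[mu]_x (lnneg (f x))%:E =
   \int[leb]_x ((fun x => (f x * ln (f x))%:E)^\- x).
  rewrite (ge0_integral_density df)//; last by move=> x _; rewrite lee_fin lnneg_ge0.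
  apply: eq_integral => x _; rewrite funenegE -EFinN -EFin_max -EFinM; congr EFin.
  by rewrite /lnneg mulrC maxr_pMr// mulr0 mulrN.
have := integral_lnneg_lty; rewrite posE negE.
have : 0 <= \int[leb]_x ((fun x => (f x * ln (f x))%:E)^\- x).
  by apply: integral_ge0.
have : 0 <= \int[leb]_x ((fun x => (f x * ln (f x))%:E)^\+ x).
  by apply: integral_ge0.
move: (\int[leb]_x _) (\int[leb]_x _) => a b.
case: a b => [a| |] [b| |] //=; rewrite ?ltry //.
Qed.
End finite_log.

Section bounded_cost.
Context {R : realType}.
Local Notation Rm := (measurableTypeR R).
Local Notation leb := (@lebesgue_measure R).
Variables (mu nu : probability Rm R) (M : R).
Hypothesis M0 : (0 <= M)%R.
Hypothesis muM : mu (~` `[(- M)%R, M]%classic) = 0.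
Hypothesis nuM : nu (~` `[(- M)%R, M]%classic) = 0.

(** A bounded continuous substitute for the distance, so that narrow convergence applies. It
    coincides with the distance when both coordinates lie in [[-M, M]], which holds almost surely
    for every plan. *)
Definition cutcost (p : R * R) : R := (Num.min `|p.2 - p.1| (2 * M))%R.

Lemma continuous_cutcost : continuous cutcost.
Proof.
move=> p; apply: (@continuous_min R _ (fun p : R * R => `|p.2 - p.1|)%R (cst (2 * M)%R)); last first.
  exact: cst_continuous.
apply: (@continuous_comp _ _ _ (fun p : R * R => p.2 - p.1)%R (fun x : R => `|x|%R)); last first.
  exact: norm_continuous.
by apply: (@continuousB _ R^o (R * R)%type); [exact: cvg_snd|exact: cvg_fst].
Qed.

Lemma cutcost_bounded : exists C : R, forall p, (`|cutcost p| <= C)%R.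
Proof.
exists (2 * M)%R => p; rewrite ger0_norm ?ge_min ?lexx ?orbT//.
by rewrite le_min normr_ge0 mulr_ge0.
Qed.

Lemma measurable_cost : measurable_fun setT (fun p : Rm * Rm => (`|p.2 - p.1|)%:E).
Proof.
apply/measurable_EFinP; apply: measurableT_comp => //.
by apply: measurable_funB; [exact: measurable_snd|exact: measurable_fst].
Qed.

Lemma measurable_cutcost : measurable_fun setT (fun p : Rm * Rm => (cutcost p)%:E).
Proof.
apply/measurable_EFinP; apply: measurable_minr => //.
by apply/measurable_EFinP; exact: measurable_cost.
Qed.

Lemma plan_support (g : probability (Rm * Rm)%type R) : Plans mu nu g ->
  g (~` (`[(- M)%R, M]%classic `*` `[(- M)%R, M]%classic)) = 0.
Proof.
move=> [g1 g2]; set I := `[(- M)%R, M]%classic.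
have mI : measurable (I : set Rm) by exact: measurable_itv.
have mIC := measurableC mI.
have m1 : measurable ((~` I : set Rm) `*` [set: Rm]) by exact: measurableX.
have m2 : measurable ([set: Rm] `*` (~` I : set Rm)) by exact: measurableX.
apply/le_anti/andP; split; last exact: measure_ge0.
apply: (@le_trans _ _ (g ((~` I `*` setT) `|` (setT `*` ~` I)))).
  apply: le_measure; rewrite ?inE.
  - by apply: measurableC; exact: measurableX.
  - exact: measurableU.
  - move=> [x y] /= H; have [Ix|nIx] := pselect (I x); last by left.
    by right; split => // Iy; apply: H.
have e1 : g (~` I `*` setT) = 0 by rewrite g1.
have e2 : g (setT `*` ~` I) = 0 by rewrite g2.
by rewrite -[leRHS]adde0 -{1}e1 -e2; exact: (measureU2 g m1 m2).
Qed.

Lemma cost_cutcost (g : probability (Rm * Rm)%type R) : Plans mu nu g ->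
  cost g = \int[g]_p (cutcost p)%:E.
Proof.
move=> gP; apply: ge0_ae_eq_integral => //.
- exact: measurable_cost.
- exact: measurable_cutcost.
- by move=> p _; rewrite lee_fin le_min normr_ge0 mulr_ge0.
exists (~` (`[(- M)%R, M]%classic `*` `[(- M)%R, M]%classic)); split.
- by apply: measurableC; exact: measurableX.
- exact: plan_support.
- move=> [x y] /= H [xI yI]; apply: H => _; congr EFin.
  rewrite /cutcost min_l//=; move: xI yI; rewrite /= !in_itv/= => /andP[a b] /andP[c d].
  by rewrite ler_norml; lra.
Qed.

Lemma cost_le (g : probability (Rm * Rm)%type R) : Plans mu nu g ->
  cost g <= (2 * M)%:E.
Proof.
move=> gP; rewrite cost_cutcost//.
apply: (@le_trans _ _ (\int[g]_p (cst (2 * M)%:E p))).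
  apply: ge0_le_integral => //.
  - by move=> p _; rewrite lee_fin le_min normr_ge0 mulr_ge0.
  - exact: measurable_cutcost.
  - by move=> p _; rewrite lee_fin ge_min lexx orbT.
by rewrite integral_cst// [X in _ * X](_ : _ = 1) ?mule1//; exact: probability_setT.
Qed.

Lemma cost_fin (g : probability (Rm * Rm)%type R) : Plans mu nu g ->
  cost g \is a fin_num.
Proof.
move=> gP; rewrite ge0_fin_numE; first exact: le_lt_trans (cost_le gP) (ltry _).
by apply: integral_ge0 => p _; rewrite lee_fin.
Qed.

Lemma W1_fin : W1 mu nu \is a fin_num.
Proof.
have [g gP _] := exists_monotone_plan mu nu.
rewrite ge0_fin_numE.
  by apply: le_lt_trans (le_lt_trans (cost_le gP) (ltry _)); apply: ereal_inf_lbound; exists g.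
apply: le_ereal_inf_tmp => _ [h _ <-].
by apply: integral_ge0 => p _; rewrite lee_fin.
Qed.

Lemma W1_le (g : probability (Rm * Rm)%type R) : Plans mu nu g -> W1 mu nu <= cost g.
Proof. by move=> gP; apply: ereal_inf_lbound; exists g. Qed.

Lemma gap_le_cost (g : probability (Rm * Rm)%type R) : Plans mu nu g ->
  \int[g]_p gapA (Aset mu nu) p <= cost g - W1 mu nu.
Proof. by move=> gP; rewrite leeBrDl ?W1_fin// W1_gap. Qed.

Lemma opt_gap0 (g : probability (Rm * Rm)%type R) : Opt1 mu nu g ->
  \int[g]_p gapA (Aset mu nu) p = 0.
Proof.
move=> [gP gW]; apply/le_anti/andP; split; last first.
  by apply: integral_ge0 => p _; exact: measure_ge0.
by apply: le_trans (gap_le_cost gP) _; rewrite gW subee// W1_fin.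
Qed.

Lemma cvg_cost (G : nat -> probability (Rm * Rm)%type R) (g : probability (Rm * Rm)%type R) :
  (forall n, Plans mu nu (G n)) -> Plans mu nu g ->
  (forall phi : R * R -> R, continuous phi ->
    (exists M : R, forall p, (`|phi p| <= M)%R) ->
    (fun n => \int[G n]_p (phi p)%:E) @ \oo --> \int[g]_p (phi p)%:E) ->
  cost (G n) @[n --> \oo] --> cost g.
Proof.
move=> GP gP H; rewrite cost_cutcost//.
rewrite (_ : (fun n => cost (G n)) = (fun n => \int[G n]_p (cutcost p)%:E)).
  by apply: H; [exact: continuous_cutcost|exact: cutcost_bounded].
by apply/funext => n; rewrite cost_cutcost.
Qed.

End bounded_cost.

(** Inserts the bound on cost plus entropy into the Gibbs inequality and cancels [La], the only term
    that diverges with [eps]; its finiteness is what permits the cancellation. *)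
Lemma ereal_shuffle (R : realDomainType) (La lm h lp c a b dd l : \bar R) :
  La \is a fin_num -> La + lm + h + 1 <= lp + c + a + b + dd ->
  a + b <= l + La -> lm + h + 1 <= l + (lp + c + dd).
Proof.
move=> Lf H S; rewrite -(@leeD2lE _ La)// !addeA; apply: (le_trans H).
rewrite [leRHS](_ : _ = (lp + c + dd) + (l + La)); last first.
  by rewrite [RHS]addeC [l + La]addeC !addeA.
rewrite [leLHS](_ : _ = (lp + c + dd) + (a + b)) ?leeD2l//.
by rewrite -!addeA; do 2 congr (_ + _); rewrite addeA addeC.
Qed.

(** * The liminf inequality *)

Section liminf_inequality.
Context {R : realType}.
Local Notation Rm := (measurableTypeR R).
Local Notation leb := (@lebesgue_measure R).
Variables (mu nu : probability Rm R) (M : R) (f fn : Rm -> R).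
Hypothesis M0 : (0 <= M)%R.
Hypothesis muM : mu (~` `[(- M)%R, M]%classic) = 0.
Hypothesis nuM : nu (~` `[(- M)%R, M]%classic) = 0.
Hypothesis df : is_density leb mu f.
Hypothesis dfn : is_density leb nu fn.
Hypothesis Emu : Ent mu leb < +oo.

Let A : set Rm := Aset mu nu.
Let mA : measurable A. Proof. exact: measurable_Aset. Qed.
Let mAC : measurable (~` A). Proof. exact: measurableC. Qed.
Let E : set (Rm * Rm) := ~` A `*` ~` A.
Let mE : measurable E. Proof. exact: measurableX. Qed.
Let mix : set (Rm * Rm) := (A `*` ~` A) `|` (~` A `*` A).

Let mf : measurable_fun setT f. Proof. by case: df. Qed.

Let prob_fin d (T : measurableType d) (P : probability T R) S :
  measurable S -> P S \is a fin_num.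
Proof. by move=> mS; rewrite fin_num_measure. Qed.

Let probT d (T : measurableType d) (P : probability T R) : P setT = 1.
Proof. exact: probability_setT. Qed.

Definition logm := \int[mu]_(x in A) (lnneg (f x))%:E.
Definition logp := \int[mu]_(x in A) (lnpos (f x))%:E.

Lemma logm_fin : logm \is a fin_num.
Proof.
rewrite ge0_fin_numE; last by apply: integral_ge0 => x _; rewrite lee_fin lnneg_ge0.
apply: le_lt_trans (integral_lnneg_lty df muM).
apply: ge0_subset_integral => //.
- by apply/measurable_EFinP; exact: (measurableT_comp measurable_lnneg).
- by move=> x _; rewrite lee_fin lnneg_ge0.
Qed.

Lemma logp_fin : logp \is a fin_num.
Proof.
rewrite ge0_fin_numE; last by apply: integral_ge0 => x _; rewrite lee_fin lnpos_ge0.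
apply: le_lt_trans (integral_lnpos_lty df muM Emu).
apply: ge0_subset_integral => //.
- by apply/measurable_EFinP; exact: (measurableT_comp measurable_lnpos).
- by move=> x _; rewrite lee_fin lnpos_ge0.
Qed.

Lemma Ent_plan_phi (g : probability (Rm * Rm)%type R) (q : Rm * Rm -> R) :
  is_density (mu \x nu) g q -> Ent g (mu \x nu) = \int[mu \x nu]_p (phi (q p))%:E.
Proof.
move=> dq; have g1 : g setT < +oo by rewrite [X in X < _]probT ltry.
have := Ent_phi (prodT mu nu) g1 dq; rewrite [g setT]probT.
move/(congr1 (fun z => z - 1)); rewrite !addeK//; move=> H; exact: H.
Qed.

Lemma Ent_plan_ge0 (g : probability (Rm * Rm)%type R) : 0 <= Ent g (mu \x nu).
Proof.
have [h|h] := pselect (has_density (mu \x nu) g); last first.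
  by rewrite /Ent; case: pselect.
case: h => q dq; rewrite (Ent_plan_phi dq); apply: integral_ge0 => p _.
by rewrite lee_fin phi_ge0//; case: dq.
Qed.

Section along_sequence.
Variables (g : probability (Rm * Rm)%type R) (l : R).
Hypothesis gP : Plans mu nu g.

(* The logarithmic singularity of [Feps] cancels exactly against the one
   produced by Young's inequality: no [eps] is left in the bound. *)
Lemma Feps_bound (eps : R) : (0 < eps)%R -> (2 * eps <= 1)%R ->
  Feps mu nu eps g <= l%:E ->
  forall (K : R) (h1 h2 : Rm * Rm -> R), (0 <= K)%R ->
  measurable_fun setT h1 -> measurable_fun setT h2 ->
  (forall p, (0 <= h1 p)%R) -> (forall p, (0 <= h2 p)%R) ->
  logm + \int[g]_(p in E) (h1 p)%:E + 1 <=
  l%:E + (logp + (K%:E * g mix + \int[g]_(p in E) (h2 p)%:E) +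
   (nu A + (expR (- K))%:E + (expR (- K))%:E +
    \int[mu \x nu]_(p in E) (expR (h1 p - h2 p))%:E)).
Proof.
move=> e0 e1 Fl K h1 h2 K0 mh1 mh2 h10 h20.
set L := (- ln (2 * eps))%R.
have L0 : (0 <= L)%R by rewrite oppr_ge0 ln_le0.
have LE : `|ln (2 * eps)|%R = L by rewrite ler0_norm// ln_le0.
have LA : L%:E * mu A \is a fin_num by rewrite fin_numM//; exact: prob_fin.
have ei : (0 <= eps^-1)%R by rewrite invr_ge0 ltW.
have cW : cost g - W1 mu nu \is a fin_num.
  by rewrite fin_numB (cost_fin M0 muM nuM gP) (W1_fin M0 muM nuM).
have gapc := gap_le_cost M0 muM nuM gP.
move: Fl; rewrite /Feps LE => Fl.
have Fl' : (eps^-1)%:E * (cost g - W1 mu nu) + Ent g (mu \x nu) <= l%:E + L%:E * mu A.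
  by rewrite -leeBlDr.
have aW : (eps^-1)%:E * (cost g - W1 mu nu) \is a fin_num by rewrite fin_numM.
have lA : l%:E + L%:E * mu A \is a fin_num by rewrite fin_numD LA.
(* All terms of [Feps] other than the entropy are finite, so the bound by [l] excludes infinite
   entropy and provides a density. *)
have [q dq] : has_density (mu \x nu) g.
  apply: has_density_Ent; rewrite ltNge; apply/negP; rewrite leye_eq => /eqP Eoo.
  move: Fl' aW lA; rewrite Eoo !fin_numE => + /andP[an _] /andP[_ lp].
  by rewrite addey// leye_eq (negbTE lp).
rewrite (Ent_plan_phi dq) in Fl'.
have := @gibbs_plan R mu nu A f mA df eps e0 g q gP dq e1 K h1 h2 K0 mh1 mh2 h10 h20.
rewrite -/L -/logm -/logp -/E -/mix.
have S : (eps^-1)%:E * \int[g]_p gapA A p + \int[mu \x nu]_p (phi (q p))%:E <= l%:E + L%:E * mu A.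
  by apply: le_trans Fl'; rewrite leeD2r// lee_wpmul2l// lee_fin.
by move=> H; exact: (ereal_shuffle LA H S).
Qed.

End along_sequence.

End liminf_inequality.

Lemma ge0_integral_mrestr d (T : measurableType d) (R : realType)
    (m : {measure set T -> \bar R}) (D : set T) (mD : measurable D) (h : T -> \bar R) :
  measurable_fun setT h -> (forall x, 0 <= h x) ->
  \int[mrestr m mD]_x h x = \int[m]_(x in D) h x.
Proof.
move=> mh h0.
have dD : is_density m (mrestr m mD) (\1_D : T -> R).
  have mi : measurable_fun setT (\1_D : T -> R) by exact: measurable_indic.
  by split => // B mB; rewrite integral_indic// setIC.
rewrite (ge0_integral_density dD)// [RHS]integral_mkcond; apply: eq_integral => x _.
by rewrite patchE indicE; case: ifPn => _; rewrite ?mule1 ?mule0.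
Qed.

Section measure_to_finite.
Context d (T : measurableType d) (R : realType).
Variable m : {measure set T -> \bar R}.

Definition measure_finite of fin_num_fun m : set T -> \bar R := m.

Hypothesis mfin : fin_num_fun m.

HB.instance Definition _ := Measure.copy (measure_finite mfin) m.
HB.instance Definition _ :=
  Measure_isFinite.Build _ _ _ (measure_finite mfin) mfin.

Lemma measure_finite_exists :
  exists P : {finite_measure set T -> \bar R}, forall B, P B = m B.
Proof. by exists (measure_finite mfin : {finite_measure set T -> \bar R}). Qed.

End measure_to_finite.

Lemma exists_density d (T : measurableType d) (R : realType)
    (rho gam : {measure set T -> \bar R}) :
  rho setT = 1 -> gam setT < +oo ->
  (forall B, measurable B -> rho B = 0 -> gam B = 0) ->
  exists q : T -> R, is_density rho gam q.
Proof.
move=> r1 goo dom.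
have [P PE] := measure_probability r1.
have gf : fin_num_fun gam.
  move=> B mB; rewrite ge0_fin_numE//; apply: le_lt_trans goo.
  by apply: le_measure; rewrite ?inE.
have [N NE] := measure_finite_exists gf.
have NP : N `<< P.
  by move=> Z HZ B mB BZ; rewrite NE; apply: dom => //; rewrite -PE; exact: HZ.
have [q [q0 qf iq qE]] := radon_nikodym_sigma_finite NP.
exists (fine \o q); split.
- apply: measurableT_comp; first exact: fine_measurable.
  exact: measurable_int iq.
- by move=> x; rewrite fine_ge0.
- move=> B mB; rewrite -NE qE//.
  rewrite [LHS](eq_measure_integral rho) => [|C mC _]; last exact: PE.
  by apply: eq_integral => x _ /=; rewrite fineK.
Qed.

(** Since [t] times the negative part of [ln t] is at most 1 and [rho] has mass 1, the subtracted
    integral is finite and the difference is meaningful even for infinite entropy. *)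
Lemma Ent_restr_fin d (T : measurableType d) (R : realType)
    (rho gam : {measure set T -> \bar R}) (q : T -> R) :
  rho setT = 1 -> gam setT < +oo -> is_density rho gam q ->
  Ent gam rho = \int[gam]_x (lnpos (q x))%:E - \int[gam]_x (lnneg (q x))%:E /\
  \int[gam]_x (lnneg (q x))%:E \is a fin_num.
Proof.
move=> r1 goo dq; rewrite (Ent_density goo dq) integralE.
have [mq q0 _] := dq.
have mlm : measurable_fun setT (fun x => (lnneg (q x))%:E).
  by apply/measurable_EFinP; exact: (measurableT_comp measurable_lnneg).
have mlp : measurable_fun setT (fun x => (lnpos (q x))%:E).
  by apply/measurable_EFinP; exact: (measurableT_comp measurable_lnpos).
have lm0 x : 0 <= (lnneg (q x))%:E by rewrite lee_fin lnneg_ge0.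
have lp0 x : 0 <= (lnpos (q x))%:E by rewrite lee_fin lnpos_ge0.
rewrite !(ge0_integral_density dq)//; split.
  congr (_ - _); apply: eq_integral => x _.
    rewrite funeposE -EFin_max -EFinM; congr EFin.
    by rewrite /lnpos [RHS]mulrC maxr_pMr// mulr0.
  rewrite funenegE -EFinN -EFin_max -EFinM; congr EFin.
  by rewrite /lnneg [RHS]mulrC maxr_pMr// mulr0 mulrN.
rewrite ge0_fin_numE; last first.
  by apply: integral_ge0 => x _; rewrite mule_ge0 ?lee_fin ?lnneg_ge0.
apply: (@le_lt_trans _ _ (\int[rho]_x cst 1 x)); last first.
  by rewrite integral_cst// mul1e r1 ltry.
apply: ge0_le_integral => //.
- by move=> x _; apply: mule_ge0; rewrite ?lee_fin ?lnneg_ge0.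
- by apply: emeasurable_funM => //; exact/measurable_EFinP.
- by move=> x _; rewrite -EFinM lee_fin; apply: lnnegM_le1; exact: q0.
Qed.

Lemma nnsfun_below d (T : measurableType d) (R : realType) (h : T -> R) :
  measurable_fun setT h -> (forall x, (0 <= h x)%R) ->
  exists H : {nnsfun T >-> R}^nat,
  [/\ forall n x, (H n x <= h x)%R,
      forall x, (fun n => H n x) @ \oo --> h x &
      forall m : {measure set T -> \bar R},
        (fun n => \int[m]_x (H n x)%:E) @ \oo --> \int[m]_x (h x)%:E].
Proof.
move=> mh h0.
have mhE : measurable_fun setT (EFin \o h) by exact/measurable_EFinP.
pose H := nnsfun_approx measurableT mhE.
have c x : (fun n => (H n x)%:E) @ \oo --> (h x)%:E.
  exact: (@cvg_nnsfun_approx _ _ _ _ measurableT _ mhE (fun x _ => h0 x) x).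
have nd x : {homo (fun n => H n x) : n m / (n <= m)%N >-> (n <= m)%R}.
  by move=> n m nm; have /lefP := @nd_nnsfun_approx _ _ _ _ measurableT _ mhE n m nm.
exists H; split => [n x|x|m].
- have ndE : {homo (fun n => (H n x)%:E) : n m / (n <= m)%N >-> n <= m}.
    by move=> a b ab; rewrite lee_fin nd.
  have := ereal_nondecreasing_cvgn ndE.
  move/(cvg_unique (@ereal_hausdorff _))/(_ (c x)) => e.
  by rewrite -lee_fin -e; apply: ereal_sup_ubound; exists n.
- have := c x; move/fine_cvgP => [_]; apply.
- have := @cvg_monotone_convergence _ _ _ m _ measurableT (fun n x => (H n x)%:E).
  rewrite (_ : (fun x => limn _) = (fun x => (h x)%:E)); last first.
    by apply/funext => x; exact: (cvg_lim (@ereal_hausdorff _) (c x)).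
  apply=> [n|n x _|x _ a b ab].
  - exact/measurable_EFinP.
  - by rewrite lee_fin.
  - by rewrite lee_fin nd.
Qed.

(* The dual (Donsker-Varadhan) bound on simple functions gives back the entropy:
   the test functions increase to the positive and negative parts of [ln q],
   [q] being truncated from below for the sake of domination. *)
Lemma Ent_le_dual d (T : measurableType d) (R : realType)
    (rho gam : {measure set T -> \bar R}) (E : set T) (q : T -> R) (c : R) :
  rho setT = 1 -> gam setT < +oo -> measurable E -> is_density rho gam q ->
  (forall h1 h2 : {nnsfun T >-> R}, \int[gam]_x (h1 x)%:E <=
     c%:E + (\int[gam]_x (h2 x)%:E + \int[rho]_(x in E) (expR (h1 x - h2 x))%:E)) ->
  Ent gam rho <= c%:E + gam setT.
Proof.
move=> rho1 gf mE dq H; have [mq q0 gq] := dq.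
have [-> Nf] := Ent_restr_fin rho1 gf dq.
rewrite leeBlDr//.
apply/lee_addgt0Pr => e0 e00.
(* Capping at 1 leaves [lnpos] unchanged when [q] is replaced by [qe = max q e]. *)
pose e := Num.min e0 1%R.
have e_0 : (0 < e)%R by rewrite lt_min e00 ltr01.
have e1 : (e <= 1)%R by rewrite ge_min lexx orbT.
have ee : (e <= e0)%R by rewrite ge_min lexx.
pose qe x := Num.max (q x) e.
have mqe : measurable_fun setT qe by exact: measurable_maxr.
have qe0 x : (0 < qe x)%R by rewrite lt_max e_0 orbT.
have mp : measurable_fun setT (lnpos \o q).
  by apply: measurableT_comp => //; exact: measurable_lnpos.
have mm : measurable_fun setT (lnneg \o qe).
  by apply: measurableT_comp => //; exact: measurable_lnneg.
have mm' : measurable_fun setT (lnneg \o q).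
  by apply: measurableT_comp => //; exact: measurable_lnneg.
have [h1 [h1l h1c h1i]] := nnsfun_below mp (fun x => lnpos_ge0 _).
have [h2 [h2l h2c h2i]] := nnsfun_below mm (fun x => lnneg_ge0 _).
have lnpq x : lnpos (q x) = lnpos (qe x).
  rewrite /lnpos /qe; have [qe'|//] := leP (q x) e.
  by rewrite !max_r// ln_le0// (le_trans qe').
have eq1 x : expR (lnpos (q x) - lnneg (qe x)) = qe x.
  by rewrite lnpq lnposneg lnK ?posrE.
(* Where [q = 0] the convention makes [lnneg q] vanish, possibly below [lnneg qe]. The comparison is
   therefore made against [rho], where the factor [q] removes those points. *)
have N2 n : \int[gam]_x (h2 n x)%:E <= \int[gam]_x (lnneg (q x))%:E.
  apply: (@le_trans _ _ (\int[gam]_x (lnneg (qe x))%:E)).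
    apply: ge0_le_integral => //.
    - by move=> x _; rewrite lee_fin.
    - by apply/measurable_EFinP.
    - by apply/measurable_EFinP.
    - by move=> x _; rewrite lee_fin h2l.
  rewrite (@ge0_integral_density _ _ _ _ _ _ _ (EFin \o (lnneg \o qe)) dq)//; last 2 first.
    exact/measurable_EFinP.
    by move=> *; rewrite /= lee_fin lnneg_ge0.
  rewrite (@ge0_integral_density _ _ _ _ _ _ _ (EFin \o (lnneg \o q)) dq)//; last 2 first.
    exact/measurable_EFinP.
    by move=> *; rewrite /= lee_fin lnneg_ge0.
  apply: ge0_le_integral => //.
  - by move=> x _; rewrite lee_fin mulr_ge0// lnneg_ge0.
  - by apply/measurable_EFinP; exact: measurable_funM.
  - by apply/measurable_EFinP; exact: measurable_funM.
  - move=> x _; rewrite lee_fin.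
    have [->|qn] := eqVneq (q x) 0%R; first by rewrite !mulr0.
    rewrite ler_wpM2r// /lnneg ge_max le_max lerN2 ler_ln ?posrE//; last first.
      by rewrite lt_def qn q0.
    by rewrite /qe le_max lexx/= le_max lexx orbT.
have rE : \int[rho]_(x in E) (qe x)%:E <= gam setT + e%:E.
  apply: (@le_trans _ _ (\int[rho]_x (q x + e)%:E)).
    apply: (@le_trans _ _ (\int[rho]_x (qe x)%:E)).
      apply: ge0_subset_integral => //; first exact/measurable_EFinP.
      by move=> x _; rewrite lee_fin ltW.
    apply: ge0_le_integral => //.
    - by move=> x _; rewrite lee_fin ltW.
    - exact/measurable_EFinP.
    - by apply/measurable_EFinP; exact: measurable_funD.
    - move=> x _; rewrite lee_fin /qe ge_max lerDl lerDr q0 ltW//.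
  under eq_integral do rewrite EFinD.
  rewrite ge0_integralD//;
    try (by move=> x _; rewrite lee_fin ?q0 ?ltW); try exact/measurable_EFinP.
  - by rewrite (integral_cst rho measurableT e%:E) rho1 mule1 gq.
have qint : rho.-integrable setT (fun x => (1 + q x)%:E).
  apply/integrableP; split.
    by apply/measurable_EFinP; exact: measurable_funD.
  under eq_integral => x _ do rewrite gee0_abs ?lee_fin ?addr_ge0// EFinD.
  rewrite ge0_integralD//;
    try (by move=> x _; rewrite lee_fin ?q0 ?ltW); try exact/measurable_EFinP.
  - by rewrite (integral_cst rho measurableT 1%:E) rho1 mule1 -gq// lte_add_pinfty// ltry.
have c3 : (fun n => \int[rho]_(x in E) (expR (h1 n x - h2 n x))%:E) @ \oo -->
    \int[rho]_(x in E) (qe x)%:E.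
  have := @dominated_cvg _ _ _ rho E mE (fun n x => (expR (h1 n x - h2 n x))%:E)
    (fun x => (qe x)%:E) (fun x => (1 + q x)%:E).
  apply => //.
  - move=> n; apply/measurable_EFinP; apply: measurable_funTS.
    apply: measurableT_comp => //; exact: measurable_funB.
  - move=> x _; apply: cvg_EFin; first exact: nearW.
    rewrite -eq1 /=.
    have cB : (fun n => h1 n x - h2 n x)%R @ \oo --> (lnpos (q x) - lnneg (qe x))%R.
      by apply: cvgB; [exact: h1c|exact: h2c].
    by apply: (continuous_cvg _ _ cB); exact: continuous_expR.
  - exact: (integrableS measurableT mE (@subsetT _ _) qint).
  (* Dropping [h2] leaves [exp (lnpos q) = max q 1], at most the integrable [1 + q]. *)
  - move=> n x _; rewrite gee0_abs ?lee_fin ?expR_ge0//.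
    apply: (@le_trans _ _ (expR (lnpos (q x)))).
      by rewrite ler_expR lerBlDr (le_trans (h1l n x))// lerDl.
    rewrite /lnpos; have [l0|l0] := leP (ln (q x)) 0%R.
      by rewrite expR0 lerDl.
    rewrite lnK ?posrE ?lerDr//; rewrite lt_def q0 andbT; apply/eqP => q00.
    by rewrite q00 ln0 // ltxx in l0.
pose N := \int[gam]_x (lnneg (q x))%:E.
have cR : (fun n => c%:E + N + \int[rho]_(x in E) (expR (h1 n x - h2 n x))%:E) @ \oo -->
    c%:E + N + \int[rho]_(x in E) (qe x)%:E.
  apply: cvgeD => //; last exact: cvg_cst.
  by rewrite fin_num_adde_defr// fin_numD Nf.
apply: (le_trans (lee_cvg_to (h1i gam) cR _)).
  apply: nearW => n; apply: (le_trans (H _ _)).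
  have le3 (N' H2 I : \bar R) : H2 <= N' -> c%:E + (H2 + I) <= c%:E + N' + I.
    by move=> H2N; rewrite -addeA leeD2l// leeD2r.
  exact/le3/N2.
have le4 (I gT N' : \bar R) : I <= gT + e%:E ->
    c%:E + N' + I <= c%:E + gT + N' + e0%:E.
  move=> Ie; apply: (@le_trans _ _ (c%:E + N' + (gT + e0%:E))).
    by rewrite leeD2l// (le_trans Ie)// leeD2l// lee_fin.
  by rewrite addeA (addeAC c%:E N').
exact: le4.
Qed.

Lemma fin_num_neqNy (R : realDomainType) (x : \bar R) : x \is a fin_num -> x != -oo.
Proof. by rewrite fin_numE => /andP[]. Qed.

Section liminf_optimal.
Context {R : realType}.
Local Notation Rm := (measurableTypeR R).
Local Notation leb := (@lebesgue_measure R).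
Variables (mu nu : probability Rm R) (M : R) (f fn : Rm -> R).
Hypothesis M0 : (0 <= M)%R.
Hypothesis muM : mu (~` `[(- M)%R, M]%classic) = 0.
Hypothesis nuM : nu (~` `[(- M)%R, M]%classic) = 0.
Hypothesis df : is_density leb mu f.
Hypothesis dfn : is_density leb nu fn.
Hypothesis Emu : Ent mu leb < +oo.

Let A : set Rm := Aset mu nu.
Let mA : measurable A. Proof. exact: measurable_Aset. Qed.
Let mAC : measurable (~` A). Proof. exact: measurableC. Qed.
Let E : set (Rm * Rm) := ~` A `*` ~` A.
Let mE : measurable E. Proof. exact: measurableX. Qed.
Let mix : set (Rm * Rm) := (A `*` ~` A) `|` (~` A `*` A).
Let mM1 : measurable (A `*` ~` A). Proof. exact: measurableX. Qed.
Let mM2 : measurable (~` A `*` A). Proof. exact: measurableX. Qed.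
Let mmix : measurable mix. Proof. exact: measurableU. Qed.
Let rho : {measure set (Rm * Rm)%type -> \bar R} := mu \x nu.
Let rho1 : rho setT = 1. Proof. exact: prodT. Qed.

Let prob_fin d (T : measurableType d) (P : probability T R) S :
  measurable S -> P S \is a fin_num.
Proof. by move=> mS; rewrite fin_num_measure. Qed.

Let prob_lty d (T : measurableType d) (P : probability T R) S :
  measurable S -> P S < +oo.
Proof. by move=> mS; rewrite -ge0_fin_numE// prob_fin. Qed.

Variables (eps : nat -> R) (G : nat -> probability (Rm * Rm)%type R)
  (g : probability (Rm * Rm)%type R) (l : R).
Hypothesis eps0 : forall n, (0 < eps n)%R.
Hypothesis eps1 : forall n, (2 * eps n <= 1)%R.
Hypothesis GP : forall n, Plans mu nu (G n).
Hypothesis gO : Opt1 mu nu g.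
Hypothesis Gg : forall phi : R * R -> R, continuous phi ->
  (exists M : R, forall p, (`|phi p| <= M)%R) ->
  (fun n => \int[G n]_p (phi p)%:E) @ \oo --> \int[g]_p (phi p)%:E.
Hypothesis Fl : forall n, Feps mu nu (eps n) (G n) <= l%:E.

Let gP : Plans mu nu g. Proof. by case: gO. Qed.
Let gap0 : \int[g]_p gapA A p = 0. Proof. exact (opt_gap0 M0 muM nuM gO). Qed.
Let mul := density_null df.
Let nul := density_null dfn.

Let gmix1 : g (A `*` ~` A) = 0. Proof. exact: plan_mixed1 gP mul nul gap0. Qed.
Let gmix2 : g (~` A `*` A) = 0. Proof. exact: plan_mixed2 gP mul nul gap0. Qed.

Lemma cvg_mix : (fun n => fine (G n mix)) @ \oo --> 0%R.
Proof.
have c1 := narrow_rectangle GP gP Gg mA mAC.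
have c2 := narrow_rectangle GP gP Gg mAC mA.
rewrite gmix1 in c1; rewrite gmix2 in c2.
rewrite -[X in _ --> X](addr0 (0 : R)%R).
rewrite (_ : (fun n => _) = (fun n => fine (G n (A `*` ~` A)) + fine (G n (~` A `*` A)))%R).
  exact: cvgD c1 c2.
apply/funext => n; rewrite measureU//; last first.
  by apply/seteqP; split => // -[x y] /= [[Ax _] [nAx _]].
by rewrite fineD//; exact: prob_fin.
Qed.

Let bound n := Feps_bound M0 muM nuM df (GP n) (eps0 n) (eps1 n) (Fl n).

Let gE : {measure set (Rm * Rm)%type -> \bar R} := mrestr g mE.
Let GE n : {measure set (Rm * Rm)%type -> \bar R} := mrestr (G n) mE.

(** Tested with [K = 0], [h2 = 0] and [h1 = la] times the indicator of [S], [Feps_bound] gives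
    [la * GE n S <= C + expR la * rho S]. The threshold [C / expR la] bounds the right side by
    [2 C], and [la = 2 C / e] concludes. *)
Lemma entropy_equi (e : R) : (0 < e)%R -> exists2 d : R, (0 < d)%R &
  forall S, measurable S -> rho S < d%:E -> forall n, GE n S <= e%:E.
Proof.
move=> e0.
have lf := logm_fin nu muM df.
have lp := logp_fin nu muM df Emu.
pose C : R := (`|l| + fine (logp mu nu f) + fine (nu A) + 3)%R.
have lp0 : (0 <= fine (logp mu nu f))%R.
  by apply: fine_ge0; apply: integral_ge0 => x _; rewrite lee_fin lnpos_ge0.
have C0 : (0 < C)%R.
  by apply: ltr_wpDl; rewrite ?ltr0n// !addr_ge0// fine_ge0.
pose la := (2 * C / e)%R.
have la0 : (0 < la)%R by rewrite divr_gt0// mulr_gt0.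
exists (C / expR la)%R; first by rewrite divr_gt0// expR_gt0.
move=> S mS Sd n.
have mi : measurable_fun setT (\1_S : Rm * Rm -> R) by exact: measurable_indic.
pose h1 (p : Rm * Rm) : R := (la * \1_S p)%R.
have mh1 : measurable_fun setT h1 by exact: measurable_funM.
have h10 p : (0 <= h1 p)%R by rewrite mulr_ge0// ltW.
have m0 : measurable_fun setT (cst 0%R : Rm * Rm -> R) by exact: measurable_cst.
have H := @bound n 0%R h1 (cst 0%R) (lexx 0%R) mh1 m0 h10 (fun=> lexx 0%R).
have I1 : \int[G n]_(p in E) (h1 p)%:E = la%:E * GE n S.
  have mi' : measurable_fun E (fun p => (\1_S p : R)%:E).
    by apply/measurable_EFinP; exact: measurable_funTS.
  under eq_integral do rewrite EFinM.
  by rewrite ge0_integralZl_EFin ?(ltW la0)// integral_indic// setIC.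
have I2 : \int[G n]_(p in E) (cst 0%R p)%:E = 0 by exact: integral0.
have I3 : \int[rho]_(p in E) (expR (h1 p - cst 0 p))%:E <= (1 + C)%:E.
  apply: (@le_trans _ _ (\int[rho]_p (1 + expR la * \1_S p)%:E)).
    apply: (@le_trans _ _ (\int[rho]_(p in E) (1 + expR la * \1_S p)%:E)).
      apply: ge0_le_integral => //.
      - apply/measurable_EFinP; apply: measurable_funTS; apply: measurableT_comp => //.
        exact: measurable_funB.
      - apply/measurable_EFinP; apply: measurable_funTS.
        by apply: measurable_funD => //; exact: measurable_funM.
      - move=> p _; rewrite lee_fin subr0 /h1 indicE.
        case: (p \in S); rewrite ?mulr1 ?mulr0 ?expR0 ?addr0//.
        by rewrite lerDr.
    apply: ge0_subset_integral => //.
    by apply/measurable_EFinP; apply: measurable_funD => //; exact: measurable_funM.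
  have mi' : measurable_fun setT (fun p => (\1_S p : R)%:E) by exact/measurable_EFinP.
  under eq_integral do rewrite EFinD EFinM.
  rewrite ge0_integralD//; last exact: measurable_funeM.
  rewrite (integral_cst rho measurableT 1) rho1 mule1.
  rewrite ge0_integralZl_EFin ?expR_ge0// integral_indic// setIT.
  rewrite EFinD leeD2l//.
  apply: (@le_trans _ _ ((expR la)%:E * (C / expR la)%:E)).
    by rewrite lee_wpmul2l ?lee_fin ?expR_ge0// ltW.
  by rewrite -EFinM mulrCA divff ?mulr1// gt_eqF// expR_gt0.
have lm0 : 0 <= logm mu nu f by apply: integral_ge0 => x _; rewrite lee_fin lnneg_ge0.
have GSf : GE n S \is a fin_num by apply: prob_fin; exact: measurableI.
have nAf : nu A \is a fin_num by exact: prob_fin.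
move: H I3; rewrite I1 I2 mul0e oppr0 expR0 !adde0.
move: (\int[rho]_(p in E) _) => I3 H I3C.
rewrite -[leLHS]fineK// lee_fin -(@ler_pM2l _ la)//.
have -> : (la * e = 2 * C)%R by rewrite /la mulfVK// gt_eqF.
rewrite -lee_fin EFinM fineK//.
apply: (@le_trans _ _ (logm mu nu f + la%:E * GE n S + 1)).
  by rewrite -addeA addeCA leeDl// adde_ge0.
apply: (le_trans H).
apply: (@le_trans _ _ (`|l|%:E + (logp mu nu f + (nu A + 1 + 1 + (1 + C)%:E)))).
  apply: leeD; first by rewrite lee_fin ler_norm.
  by rewrite leeD2l// leeD2l.
rewrite -(fineK lp) -(fineK nAf) -!EFinD lee_fin /C.
rewrite -/A; lra.
Qed.

Let GElty n : GE n setT < +oo.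
Proof. by apply: prob_lty; exact: measurableI. Qed.
Let gElty : gE setT < +oo.
Proof. by apply: prob_lty; exact: measurableI. Qed.
Let GEfin n S : measurable S -> GE n S \is a fin_num.
Proof. by move=> mS; apply: prob_fin; exact: measurableI. Qed.
Let gEfin S : measurable S -> gE S \is a fin_num.
Proof. by move=> mS; apply: prob_fin; exact: measurableI. Qed.

(** A rectangle cut by [E] is again a rectangle, with arbitrary measurable sides. This is why
    [narrow_rectangle] must go beyond continuity sets; [entropy_equi] then extends convergence to
    the product sigma-algebra. *)
Lemma cvg_restr S : measurable S -> (fun n => fine (GE n S)) @ \oo --> fine (gE S).
Proof.
have rect (B C : set Rm) : measurable B -> measurable C ->
    (fun n => fine (GE n (B `*` C))) @ \oo --> fine (gE (B `*` C)).
  move=> mB mC.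
  have BC : (B `*` C) `&` E = (B `&` ~` A) `*` (C `&` ~` A).
    by apply/seteqP; split => -[x y] /= [[? ?] [? ?]].
  have := narrow_rectangle GP gP Gg (measurableI _ _ mB mAC) (measurableI _ _ mC mAC).
  by rewrite -BC.
move: S; apply: (@setwise_cvg _ _ _ GE gE rho GElty gElty _ entropy_equi
   [set B `*` C | B in measurable & C in measurable]).
- by rewrite rho1 ltry.
- exact: (@measurable_prod_measurableType _ _ Rm Rm).
- move=> _ _ [B mB [C mC <-]] [B' mB' [C' mC' <-]].
  exists (B `&` B'); first exact: measurableI.
  exists (C `&` C'); first exact: measurableI.
  by apply/seteqP; split => -[x y] /= [[? ?] [? ?]].
- by rewrite -setXTT; exact: rect.
- by move=> _ [B mB [C mC <-]]; exact: rect.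
Qed.

Lemma restr_dominated S : measurable S -> rho S = 0 -> gE S = 0.
Proof.
move=> mS S0.
have G0 n : GE n S = 0.
  apply/le_anti/andP; split; last exact: measure_ge0.
  apply/lee_addgt0Pr => e e0; rewrite add0e.
  by have [d d0] := entropy_equi e0; apply => //; rewrite S0 lte_fin.
have := cvg_restr mS.
rewrite (_ : (fun n => _) = cst 0%R); last by apply/funext => n; rewrite G0.
move/(cvg_unique (@norm_hausdorff _ R^o))/(_ (cvg_cst _)) => g0.
by rewrite -(fineK (gEfin mS)) g0.
Qed.

Let fine_sintegral (m : {measure set (Rm * Rm)%type -> \bar R}) (h : {nnsfun (Rm * Rm)%type >-> R}) :
  (forall S, measurable S -> m S \is a fin_num) ->
  \int[m]_p (h p)%:E = (\sum_(x <- finmap.enum_fset (fset_set (range h))) (x * fine (m (h @^-1` [set x]))))%:E.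
Proof.
move=> mfin; rewrite integralT_nnsfun sintegralE fsbig_finite//= -sumEFin.
by apply: eq_bigr => x _; rewrite EFinM fineK//; exact: mfin.
Qed.

Let mnns (h : {nnsfun (Rm * Rm)%type >-> R}) : measurable_fun setT (fun p => (h p)%:E).
Proof. by apply/measurable_EFinP. Qed.

Lemma cvg_simple (h : {nnsfun (Rm * Rm)%type >-> R}) :
  (fun n => fine (\int[GE n]_p (h p)%:E)) @ \oo --> fine (\int[gE]_p (h p)%:E).
Proof.
rewrite (fine_sintegral h gEfin) (_ : (fun n => _) = (fun n =>
   \sum_(x <- finmap.enum_fset (fset_set (range h))) (x * fine (GE n (h @^-1` [set x]))))%R); last first.
  by apply/funext => n; rewrite (fine_sintegral h (GEfin n)).
rewrite /=; elim: (finmap.enum_fset _) => [|x s IH].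
  by under eq_fun do rewrite big_nil; rewrite big_nil; exact: cvg_cst.
under eq_fun do rewrite big_cons; rewrite big_cons.
apply: cvgD => //; apply: cvgM; first exact: cvg_cst.
exact: cvg_restr.
Qed.

Let nnsE (m : probability (Rm * Rm)%type R) (h : {nnsfun (Rm * Rm)%type >-> R}) :
  \int[m]_(p in E) (h p)%:E = \int[mrestr m mE]_p (h p)%:E.
Proof. by rewrite ge0_integral_mrestr// => p; rewrite lee_fin. Qed.

Let nns_fin (m : {measure set (Rm * Rm)%type -> \bar R}) (h : {nnsfun (Rm * Rm)%type >-> R}) :
  (forall S, measurable S -> m S \is a fin_num) -> \int[m]_p (h p)%:E \is a fin_num.
Proof. by move=> mfin; rewrite (fine_sintegral h mfin). Qed.

Let lm_fin : logm mu nu f \is a fin_num. Proof. exact: (logm_fin nu muM df). Qed.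
Let lp_fin : logp mu nu f \is a fin_num. Proof. exact: (logp_fin nu muM df Emu). Qed.

(** Simple test functions have convergent integrals under setwise convergence, and the term
    [K * G n mix] vanishes in the limit because [K] is fixed. *)
Lemma simple_bound_K (K : R) (h1 h2 : {nnsfun (Rm * Rm)%type >-> R}) : (0 <= K)%R ->
  logm mu nu f + \int[gE]_p (h1 p)%:E + 1 <=
  l%:E + (logp mu nu f + \int[gE]_p (h2 p)%:E +
   (nu A + (expR (- K))%:E + (expR (- K))%:E +
    \int[rho]_(p in E) (expR (h1 p - h2 p))%:E)).
Proof.
move=> K0.
have p1 p : (0 <= h1 p)%R by [].
have p2 p : (0 <= h2 p)%R by [].
have mh1 : measurable_fun setT h1 by [].
have mh2 : measurable_fun setT h2 by [].
have H n := @bound n K h1 h2 K0 mh1 mh2 p1 p2.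
have I0 : 0 <= \int[rho]_(p in E) (expR (h1 p - h2 p))%:E.
  by apply: integral_ge0 => p _; rewrite lee_fin expR_ge0.
have nAf : nu A \is a fin_num by exact: prob_fin.
move: H I0; rewrite -/rho -/A -/E -/mix.
move: (\int[rho]_(p in E) _) => I H I0.
(* If the exponential integral is infinite the right side is [+oo]; otherwise all terms are finite
   and the limit is taken between real sequences. *)
have [If|] := boolP (I \is a fin_num); last first.
  rewrite ge0_fin_numE// -leNgt leye_eq => /eqP ->.
  have h2f := nns_fin h2 gEfin.
  have n1 : nu A + (expR (- K))%:E + (expR (- K))%:E != -oo.
    by apply: fin_num_neqNy; rewrite !fin_numD nAf.
  have n2 : logp mu nu f + \int[gE]_p (h2 p)%:E != -oo.
    by apply: fin_num_neqNy; rewrite fin_numD lp_fin h2f.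
  by rewrite (addey n1) (addey n2) addey// leey.
pose a n := fine (\int[GE n]_p (h1 p)%:E).
pose b n := fine (\int[GE n]_p (h2 p)%:E).
pose c n := fine (G n mix).
pose r1 := fine (logm mu nu f). pose r2 := fine (logp mu nu f).
pose r3 := (fine (nu A) + expR (- K) + expR (- K) + fine I)%R.
have HR n : (r1 + a n + 1 <= l + (r2 + (K * c n + b n) + r3))%R.
  rewrite -lee_fin !EFinD EFinM !fineK//; try exact: nns_fin (GEfin n); last exact: prob_fin.
  by have := H n; rewrite !nnsE.
have cL : (fun n => r1 + a n + 1)%R @ \oo --> (r1 + fine (\int[gE]_p (h1 p)%:E) + 1)%R.
  apply: cvgD; last exact: cvg_cst.
  by apply: cvgD; [exact: cvg_cst|exact: cvg_simple].
have cR : (fun n => l + (r2 + (K * c n + b n) + r3))%R @ \oo -->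
    (l + (r2 + (K * 0 + fine (\int[gE]_p (h2 p)%:E)) + r3))%R.
  apply: cvgD; first exact: cvg_cst.
  apply: cvgD; last exact: cvg_cst.
  apply: cvgD; first exact: cvg_cst.
  apply: cvgD; last exact: cvg_simple.
  by apply: cvgM; [exact: cvg_cst|exact: cvg_mix].
have := ler_cvg_to cL cR (nearW _ HR).
have hf1 := nns_fin h1 gEfin; have hf2 := nns_fin h2 gEfin.
rewrite -lee_fin mulr0 add0r /r1 /r2 /r3 !EFinD !fineK//; apply.
Qed.

Lemma simple_bound (h1 h2 : {nnsfun (Rm * Rm)%type >-> R}) :
  logm mu nu f + \int[gE]_p (h1 p)%:E + 1 <=
  l%:E + (logp mu nu f + \int[gE]_p (h2 p)%:E +
   (nu A + \int[rho]_(p in E) (expR (h1 p - h2 p))%:E)).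
Proof.
apply/lee_addgt0Pr => e e0.
(* Chosen so that [expR (- K) <= e / 2]: the two mixed rectangles together cost at most [e]. *)
pose K := Num.max 0%R (- ln (e / 2))%R.
have K0 : (0 <= K)%R by rewrite le_max lexx.
have e2 : (0 < e / 2)%R by rewrite divr_gt0.
have eK : (expR (- K) <= e / 2)%R.
  rewrite -[leRHS]lnK ?posrE// ler_expR lerNl le_max lexx orbT//.
apply: (le_trans (simple_bound_K h1 h2 K0)).
move: (\int[gE]_p (h2 p)%:E) (\int[rho]_(p in E) _) (logp _ _ _) (nu A) => H2 I lp nA.
rewrite -!addeA; do 4 rewrite leeD2l//.
rewrite addeA [leRHS]addeC leeD2r// -EFinD lee_fin; lra.
Qed.

(** An optimal plan does not charge [A x ~A], so its mass over [E] is all of [nu (~A)]. This mass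
    balance absorbs the additive constants of the Gibbs inequality. *)
Lemma nu_restr : nu A + gE setT = 1.
Proof.
have -> : gE setT = g (setT `*` ~` A).
  rewrite /gE /= /mrestr setTI.
  have -> : setT `*` ~` A = (~` A `*` ~` A) `|` (A `*` ~` A).
    apply/seteqP; split => -[x y] /=; last by case=> -[].
    by move=> [_ nAy]; have [Ax|nAx] := pselect (A x); [right|left].
  apply: (@etrans _ _ (g (~` A `*` ~` A) + g (A `*` ~` A))); first by rewrite gmix1 adde0.
  apply/esym; apply: measureU => //.
  by apply/seteqP; split => // -[x y] /= [[nAx _] [Ax _]].
have [_ ->//] := gP.
have := probability_setC nu mA => ->.
by rewrite addeC subeK ?prob_fin.
Qed.

Lemma Ent_restr_le : Ent gE rho <= l%:E + logp mu nu f - logm mu nu f.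
Proof.
have [q dq] := exists_density rho1 gElty restr_dominated.
(* The [nu A - 1] contained in [c] cancels, by [nu_restr], against the mass of [gE] that
   [Ent_le_dual] adds. *)
pose c := (l + fine (logp mu nu f) + fine (nu A) - 1 - fine (logm mu nu f))%R.
have nuAf : nu A \is a fin_num by exact: prob_fin.
have gEf := gEfin measurableT.
apply: (@le_trans _ _ (c%:E + gE setT)).
  apply: (Ent_le_dual rho1 gElty mE dq) => h1 h2.
  have I0 : 0 <= \int[rho]_(x in E) (expR (h1 x - h2 x))%:E.
    by apply: integral_ge0 => x _; rewrite lee_fin expR_ge0.
  have aux (a h b p nA i : \bar R) : a \is a fin_num -> p \is a fin_num ->
    nA \is a fin_num -> b \is a fin_num -> h \is a fin_num -> 0 <= i ->
    a + h + 1 <= l%:E + (p + b + (nA + i)) ->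
    h <= (l + fine p + fine nA - 1 - fine a)%:E + (b + i).
    move=> /fineK <- /fineK <- /fineK <- /fineK <- /fineK <-.
    case: i => [i i0|_ _|//]; last by rewrite /= leey.
    rewrite -!EFinD !lee_fin /= => ?; lra.
  exact: (aux _ _ _ _ _ _ lm_fin lp_fin nuAf (nns_fin h2 gEfin) (nns_fin h1 gEfin) I0
    (simple_bound h1 h2)).
have := nu_restr; move: nuAf gEf lm_fin lp_fin; rewrite /c.
move: (gE setT) (nu A) (logm _ _ _) (logp _ _ _) => gT nA lm lp.
move=> /fineK <- /fineK <- /fineK <- /fineK <-.
rewrite -!EFinD => -[] ?; rewrite lee_fin /=; lra.
Qed.

Lemma integral_ln_parts (D : set Rm) : measurable D ->
  \int[mu]_(x in D) (ln (f x))%:E =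
  \int[mu]_(x in D) (lnpos (f x))%:E - \int[mu]_(x in D) (lnneg (f x))%:E.
Proof.
move=> mD; rewrite integralE; congr (_ - _); apply: eq_integral => x _.
  by rewrite funeposE /lnpos EFin_max.
by rewrite funenegE /lnneg EFin_max EFinN.
Qed.

Lemma liminf_optimal : f = dens leb mu -> Flim mu nu g <= l%:E.
Proof.
move=> fE; rewrite /Flim; case: pselect => [?|/(_ gO)//].
rewrite -fE integral_ln_parts//.
have := Ent_restr_le; rewrite -/A.
change (restr g (~` A `*` ~` A)) with (gE : set (Rm * Rm) -> \bar R).
move: lm_fin lp_fin; rewrite /logm /logp -/A.
move: (Ent _ _) (\int[mu]_(x in A) (lnneg _)%:E) (\int[mu]_(x in A) (lnpos _)%:E) => e a b.
move=> /fineK <- /fineK <-; case: e => [e| |].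
- by rewrite -!EFinD !lee_fin /= => ?; lra.
- by rewrite -!EFinD leye_eq.
- by move=> _; rewrite -EFinN leNye.
Qed.

End liminf_optimal.

Lemma ereal_between (R : realFieldType) (x y : \bar R) : x < y ->
  exists l : R, x < l%:E < y.
Proof.
case: x y => [x| |] [y| |] //.
- by rewrite lte_fin => xy; exists ((x + y) / 2)%R; rewrite !lte_fin; lra.
- by move=> _; exists (x + 1)%R; rewrite lte_fin ltry; lra.
- by move=> _; exists (y - 1)%R; rewrite lte_fin ltNyr; lra.
- by move=> _; exists 0%R; rewrite ltNyr ltry.
Qed.

Section liminf.
Context {R : realType}.
Local Notation Rm := (measurableTypeR R).
Local Notation leb := (@lebesgue_measure R).
Variables (mu nu : probability Rm R) (M : R).
Hypothesis M0 : (0 <= M)%R.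
Hypothesis muM : mu (~` `[(- M)%R, M]%classic) = 0.
Hypothesis nuM : nu (~` `[(- M)%R, M]%classic) = 0.

(** Since the entropy is nonnegative and [mu A <= 1], a bound on [Feps] limits the excess cost to
    [eps * (|l| + |ln (2 eps)|)]. This tends to 0, and the cost passes to the narrow limit because
    supports are bounded. *)
Lemma liminf_suboptimal (eps : nat -> R) (G : nat -> probability (Rm * Rm)%type R)
    (g : probability (Rm * Rm)%type R) (l : R) :
  (forall n, (0 < eps n)%R) -> (forall n, (2 * eps n <= 1)%R) ->
  eps @ \oo --> 0%R ->
  (forall n, Plans mu nu (G n)) -> Plans mu nu g ->
  (forall phi : R * R -> R, continuous phi ->
    (exists M : R, forall p, (`|phi p| <= M)%R) ->
    (fun n => \int[G n]_p (phi p)%:E) @ \oo --> \int[g]_p (phi p)%:E) ->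
  (forall n, Feps mu nu (eps n) (G n) <= l%:E) -> Opt1 mu nu g.
Proof.
move=> e0 e1 ec GP gP Gg Fl; split=> //.
have Wf := W1_fin M0 muM nuM.
have cf h hP := cost_fin M0 muM nuM (g := h) hP.
have cc := cvg_cost M0 muM nuM GP gP Gg.
apply/le_anti; rewrite W1_le// andbT.
apply/lee_addgt0Pr => d d0.
(* [ln_le_lin] at [(2 eps)^-1] gives [eps * - ln (2 eps) <= eps * la + expR (- la) / 2]; this [la]
   makes the last term at most [d], independently of [eps]. *)
pose la := Num.max 0%R (- ln (2 * d))%R.
have la0 : (0 <= la)%R by rewrite le_max lexx.
have ed : (expR (- la) / 2 <= d)%R.
  rewrite ler_pdivrMr// mulrC -[leRHS]lnK ?posrE ?mulr_gt0// ler_expR.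
  by rewrite lerNl le_max lexx orbT.
have step n : (fine (cost (G n)) <= fine (W1 mu nu) + (eps n * (`|l| + la) + d))%R.
  have E0 := Ent_plan_ge0 mu nu (G n).
  have A1 : mu (Aset mu nu) <= 1 by apply: probability_le1; exact: measurable_Aset.
  have Af : mu (Aset mu nu) \is a fin_num.
    by rewrite fin_num_measure//; exact: measurable_Aset.
  have c0 : (0 <= fine (mu (Aset mu nu)) <= 1)%R.
    by rewrite fine_ge0//= -lee_fin fineK.
  have L0 : (0 <= - ln (2 * eps n))%R by rewrite oppr_ge0 ln_le0.
  have Ll : (- ln (2 * eps n) <= la + expR (- la) / (2 * eps n))%R.
    have ep : (0 < (2 * eps n)^-1)%R by rewrite invr_gt0 mulr_gt0.
    by have := ln_le_lin la ep; rewrite lnV// posrE mulr_gt0.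
  have := Fl n; rewrite /Feps ler0_norm ?ln_le0//.
  rewrite -(fineK Wf) -(fineK (cf _ (GP n))) -(fineK Af).
  rewrite leeBlDr// -EFinB -!EFinM -!EFinD.
  move/(le_trans (leeDl _ E0)); rewrite lee_fin /=.
  move: (fine _) (fine _) (fine _) c0 => w c a /andP[a0 a1] H.
  have := e0 n; move: (eps n) L0 Ll H => e L0 Ll H e_0.
  have H1 : (c - w <= e * (l + (- ln (2 * e)) * a))%R.
    rewrite -(@ler_pM2l _ e^-1) ?invr_gt0// mulKf ?gt_eqF//.
  have H2 : (e * (- ln (2 * e)) <= e * la + expR (- la) / 2)%R.
    have -> : (e * la + expR (- la) / 2 = e * (la + expR (- la) / (2 * e)))%R.
      by field; rewrite gt_eqF.
    by rewrite ler_wpM2l// ltW.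
  have H3 : (e * ((- ln (2 * e)) * a) <= e * (- ln (2 * e)))%R.
    by rewrite ler_wpM2l ?(ltW e_0)// ler_piMr.
  have H4 : (e * l <= e * `|l|)%R by rewrite ler_wpM2l ?(ltW e_0)// ler_norm.
  lra.
have cL : (fun n => fine (cost (G n))) @ \oo --> fine (cost g).
  by apply: fine_cvg; rewrite fineK ?cf.
have cR : (fun n => fine (W1 mu nu) + (eps n * (`|l| + la) + d))%R @ \oo -->
    (fine (W1 mu nu) + (0 * (`|l| + la) + d))%R.
  apply: cvgD; first exact: cvg_cst.
  apply: cvgD; last exact: cvg_cst.
  by apply: cvgM => //; exact: cvg_cst.
have := ler_cvg_to cL cR (nearW _ step).
rewrite mul0r add0r -lee_fin EFinD !fineK ?cf//; apply.
Qed.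

Variables fn : Rm -> R.
Hypothesis df : is_density leb mu (dens leb mu).
Hypothesis dfn : is_density leb nu fn.
Hypothesis Emu : Ent mu leb < +oo.

(** If it failed, a real [l] would separate the two sides, and [Feps] would stay below [l] along a
    sequence of [eps] smaller than [1 / 2] and than [harmonic n]. That forces [g] to be optimal,
    after which [liminf_optimal] contradicts the choice of [l]. *)
Lemma liminf_inequality (g : probability (Rm * Rm)%type R) (G : R -> probability (Rm * Rm)%type R) :
  Plans mu nu g -> (forall e, (0 < e)%R -> Plans mu nu (G e)) -> narrow_cvg0 G g ->
  Flim mu nu g <= liminf0 (fun e => Feps mu nu e (G e)).
Proof.
move=> gP GP Gg; rewrite leNgt; apply/negP => /ereal_between[l /andP[hl lF]].
have ex n : exists e : R, [/\ (0 < e)%R, (2 * e <= 1)%R, (e <= harmonic n)%R &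
    Feps mu nu e (G e) <= l%:E].
  pose d : R := Num.min (harmonic n) (1 / 2)%R.
  have d0 : (0 < d)%R by rewrite lt_min harmonic_gt0/= divr_gt0.
  have /ereal_inf_lt[_ [e /= + <-] el] : ereal_inf [set Feps mu nu e (G e) | e in `]0%R, d[%classic] < l%:E.
    apply: le_lt_trans hl; apply: ereal_sup_ubound; exists d => //=.
    by rewrite in_itv/= d0.
  rewrite in_itv/= lt_min => /andP[e0 /andP[eh e2]].
  by exists e; split => //; [lra|exact: ltW|exact: ltW].
have [eps epsP] := choice ex.
have e0 n : (0 < eps n)%R by have [] := epsP n.
have e1 n : (2 * eps n <= 1)%R by have [] := epsP n.
have ec : eps @ \oo --> 0%R.
  apply: (@squeeze_cvgr _ _ _ _ (cst 0%R) harmonic).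
  - by apply: nearW => n /=; have [? _ ? _] := epsP n; rewrite ltW.
  - exact: cvg_cst.
  - exact: cvg_harmonic.
have Fl n : Feps mu nu (eps n) (G (eps n)) <= l%:E by have [] := epsP n.
have ecr : eps @ \oo --> 0%R^'+.
  move=> B [r /= r0 rB].
  have : \forall n \near \oo, (eps n < r)%R by exact: (cvgr_lt _ ec).
  apply: filterS => n er; apply: rB => //=.
  by rewrite sub0r normrN gtr0_norm.
have Gn phi : continuous phi -> (exists M : R, forall p, (`|phi p| <= M)%R) ->
    (fun n => \int[G (eps n)]_p (phi p)%:E) @ \oo --> \int[g]_p (phi p)%:E.
  by move=> cp bp; exact: cvg_comp ecr (Gg phi cp bp).
have GPn n : Plans mu nu (G (eps n)) by exact: GP.
have gO := liminf_suboptimal e0 e1 ec GPn gP Gn Fl.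
have := liminf_optimal M0 muM nuM df dfn Emu e0 e1 GPn gO Gn Fl erefl.
by rewrite leNgt lF.
Qed.
End liminf.

Lemma measurable_curry1 d1 d2 d3 (T1 : measurableType d1) (T2 : measurableType d2)
    (T3 : measurableType d3) (k : T1 * T2 -> T3) (x : T1) :
  measurable_fun setT k -> measurable_fun setT (fun y => k (x, y)).
Proof. by move=> mk; apply: (measurableT_comp mk). Qed.

(** * The Laplace kernel *)

Section laplace.
Context {R : realType}.
Local Notation Rm := (measurableTypeR R).
Local Notation leb := (@lebesgue_measure R).

Definition laplace (eps t : R) : R := ((2 * eps)^-1 * expR (- (`|t| / eps)))%R.

Lemma measurable_laplace eps :
  measurable_fun setT (fun p : Rm * Rm => laplace eps (p.2 - p.1)).
Proof.
have mB : measurable_fun setT (fun p : Rm * Rm => p.2 - p.1)%R by exact: measurable_funB.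
have mN : measurable_fun setT (fun p : Rm * Rm => `|p.2 - p.1| / eps)%R.
  by apply: measurable_funM => //; exact: measurableT_comp.
apply: measurable_funM => //; apply: measurableT_comp => //.
exact: measurableT_comp.
Qed.

Lemma measurable_laplace1 eps (x : R) :
  measurable_fun setT (fun y : Rm => laplace eps (y - x)).
Proof. exact: (measurable_curry1 x (measurable_laplace eps)). Qed.

Lemma laplace_gt0 eps t : (0 < eps)%R -> (0 < laplace eps t)%R.
Proof. by move=> e0; rewrite mulr_gt0 ?expR_gt0// invr_gt0 mulr_gt0. Qed.

Lemma laplaceN eps t : laplace eps (- t) = laplace eps t.
Proof. by rewrite /laplace normrN. Qed.

Lemma ln_laplace eps t : (0 < eps)%R ->
  ln (laplace eps t) = (- ln (2 * eps) - `|t| / eps)%R.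
Proof.
move=> e0; rewrite /laplace lnM ?posrE ?expR_gt0 ?invr_gt0 ?mulr_gt0//.
by rewrite lnV ?posrE ?mulr_gt0// expRK.
Qed.

Lemma gap_setT (p : R * R) : gap setT p = `|p.2 - p.1|%R.
Proof. by rewrite /gap /gapA setTI leb_crosses. Qed.

(** With the whole line in place of [A] the gap is the distance, and this becomes
    [gap_kernel_le]. *)
Lemma integral_laplace_le1 eps (x : R) : (0 < eps)%R ->
  \int[leb]_y (laplace eps (y - x))%:E <= 1.
Proof.
move=> e0.
have e20 : (0 < 2 * eps)%R by rewrite mulr_gt0.
have H := @gap_kernel_le R setT measurableT eps^-1 x.
rewrite invr_gt0 in H; have {}H := H e0.
have me : measurable_fun setT (fun y : Rm => (expR (- eps^-1 * gap setT (y, x)))%:E).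
  apply/measurable_EFinP; apply: measurableT_comp => //.
  by apply: measurable_funM => //; exact: measurable_gapl.
have -> : \int[leb]_y (laplace eps (y - x))%:E =
    ((2 * eps)^-1)%:E * \int[leb]_y (expR (- eps^-1 * gap setT (y, x)))%:E.
  rewrite -ge0_integralZl_EFin//.
  - by apply: eq_integral => y _; rewrite -EFinM /laplace gap_setT/= distrC mulNr (mulrC eps^-1%R).
  - by rewrite invr_ge0 ltW.
apply: (@le_trans _ _ (((2 * eps)^-1)%:E * (2 / eps^-1)%:E)).
  by rewrite lee_wpmul2l// lee_fin invr_ge0 ltW.
by rewrite invrK -EFinM lee_fin mulVf// gt_eqF.
Qed.

(** With [u = |t| / (2 eps)], half of the exponent absorbs the factor [|t|] through
    [u exp (- u) <= 1 / 2]; the other half is the kernel at scale [2 eps]. First moments thus reduce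
    to masses. *)
Lemma laplace_moment eps t : (0 < eps)%R ->
  (`|t| * laplace eps t <= 2 * eps * laplace (2 * eps) t)%R.
Proof.
move=> e0; rewrite /laplace.
have e20 : (0 < 2 * eps)%R by rewrite mulr_gt0.
set u := (`|t| / (2 * eps))%R.
have u0 : (0 <= u)%R by rewrite divr_ge0// ltW.
have tE : `|t|%R = (u * (2 * eps))%R by rewrite /u divfK// gt_eqF.
have -> : (`|t| / eps = u + u)%R by rewrite tE; field; rewrite gt_eqF.
(* From [exp u >= (1 + u / 2)^2 = 2 u + (1 - u / 2)^2]. *)
have ue : (u * expR (- u) <= 1 / 2)%R.
  have : (1 + u / 2 <= expR (u / 2))%R by exact: expR_ge1Dx.
  have eu : (expR u = expR (u / 2) * expR (u / 2))%R by rewrite -expRD -splitr.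
  rewrite expRN ler_pdivrMr ?expR_gt0// => h.
  have : ((1 + u / 2) * (1 + u / 2) <= expR u)%R.
    by rewrite eu; apply: ler_pM => //; lra.
  have : (0 <= (1 - u / 2) * (1 - u / 2))%R by rewrite -expr2 sqr_ge0.
  lra.
have -> : (2 * eps * ((2 * (2 * eps))^-1 * expR (- u)) = 1 / 2 * expR (- u))%R.
  by field; rewrite gt_eqF.
rewrite tE opprD expRD.
have -> : (u * (2 * eps) * ((2 * eps)^-1 * (expR (- u) * expR (- u))) =
   u * expR (- u) * expR (- u))%R by field; rewrite gt_eqF.
by rewrite ler_wpM2r// expR_ge0.
Qed.

Lemma integral_laplace_moment eps (x : R) : (0 < eps)%R ->
  \int[leb]_y (`|y - x| * laplace eps (y - x))%:E <= (2 * eps)%:E.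
Proof.
move=> e0; have e20 : (0 < 2 * eps)%R by rewrite mulr_gt0.
have m2 := measurable_laplace1 (2 * eps) x.
apply: (@le_trans _ _ (\int[leb]_y (2 * eps * laplace (2 * eps) (y - x))%:E)).
  apply: ge0_le_integral => //.
  - by move=> y _; rewrite lee_fin mulr_ge0// ltW// laplace_gt0.
  - apply/measurable_EFinP; apply: measurable_funM; last exact: measurable_laplace1.
    by apply: measurableT_comp => //; apply: measurable_funB.
  - by apply/measurable_EFinP; apply: measurable_funM.
  - by move=> y _; rewrite lee_fin laplace_moment.
under eq_integral do rewrite EFinM.
rewrite ge0_integralZl_EFin ?(ltW e20)//.
- by rewrite -[leRHS]mule1 lee_wpmul2l ?lee_fin ?(ltW e20)// integral_laplace_le1.
- by move=> y _; rewrite lee_fin ltW// laplace_gt0.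
- by apply/measurable_EFinP.
Qed.

Lemma integral_exp_affine (A c k a b : R) : (a < b)%R ->
  \int[leb]_(y in `[a, b]) (A * c * expR (c * y + k))%:E =
  (A * expR (c * b + k) - A * expR (c * a + k))%:E.
Proof.
move=> ab; rewrite EFinB.
have df (B y : R) : is_derive (y : R^o) (1%R : R^o) (fun y : R^o => B * expR (c * y + k) : R^o)%R
    (B * c * expR (c * y + k))%R.
  by apply: is_derive_eq; rewrite /GRing.scale/=; ring.
have cf (B : R) : continuous (fun y : R => B * expR (c * y + k))%R.
  move=> y; apply: differentiable_continuous; apply/derivable1_diffP.
  by have := df B y; move=> ?; exact: ex_derive.
apply: (@continuous_FTC2 _ (fun y => A * c * expR (c * y + k))%R
  (fun y => A * expR (c * y + k))%R _ _ ab).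
- by apply: continuous_subspaceT; exact: cf.
- split.
  + by move=> y _; have := df A y; move=> ?; exact: ex_derive.
  + by apply: cvg_at_right_filter; exact: cf.
  + by apply: cvg_at_left_filter; exact: cf.
- by move=> y _; rewrite derive1E; have := df A y; move=> ?; exact: derive_val.
Qed.

Lemma integral_laplace_ge (B : set Rm) eps (x r : R) : measurable B -> (0 < eps)%R -> (0 < r)%R ->
  `[(x - r)%R, (x + r)%R]%classic `<=` B ->
  (1 - expR (- (r / eps)))%:E <= \int[leb]_(y in B) (laplace eps (y - x))%:E.
Proof.
move=> mB e0 r0 sB.
have ml := measurable_laplace1 eps x.
have l0 y : 0 <= (laplace eps (y - x))%:E by rewrite lee_fin ltW// laplace_gt0.
have mE (D : set Rm) : measurable D -> measurable_fun D (fun y : Rm => (laplace eps (y - x))%:E).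
  by move=> mD; apply/measurable_EFinP; exact: measurable_funTS.
have m1 : measurable (`[(x - r)%R, x]%classic : set Rm) by exact: measurable_itv.
have m2 : measurable (`]x, (x + r)%R]%classic : set Rm) by exact: measurable_itv.
apply: (@le_trans _ _ (\int[leb]_(y in `[(x - r)%R, x]%classic `|` `]x, (x + r)%R]%classic)
    (laplace eps (y - x))%:E)); last first.
  apply: ge0_subset_integral => //; [exact: measurableU|exact: mE|].
  move=> y /= [|]; rewrite in_itv/= => /andP[y1 y2]; apply: sB; rewrite /= in_itv/=; lra.
rewrite ge0_integral_setU//; last 2 first.
  by apply: mE; exact: measurableU.
  apply/disj_setPS => y /= []; rewrite !in_itv/=; lra.
rewrite integral_itv_obnd_cbnd; last first.
  exact: mE.
have -> : \int[leb]_(y in `[(x - r)%R, x]) (laplace eps (y - x))%:E =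
    \int[leb]_(y in `[(x - r)%R, x]) (1 / 2 * eps^-1 * expR (eps^-1 * y + - (x / eps)))%:E.
  apply: eq_integral => y; rewrite inE/= in_itv/= => /andP[_ yx].
  congr EFin; rewrite /laplace ler0_norm; last lra.
  by congr (_ * expR _)%R; field; rewrite gt_eqF.
have -> : \int[leb]_(y in `[x, (x + r)%R]) (laplace eps (y - x))%:E =
    \int[leb]_(y in `[x, (x + r)%R]) (- (1 / 2) * - eps^-1 * expR (- eps^-1 * y + x / eps))%:E.
  apply: eq_integral => y; rewrite inE/= in_itv/= => /andP[yx _].
  congr EFin; rewrite /laplace ger0_norm; last lra.
  by congr (_ * expR _)%R; field; rewrite gt_eqF.
rewrite !integral_exp_affine; [|lra|lra].
rewrite -EFinD lee_fin.
have -> : (eps^-1 * x + - (x / eps) = 0)%R by field; rewrite gt_eqF.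
have -> : (- eps^-1 * x + x / eps = 0)%R by field; rewrite gt_eqF.
have -> : (eps^-1 * (x - r) + - (x / eps) = - (r / eps))%R by field; rewrite gt_eqF.
have -> : (- eps^-1 * (x + r) + x / eps = - (r / eps))%R by field; rewrite gt_eqF.
rewrite expR0; lra.
Qed.
End laplace.

(* Uniform continuity near the diagonal, in a form that can be integrated. *)
Lemma diagonal_modulus (R : realType) (phi : R * R -> R) (M C d : R) : continuous phi ->
  (0 < d)%R -> (forall p, (`[(- M)%R, M]%classic p.1 /\ `[(- M)%R, M]%classic p.2) -> (`|phi p| <= C)%R) ->
  exists2 L : R, (0 <= L)%R & forall x y, `[(- M)%R, M]%classic x -> `[(- M)%R, M]%classic y ->
    (`|phi (x, y) - phi (x, x)| <= d + L * `|y - x|)%R.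
Proof.
move=> cphi d0 pC.
have [r r0 rP] : exists2 r : R, (0 < r)%R & forall x, `[(- M)%R, M]%classic x ->
    forall y, (`|y - x| < r)%R -> (`|phi (x, y) - phi (x, x)| <= d)%R.
  have := (@segment_compact R (- M) M); rewrite compact_near_coveringP.
  move=> /(_ R (0%R^'+) (fun r x => forall y, (`|y - x| < r)%R -> (`|phi (x, y) - phi (x, x)| <= d)%R) _).
  case=> [x _|r /= r0 rP].
    have d2 : (0 < d / 2)%R by rewrite divr_gt0.
    have /cvgrPdist_lt /(_ _ d2) /nbhs_ballP[r /= r0 rP] := cphi (x, x).
    have r2 : (0 < r / 2)%R by rewrite divr_gt0.
    exists (ball x (r / 2), [set s | (s < r / 2)%R]).
      split; first exact: nbhsx_ballx.
      by apply: (nbhs_right_lt r2).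
    move=> [z s] /= [xz sr] y yzs.
    move: xz; rewrite /ball/= => xz.
    have b1 : (`|phi (x, x) - phi (z, y)| < d / 2)%R.
      apply: rP; split => /=; rewrite /ball/=; first lra.
      by rewrite (_ : x - y = (x - z) - (y - z))%R ?(le_lt_trans (ler_normB _ _))//; lra.
    have b2 : (`|phi (x, x) - phi (z, z)| < d / 2)%R.
      by apply: rP; split => /=; rewrite /ball/=; lra.
    rewrite (_ : phi (z, y) - phi (z, z) = (phi (x, x) - phi (z, z)) - (phi (x, x) - phi (z, y)))%R; last lra.
    by rewrite (le_trans (ler_normB _ _))//; lra.
  exists (r / 2)%R; first by rewrite divr_gt0.
  move=> x xM y xy; apply: (rP (r / 2)%R _ _ x xM y xy) => /=.
    by rewrite sub0r normrN gtr0_norm ?divr_gt0//; lra.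
  by rewrite divr_gt0.
(* At distance at least [r] the trivial bound [2 |C|] is absorbed by the linear term. *)
exists (2 * `|C| / r)%R; first by rewrite divr_ge0 ?mulr_ge0// ltW.
move=> x y xM yM; have [xy|xy] := ltP `|y - x|%R r.
  by rewrite (le_trans (rP x xM y xy))// lerDl !mulr_ge0// invr_ge0 ltW.
apply: (@le_trans _ _ (2 * `|C|)%R).
  rewrite (le_trans (ler_normB _ _))//.
  have c1 := pC (x, y) (conj xM yM); have c2 := pC (x, x) (conj xM xM).
  have := ler_norm C; lra.
apply: (@le_trans _ _ (2 * `|C| / r * `|y - x|))%R; last by rewrite lerDr ltW.
by rewrite -mulrA ler_peMr ?mulr_ge0// mulrC ler_pdivlMr// mul1r.
Qed.

Section real_arithmetic.
Context {R : realFieldType}.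
Local Open Scope ring_scope.

Lemma kaux_arith (a b r c lp L la lm cd e lcs leps l2 : R) : a <= 0 -> b <= 0 -> c <= 1 ->
  lcs + r <= la + e -> leps - lcs <= cd -> L = - l2 - leps -> l2 <= 2 -> 0 <= lm ->
  a + b + r + c + lp + (la + 1) <= L + lm + (4 + 2 * la + lp + cd) + e.
Proof. by move=> *; lra. Qed.

Lemma kernel_arith (a b lna lnb lns la e L lm lp t u d ei : R) :
  (a + b) * lns <= a * lna + b * lnb + b * (la + 1) + e * (a + b) ->
  a * lna + a * (d * ei) + a * lp <= a * (L + lm) ->
  b * lnb + b * (d * ei) + b * lp + b * (la + 1) <= b * (L + lm) + b * t + b * u ->
  (a + b) * lns - (a + b) + 1 + ei * (d * (a + b)) + (a + b) * lp + (a + b) <=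
  1 + (a + b) * (L + lm) + b * t + b * u + e * (a + b).
Proof.
have -> : ei * (d * (a + b)) = a * (d * ei) + b * (d * ei) by ring.
by move=> *; lra.
Qed.
End real_arithmetic.

(** * The recovery kernel on [U x U], its marginals and its entropy *)

Section recovery_kernel.
Context {R : realType}.
Local Notation Rm := (measurableTypeR R).
Local Notation leb := (@lebesgue_measure R).
Variables (mu : probability Rm R) (f : Rm -> R) (U : set Rm) (eps : R).
Hypothesis df : is_density leb mu f.
Hypothesis mU : measurable U.
Hypothesis e0 : (0 < eps)%R.

Let mf : measurable_fun setT f. Proof. by case: df. Qed.
Let f0 x : (0 <= f x)%R. Proof. by case: df => _ + _; apply. Qed.
Let muE B : measurable B -> mu B = \int[leb]_(x in B) (f x)%:E.
Proof. by case: df => _ _; apply. Qed.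

(** Equal to [1 / t] for [t > 0] and to 1 otherwise: positive everywhere, measurable by composition,
    and with logarithm exactly [- ln t]. *)
Let rinv (t : R) : R := expR (- ln t).
Let rinv_gt0 t : (0 < rinv t)%R. Proof. exact: expR_gt0. Qed.
Let rinvE t : (0 < t)%R -> rinv t = t^-1%R.
Proof. by move=> t0; rewrite /rinv expRN lnK. Qed.
Let mrinv d (T : measurableType d) (h : T -> R) : measurable_fun setT h ->
  measurable_fun setT (rinv \o h).
Proof.
move=> mh; apply: measurableT_comp => //; apply: measurableT_comp => //.
by apply: measurableT_comp => //; exact: measurable_ln.
Qed.

Let mX d1 d2 (T1 : measurableType d1) (T2 : measurableType d2) (h : T1 -> R) :
  measurable_fun setT h -> measurable_fun setT (fun p : T1 * T2 => h p.1).
Proof. by move=> mh; exact: measurableT_comp. Qed.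
Let mY d1 d2 (T1 : measurableType d1) (T2 : measurableType d2) (h : T2 -> R) :
  measurable_fun setT h -> measurable_fun setT (fun p : T1 * T2 => h p.2).
Proof. by move=> mh; exact: measurableT_comp. Qed.

Let Up : set Rm := U `&` [set x | (0 < f x)%R].
Let mUp : measurable Up.
Proof.
apply: measurableI => //; rewrite (_ : [set x | _] = f @^-1` `]0%R, +oo[%classic).
  by rewrite -[X in measurable X]setTI; apply: mf => //; exact: measurable_itv.
by apply/seteqP; split => x /=; rewrite in_itv/= andbT.
Qed.
Let iU : measurable_fun setT (\1_Up : Rm -> R). Proof. exact: measurable_indic. Qed.
Let i0 (B : set Rm) x : (0 <= \1_B x :> R)%R. Proof. by rewrite indicE. Qed.

(** A density relative to [mu x mu]. The indicators keep both points where [f > 0], so that the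
    reciprocal is genuine; this loses no [mu]-mass of [U]. *)
Definition kmain (p : Rm * Rm) : R :=
  (\1_Up p.1 * \1_Up p.2 * (laplace eps (p.2 - p.1) * expR (- ln (Num.max (f p.1) (f p.2)))))%R.

Lemma measurable_kmain : measurable_fun setT kmain.
Proof.
apply: measurable_funM; first by apply: measurable_funM; [exact: mX|exact: mY].
apply: measurable_funM; first exact: measurable_laplace.
apply: (@mrinv _ _ (fun p : Rm * Rm => Num.max (f p.1) (f p.2))).
by apply: measurable_maxr; [exact: mX|exact: mY].
Qed.

Lemma kmain_ge0 p : (0 <= kmain p)%R.
Proof.
apply: mulr_ge0; first by apply: mulr_ge0; exact: i0.
by apply: mulr_ge0; [apply/ltW/laplace_gt0|exact: expR_ge0].
Qed.

Lemma kmainC x y : kmain (x, y) = kmain (y, x).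
Proof.
rewrite /kmain/= (mulrC (\1_Up x)%R) (_ : x - y = - (y - x))%R ?laplaceN ?opprB//.
by rewrite maxC.
Qed.

Let mcur (k : Rm * Rm -> R) x : measurable_fun setT k ->
  measurable_fun setT (fun y => (k (x, y))%:E).
Proof. by move=> mk; apply/measurable_EFinP; exact: measurable_curry1. Qed.

(* [f y / max (f x) (f y) <= 1] *)
Let int_kmain (h : Rm -> R) x : measurable_fun setT h -> (forall y, (0 <= h y)%R) ->
  \int[mu]_y (h y * kmain (x, y))%:E <= \int[leb]_y (h y * laplace eps (y - x))%:E.
Proof.
move=> mh h0.
have mhk : measurable_fun setT (fun y => (h y * kmain (x, y))%:E).
  by apply/measurable_EFinP; apply: measurable_funM => //; apply: measurable_curry1; exact: measurable_kmain.
have ml := measurable_laplace1 eps x.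
rewrite (ge0_integral_density df)//; last first.
  by move=> y _; rewrite lee_fin; exact: mulr_ge0 (h0 y) (kmain_ge0 _).
apply: ge0_le_integral => //.
- by move=> y _; apply: mule_ge0; rewrite lee_fin//; exact: mulr_ge0 (h0 y) (kmain_ge0 _).
- by apply: emeasurable_funM => //; exact/measurable_EFinP.
- by apply/measurable_EFinP; exact: measurable_funM.
move=> y _; rewrite -EFinM lee_fin -mulrA ler_wpM2l// /kmain/=.
have l0 := laplace_gt0 (y - x) e0.
have [xU|xU] := boolP (x \in Up); last by rewrite indicE (negbTE xU) !mul0r ltW.
have [yU|yU] := boolP (y \in Up); last by rewrite !indicE (negbTE yU) mulr0 !mul0r ltW.
rewrite !indicE xU yU !mul1r.
move: xU yU; rewrite !inE => -[_ /= fx] [_ /= fy].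
have m0 : (0 < Num.max (f x) (f y))%R by rewrite lt_max fx.
rewrite -[leRHS]mulr1 -mulrA ler_wpM2l ?(ltW l0)//.
by rewrite expRN lnK// mulrC ler_pdivrMr// mul1r le_max lexx orbT.
Qed.

Definition kmass x : R := fine (\int[mu]_y (kmain (x, y))%:E).

Let int_kmain_le1 x : \int[mu]_y (kmain (x, y))%:E <= 1.
Proof.
have H := @int_kmain (cst 1%R) x (measurable_cst _) (fun=> ler01).
apply: le_trans (integral_laplace_le1 x e0).
by move: H; under eq_integral do rewrite mul1r; under [leRHS]eq_integral do rewrite mul1r.
Qed.

Lemma kmassE x : (kmass x)%:E = \int[mu]_y (kmain (x, y))%:E.
Proof.
rewrite /kmass fineK// ge0_fin_numE ?(le_lt_trans (int_kmain_le1 x)) ?ltry//.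
by apply: integral_ge0 => y _; rewrite lee_fin kmain_ge0.
Qed.

Let mfubini (m : {sigma_finite_measure set Rm -> \bar R}) (k : Rm * Rm -> R) :
  measurable_fun setT k -> (forall p, (0 <= k p)%R) ->
  measurable_fun setT (fun x => \int[m]_y (k (x, y))%:E).
Proof.
move=> mk k0; apply: (@measurable_fun_fubini_tonelli_F _ _ _ _ _ m (EFin \o k)).
  exact/measurable_EFinP.
by move=> p; rewrite lee_fin.
Qed.

Let mfine (h : Rm -> \bar R) : measurable_fun setT h -> measurable_fun setT (fine \o h).
Proof. by move=> mh; exact: measurableT_comp. Qed.

Let mkmass : measurable_fun setT kmass.
Proof. by apply: mfine; apply: mfubini; [exact: measurable_kmain|exact: kmain_ge0]. Qed.

Definition defect x : R := (\1_Up x * (1 - kmass x))%R.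

Lemma kmass_le1 x : (kmass x <= 1)%R.
Proof. by rewrite -lee_fin kmassE. Qed.

Lemma defect_ge0 x : (0 <= defect x)%R.
Proof. by rewrite mulr_ge0// subr_ge0 kmass_le1. Qed.

Lemma kmass_ge0 x : (0 <= kmass x)%R.
Proof. by apply: fine_ge0; apply: integral_ge0 => y _; rewrite lee_fin kmain_ge0. Qed.

Lemma defect_le1 x : (defect x <= 1)%R.
Proof.
have := kmass_ge0 x; rewrite /defect indicE.
by case: (x \in Up); rewrite ?mul0r ?mul1r//; lra.
Qed.

Lemma measurable_defect : measurable_fun setT defect.
Proof. by apply: measurable_funM => //; exact: measurable_funB. Qed.

(** The index of the [eps]-cell of [x], cast into [R] so that its measurability follows from
    monotonicity. *)
Definition cellno (x : R) : R := (Num.floor (x / eps))%:~R.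
Definition same_cell : set (Rm * Rm) := [set p | cellno p.1 = cellno p.2].

Let mcellno : measurable_fun setT (cellno : Rm -> Rm).
Proof.
apply: nondecreasing_measurable => // x y xy.
by rewrite /cellno ler_int le_floor// ler_pM2r ?invr_gt0.
Qed.

Lemma measurable_same_cell : measurable same_cell.
Proof.
have mD : measurable_fun setT (fun p : Rm * Rm => cellno p.1 - cellno p.2 : Rm)%R.
  by apply: measurable_funB; [exact: mX|exact: mY].
rewrite (_ : same_cell = setT `&` (fun p : Rm * Rm => cellno p.1 - cellno p.2 : Rm)%R @^-1` [set 0%R]).
  by apply: mD => //; exact: measurable_set1.
rewrite setTI; apply/seteqP; split => p /=; rewrite /same_cell/=.
  by move=> ->; rewrite subrr.
by move/eqP; rewrite subr_eq0 => /eqP.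
Qed.

Let iQ : measurable_fun setT (\1_same_cell : Rm * Rm -> R).
Proof. by apply: measurable_indic; exact: measurable_same_cell. Qed.

Let Q1 x y z : cellno x = cellno y -> (\1_same_cell (x, z) = \1_same_cell (y, z) :> R)%R.
Proof. by move=> xy; rewrite !indicE; congr (_ (nat_of_bool _)); apply/idP/idP; rewrite !inE/= /same_cell/= xy. Qed.

Let QC x y : (\1_same_cell (x, y) = \1_same_cell (y, x) :> R)%R.
Proof. by rewrite !indicE; congr (_ (nat_of_bool _)); apply/idP/idP; rewrite !inE/= /same_cell/= => ->. Qed.

Lemma same_cell_dist x y : cellno x = cellno y -> (`|y - x| <= eps)%R.
Proof.
rewrite /cellno => /eqP; rewrite eqr_int => /eqP xy.
have hx := floor_itv (x / eps)%R; have hy := floor_itv (y / eps)%R.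
move: hx hy; rewrite xy intrD => /andP[x1 x2] /andP[y1 y2].
have : (`|y / eps - x / eps| <= 1)%R by rewrite ler_norml; lra.
by rewrite -mulrBl normrM (gtr0_norm (_ : 0 < eps^-1)%R) ?invr_gt0// ler_pdivrMr// mul1r.
Qed.

Definition cellmass x : R := fine (\int[mu]_z (\1_same_cell (x, z) * defect z)%:E).

Let mQd : measurable_fun setT (fun p : Rm * Rm => \1_same_cell p * defect p.2)%R.
Proof. by apply: measurable_funM => //; apply: mY; exact: measurable_defect. Qed.
Let Qd0 (p : Rm * Rm) : (0 <= \1_same_cell p * defect p.2)%R.
Proof. by rewrite mulr_ge0 ?defect_ge0// indicE. Qed.

Lemma cellmassE x : (cellmass x)%:E = \int[mu]_z (\1_same_cell (x, z) * defect z)%:E.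
Proof.
rewrite /cellmass fineK// ge0_fin_numE; last by apply: integral_ge0 => z _; rewrite lee_fin (Qd0 (x, z)).
apply: (@le_lt_trans _ _ (\int[mu]_z (cst 1%:E z))); last first.
  by rewrite integral_cst// mul1e (le_lt_trans (probability_le1 _ _))// ltry.
apply: ge0_le_integral => //.
- by move=> z _; rewrite lee_fin (Qd0 (x, z)).
- by have := mcur x mQd.
- move=> z _; rewrite lee_fin -[leRHS]mulr1 ler_pM ?defect_ge0 ?defect_le1//; rewrite indicE//.
Qed.

Let cm0 x : (0 <= cellmass x)%R.
Proof. by apply: fine_ge0; apply: integral_ge0 => z _; rewrite lee_fin (Qd0 (x, z)). Qed.

Let cm_cell x y : cellno x = cellno y -> cellmass x = cellmass y.
Proof.
by move=> xy; rewrite /cellmass; congr fine; apply: eq_integral => z _; rewrite (Q1 _ xy).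
Qed.

Let mcm : measurable_fun setT cellmass.
Proof. by apply: mfine; exact: mfubini mQd Qd0. Qed.

(** In each cell, the self-product of the defect measure divided by its mass. It is symmetric, its
    marginals restore what [kmain] lacks, and it moves mass by at most [eps]. *)
Definition kaux (p : Rm * Rm) : R :=
  (\1_same_cell p * (defect p.1 * defect p.2 * expR (- ln (cellmass p.1))))%R.

Lemma measurable_kaux : measurable_fun setT kaux.
Proof.
apply: measurable_funM => //; apply: measurable_funM.
  by apply: measurable_funM; [apply: mX|apply: mY]; exact: measurable_defect.
by apply: (@mrinv _ _ (fun p : Rm * Rm => cellmass p.1)); exact: mX.
Qed.

Lemma kaux_ge0 p : (0 <= kaux p)%R.
Proof.
apply: mulr_ge0; first by rewrite indicE.
by apply: mulr_ge0 (expR_ge0 _); exact: mulr_ge0 (defect_ge0 _) (defect_ge0 _).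
Qed.

Let Qcm x y : (\1_same_cell (x, y) * expR (- ln (cellmass x)) =
  \1_same_cell (x, y) * expR (- ln (cellmass y)))%R.
Proof.
rewrite !indicE; have aux (b : bool) (c d : R) : (b -> c = d) -> (b%:R * c = b%:R * d)%R.
  by case: b => [->//|_]; rewrite !mul0r.
by apply: aux => /set_mem xy; rewrite (cm_cell xy).
Qed.

Lemma kauxC x y : kaux (x, y) = kaux (y, x).
Proof.
rewrite /kaux [(x, y).1]/= [(x, y).2]/= [(y, x).1]/= [(y, x).2]/=.
have aux (q q' a b r r' : R) : (q * r = q * r' -> q = q' -> q * (a * b * r) = q' * (b * a * r'))%R.
  by move=> H <-; transitivity (a * b * (q * r))%R; [ring|rewrite H; ring].
exact: (aux _ _ _ _ _ _ (Qcm x y) (QC x y)).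
Qed.

Let int_kauxE x : \int[mu]_y (kaux (x, y))%:E =
  (defect x * (cellmass x * expR (- ln (cellmass x))))%:E.
Proof.
transitivity (\int[mu]_y ((defect x * expR (- ln (cellmass x)))%:E *
    (\1_same_cell (x, y) * defect y)%:E)).
  apply: eq_integral => y _; rewrite /kaux [(x, y).1]/= [(x, y).2]/= -EFinM; congr EFin.
  have aux (a b c d : R) : (a * (b * c * d) = b * d * (a * c))%R by ring.
  exact: aux.
rewrite ge0_integralZl_EFin ?(mulr_ge0 (defect_ge0 _) (expR_ge0 _))//.
- by rewrite -cellmassE -EFinM -mulrA (mulrC (expR _)).
- by move=> y _; rewrite lee_fin (Qd0 (x, y)).
- by have := mcur x mQd.
Qed.

Lemma int_kaux_le x : \int[mu]_y (kaux (x, y))%:E <= (defect x)%:E.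
Proof.
rewrite int_kauxE lee_fin ler_piMr ?defect_ge0//.
have := cm0 x; rewrite le_eqVlt => /orP[/eqP <-|c0]; first by rewrite mul0r.
by rewrite expRN lnK// divff// gt_eqF.
Qed.

(** There are countably many cells and [cellmass] is constant on each. In a cell of zero defect mass
    the defect itself vanishes [mu]-almost everywhere, so the normalisation in [kaux] fails only on
    a null set. *)
Lemma cellmass0_null : mu.-negligible [set x | cellmass x = 0%R /\ defect x <> 0%R].
Proof.
pose F n := [set x | [/\ cellmass x = 0%R, defect x <> 0%R & unpickle n = Some (Num.floor (x / eps))]].
have -> : [set x | cellmass x = 0%R /\ defect x <> 0%R] = \bigcup_n F n.
  apply/seteqP; split => [x [c0 d0]|x [n _ [c0 d0 _]]//].
  have [n nE] : exists n, unpickle n = Some (Num.floor (x / eps)) :> option int.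
    by exists (pickle (Num.floor (x / eps))); exact: pickleK.
  by exists n.
apply: negligible_bigcup => n.
have [[x [cx dx nx]]|nF] := pselect (exists x, F n x); last first.
  rewrite (_ : F n = set0); first exact: negligible_set0.
  by apply/seteqP; split => // x Fx; apply: nF; exists x.
have mc := mcur x mQd.
have : \int[mu]_z `|(\1_same_cell (x, z) * defect z)%:E| = 0.
  under eq_integral => z _ do rewrite gee0_abs ?lee_fin ?(Qd0 (x, z))//.
  by rewrite -cellmassE cx.
move/(ae_eq_integral_abs mu measurableT mc) => [N [mN N0 sN]].
exists N; split => // z [cz dz nz]; apply: sN => /= /(_ I) [].
have xz : cellno x = cellno z.
  by move: nz; rewrite nx => -[]; rewrite /cellno => ->.
rewrite indicE (_ : (x, z) \in same_cell) ?mul1r; last by rewrite inE /same_cell/=.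
by move=> dz0; apply: dz.
Qed.

Definition kernel (p : Rm * Rm) : R := (kmain p + kaux p)%R.

Lemma measurable_kernel : measurable_fun setT kernel.
Proof. by apply: measurable_funD; [exact: measurable_kmain|exact: measurable_kaux]. Qed.

Lemma kernel_ge0 p : (0 <= kernel p)%R.
Proof. by rewrite addr_ge0 ?kmain_ge0 ?kaux_ge0. Qed.

Lemma kernelC x y : kernel (x, y) = kernel (y, x).
Proof. by rewrite /kernel kmainC kauxC. Qed.

Lemma kernel_supp p : ~ (U `*` U) p -> kernel p = 0%R.
Proof.
move=> nU; rewrite /kernel /kmain /kaux /defect !indicE.
have [/set_mem[x1 _]|_] := boolP (p.1 \in Up); last by rewrite !(mul0r,mulr0,addr0).
have [/set_mem[x2 _]|_] := boolP (p.2 \in Up); last by rewrite !(mul0r,mulr0,addr0).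
by exfalso; apply: nU.
Qed.

Lemma int_kernel_ae :
  {ae mu, forall x, \int[mu]_y (kernel (x, y))%:E = (\1_Up x)%:E}.
Proof.
have [N [mN N0 sN]] := cellmass0_null.
exists N; split => // x /=; apply: contra_notP => nN.
have nZ : ~ (cellmass x = 0%R /\ defect x <> 0%R) by move=> h; apply/nN/sN.
under eq_integral do rewrite EFinD.
rewrite ge0_integralD//; first last.
- by apply: mcur; exact: measurable_kaux.
- by move=> y _; rewrite lee_fin kaux_ge0.
- by apply: mcur; exact: measurable_kmain.
- by move=> y _; rewrite lee_fin kmain_ge0.
rewrite -kmassE int_kauxE -EFinD; congr EFin.
have -> : (defect x * (cellmass x * expR (- ln (cellmass x))) = defect x)%R.
  have [->|/eqP d0] := eqVneq (defect x) 0%R; first by rewrite mul0r.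
  have c0 : (0 < cellmass x)%R.
    by rewrite lt_def cm0 andbT; apply/eqP => c; apply: nZ.
  by rewrite expRN lnK// divff ?mulr1// gt_eqF.
rewrite /defect; have [xU|xU] := boolP (x \in Up).
  by rewrite !indicE xU mul1r addrC subrK.
rewrite !indicE (negbTE xU) mul0r addr0 /kmass.
rewrite (_ : (fun y => _) = cst 0); first by rewrite integral0.
by apply/funext => y; rewrite /kmain /= [in X in (X * _)%R]indicE (negbTE xU) !mul0r.
Qed.

Lemma mu_Up B : measurable B -> mu (B `&` Up) = mu (B `&` U).
Proof.
move=> mB; have f00 : mu (B `&` (U `\` Up)) = 0.
  rewrite muE; last by apply: measurableI => //; exact: measurableD.
  apply: integral0_eq => x [_ [xU nUp]]; congr EFin; apply/eqP.
  by rewrite eq_le f0 andbT leNgt; apply/negP => fx; apply: nUp.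
have -> : B `&` U = (B `&` Up) `|` (B `&` (U `\` Up)).
  apply/seteqP; split => x.
    by move=> [Bx Ux]; have [?|?] := pselect (Up x); [left|right].
  by case=> [[Bx [Ux _]]|[Bx [Ux _]]].
transitivity (mu (B `&` Up) + mu (B `&` (U `\` Up))); first by rewrite f00 adde0.
apply/esym; apply: measureU.
- exact: measurableI.
- by apply: measurableI => //; exact: measurableD.
- by apply/seteqP; split => // x [[_ xU] [_ [_ nU]]].
Qed.

Lemma kernel_cost : \int[mu]_x \int[mu]_y (`|y - x| * kernel (x, y))%:E <= (3 * eps)%:E.
Proof.
have md (x : R) : measurable_fun setT (fun y : Rm => `|y - x|%R).
  by apply: measurableT_comp => //; apply: measurable_funB.
have mdk : measurable_fun setT (fun p : Rm * Rm => `|p.2 - p.1| * kernel p)%R.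
  apply: measurable_funM; last exact: measurable_kernel.
  by apply: measurableT_comp => //; exact: measurable_funB.
apply: (@le_trans _ _ (\int[mu]_x (cst (3 * eps)%:E x))); last first.
  by rewrite integral_cst// -[leRHS]mule1 lee_wpmul2l ?probability_le1// lee_fin mulr_ge0// ltW.
apply: ge0_le_integral => //.
- by move=> x _; apply: integral_ge0 => y _; rewrite lee_fin; exact: mulr_ge0 (normr_ge0 _) (kernel_ge0 _).
- by apply: (mfubini mu mdk) => p; exact: mulr_ge0 (normr_ge0 _) (kernel_ge0 _).
move=> x _.
under eq_integral do rewrite /kernel mulrDr EFinD.
have m1 := measurable_curry1 x measurable_kmain.
have m2 := measurable_curry1 x measurable_kaux.
rewrite ge0_integralD//; first last.
- by apply/measurable_EFinP; exact: measurable_funM.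
- by move=> y _; rewrite lee_fin; exact: mulr_ge0 (normr_ge0 _) (kaux_ge0 _).
- by apply/measurable_EFinP; exact: measurable_funM.
- by move=> y _; rewrite lee_fin; exact: mulr_ge0 (normr_ge0 _) (kmain_ge0 _).
(* [2 eps] bounds the first moment of the Laplace kernel; the last [eps] is the diameter of a cell,
   multiplied by a defect at most 1. *)
rewrite (_ : 3 * eps = 2 * eps + eps)%R; last by lra.
rewrite EFinD leeD//.
  apply: le_trans (integral_laplace_moment x e0).
  by apply: (@int_kmain (fun y => `|y - x|%R)).
apply: (@le_trans _ _ (\int[mu]_y (eps%:E * (kaux (x, y))%:E))).
  apply: ge0_le_integral => //.
  - by move=> y _; rewrite lee_fin; exact: mulr_ge0 (normr_ge0 _) (kaux_ge0 _).
  - by apply/measurable_EFinP; exact: measurable_funM.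
  - by apply: emeasurable_funM => //; exact/measurable_EFinP.
  - move=> y _; rewrite -EFinM lee_fin /kaux [in leLHS]indicE [in leRHS]indicE /=.
    have [/set_mem xy|_] := boolP ((x, y) \in same_cell); last by rewrite !(mul0r,mulr0).
    rewrite ler_wpM2r ?same_cell_dist//; apply: mulr_ge0 => //.
    exact: (mulr_ge0 (mulr_ge0 (defect_ge0 _) (defect_ge0 _)) (expR_ge0 _)).
rewrite ge0_integralZl_EFin ?(ltW e0)//.
- rewrite -[leRHS]mule1 lee_wpmul2l ?lee_fin ?(ltW e0)// (le_trans (int_kaux_le x))//.
  by rewrite lee_fin defect_le1.
- by move=> y _; rewrite lee_fin kaux_ge0.
- by apply/measurable_EFinP.
Qed.

Lemma int_kernel_aeU :
  {ae mu, forall x, \int[mu]_y (kernel (x, y))%:E = (\1_U x)%:E}.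
Proof.
have m0 : mu (U `\` Up) = 0.
  rewrite muE; last exact: measurableD.
  apply: integral0_eq => x [xU nUp]; congr EFin; apply/eqP.
  by rewrite eq_le f0 andbT leNgt; apply/negP => fx; apply: nUp.
have [N [mN N0 sN]] := int_kernel_ae.
exists (N `|` (U `\` Up)); split; first by apply: measurableU => //; exact: measurableD.
  by apply: null_set_setU => //; exact: measurableD.
move=> x /= nx; have [xU|nU] := pselect (U x); last first.
  left; apply: sN => /= h; apply: nx; rewrite h !indicE memNset; last by case.
  by rewrite memNset.
have [xUp|nUp] := pselect (Up x); last by right.
by left; apply: sN => /= h; apply: nx; rewrite h !indicE !mem_set.
Qed.

Let mkh (k : Rm * Rm -> R) (h : Rm -> R) : measurable_fun setT k -> measurable_fun setT h ->
  measurable_fun setT (fun p : Rm * Rm => k p * h p.1)%R.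
Proof. by move=> mk mh; apply: measurable_funM => //; exact: mX. Qed.

Let intkh (m : probability Rm R) (k : Rm * Rm -> R) (h : Rm -> R) x :
  measurable_fun setT k -> (forall p, (0 <= k p)%R) -> (0 <= h x)%R ->
  \int[m]_y (k (x, y) * h x)%:E = (h x)%:E * \int[m]_y (k (x, y))%:E.
Proof.
move=> mk k0 h0; rewrite -ge0_integralZl_EFin//.
- by apply: eq_integral => y _; rewrite -EFinM mulrC.
- by move=> y _; rewrite lee_fin.
- exact: mcur.
Qed.

Lemma int_kernel_fst (h : Rm -> R) : measurable_fun setT h -> (forall x, (0 <= h x)%R) ->
  \int[mu]_x \int[mu]_y (kernel (x, y) * h x)%:E = \int[mu]_(x in U) (h x)%:E.
Proof.
move=> mh h0; rewrite -integral_indicM//.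
have [N [mN N0 sN]] := int_kernel_aeU.
have mi : measurable_fun setT (\1_U : Rm -> R) by exact: measurable_indic.
have kh0 (p : Rm * Rm) : (0 <= kernel p * h p.1)%R.
  exact: mulr_ge0 (kernel_ge0 p) (h0 _).
apply: ge0_ae_eq_integral.
- by [].
- exact: (mfubini mu (mkh measurable_kernel mh) kh0).
- by apply/measurable_EFinP; exact: measurable_funM.
- by move=> x _; apply: integral_ge0 => y _; rewrite lee_fin; exact: (kh0 (x, y)).
- by move=> x _; rewrite lee_fin mulr_ge0.
exists N; split => // x /= nx; apply: sN => /= e; apply: nx => _.
by rewrite (intkh _ measurable_kernel kernel_ge0 (h0 x)) e -EFinM mulrC.
Qed.

Lemma int_kaux_fst (h : Rm -> R) : measurable_fun setT h -> (forall x, (0 <= h x)%R) ->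
  \int[mu]_x \int[mu]_y (kaux (x, y) * h x)%:E <= \int[mu]_x (defect x * h x)%:E.
Proof.
move=> mh h0.
have kh0 (p : Rm * Rm) : (0 <= kaux p * h p.1)%R.
  exact: mulr_ge0 (kaux_ge0 p) (h0 _).
apply: ge0_le_integral.
- by [].
- by move=> x _; apply: integral_ge0 => y _; rewrite lee_fin; exact: (kh0 (x, y)).
- exact: (mfubini mu (mkh measurable_kaux mh) kh0).
- by apply/measurable_EFinP; apply: measurable_funM => //; exact: measurable_defect.
- move=> x _; rewrite (intkh _ measurable_kaux kaux_ge0 (h0 x)) mulrC EFinM.
  by rewrite lee_wpmul2l ?lee_fin// int_kaux_le.
Qed.

Hypothesis Ufin : leb U < +oo.

Definition cellsize x : R := fine (\int[leb]_z (\1_same_cell (x, z) * \1_U z)%:E).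

Let iU' : measurable_fun setT (\1_U : Rm -> R). Proof. exact: measurable_indic. Qed.
Let QU (p : Rm * Rm) : R := (\1_same_cell p * \1_U p.2)%R.
Let mQU : measurable_fun setT QU. Proof. by apply: measurable_funM => //; exact: mY. Qed.
Let QU0 p : (0 <= QU p)%R. Proof. by apply: mulr_ge0; rewrite indicE. Qed.

Lemma cellsizeE x : (cellsize x)%:E = \int[leb]_z (\1_same_cell (x, z) * \1_U z)%:E.
Proof.
rewrite /cellsize fineK// ge0_fin_numE; last by apply: integral_ge0 => z _; rewrite lee_fin (QU0 (x, z)).
apply: (le_lt_trans _ Ufin).
have -> : leb U = \int[leb]_z (\1_U z)%:E by rewrite integral_indic// setIT.
apply: ge0_le_integral.
- by [].
- by move=> z _; rewrite lee_fin (QU0 (x, z)).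
- exact: (mcur x mQU).
- exact/measurable_EFinP.
- by move=> z _; rewrite lee_fin ler_piMl.
Qed.

Lemma cellsize_ge0 x : (0 <= cellsize x)%R.
Proof. by apply: fine_ge0; apply: integral_ge0 => z _; rewrite lee_fin (QU0 (x, z)). Qed.

Lemma measurable_cellsize : measurable_fun setT cellsize.
Proof.
apply: mfine; apply: (@measurable_fun_fubini_tonelli_F _ _ _ _ _ leb (EFin \o QU)).
  exact/measurable_EFinP.
by move=> p; rewrite lee_fin.
Qed.

Let rcm x : R := expR (- ln (cellmass x)).
Let mrcm : measurable_fun setT rcm. Proof. exact: (mrinv mcm). Qed.

(** By Tonelli the integral over [x] is taken first: the defect over the cell of [z], divided by its
    mass, contributes at most 1 for each [z] in [U]. The ratio of size to mass thus has bounded mean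
    although it is not bounded. *)
Lemma int_defect_cellsize :
  \int[mu]_x (defect x * (cellsize x * rcm x))%:E <= leb U.
Proof.
pose k (p : Rm * Rm) : R := (QU p * (defect p.1 * rcm p.1))%R.
have h0 x : (0 <= defect x * rcm x)%R by exact: mulr_ge0 (defect_ge0 x) (expR_ge0 _).
have mh : measurable_fun setT (fun x => defect x * rcm x)%R.
  by apply: measurable_funM => //; exact: measurable_defect.
have mk : measurable_fun setT k by exact: mkh mQU mh.
have k0 p : (0 <= k p)%R by exact: mulr_ge0 (QU0 p) (h0 _).
have -> : \int[mu]_x (defect x * (cellsize x * rcm x))%:E =
    \int[mu]_x \int[leb]_z ((EFin \o k) (x, z)).
  apply: eq_integral => x _.
  transitivity (\int[leb]_z ((defect x * rcm x)%:E * (QU (x, z))%:E)).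
    rewrite ge0_integralZl_EFin//; last 2 first.
    - by move=> z _; rewrite lee_fin.
    - exact: mcur.
    by rewrite -cellsizeE -EFinM mulrA mulrAC.
  by apply: eq_integral => z _; rewrite -EFinM mulrC.
rewrite (@fubini_tonelli _ _ _ _ _ mu leb); last 2 first.
- exact/measurable_EFinP.
- by move=> p; rewrite lee_fin.
have -> : leb U = \int[leb]_z (\1_U z)%:E by rewrite integral_indic// setIT.
apply: ge0_le_integral.
- by [].
- by move=> z _; apply: integral_ge0 => x _; rewrite lee_fin.
- apply: (@measurable_fun_fubini_tonelli_G _ _ _ _ _ mu (EFin \o k)).
    exact/measurable_EFinP.
  by move=> p; rewrite lee_fin.
- exact/measurable_EFinP.
move=> z _.
have -> : \int[mu]_x (EFin \o k) (x, z) =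
    \int[mu]_x ((\1_U z * rcm z)%:E * (\1_same_cell (z, x) * defect x)%:E).
  apply: eq_integral => x _; rewrite /= -EFinM; congr EFin.
  rewrite /k /QU [(x, z).1]/= [(x, z).2]/= QC.
  have aux (a b c d e : R) : (a * c = a * e -> a * b * (d * c) = b * e * (a * d))%R.
    by move=> H; transitivity (b * d * (a * c))%R; [ring|rewrite H; ring].
  exact: (aux _ _ _ _ _ (esym (Qcm z x))).
have U0 : (0 <= \1_U z * rcm z :> R)%R by apply: mulr_ge0 (expR_ge0 _); rewrite indicE.
rewrite ge0_integralZl_EFin//; last 2 first.
- by move=> x _; rewrite lee_fin (Qd0 (z, x)).
- exact: (mcur z mQd).
rewrite -cellmassE -EFinM lee_fin -mulrA ler_piMr//.
have := cm0 z; rewrite le_eqVlt => /orP[/eqP <-|c0]; first by rewrite mulr0.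
by rewrite /rcm expRN lnK// mulVf// gt_eqF.
Qed.

(** The entropy loss in a cell of which [U] retains less than [eps]; it vanishes when [U] contains
    the whole cell. *)
Definition celldef x : R := lnneg (cellsize x / eps).

Lemma measurable_celldef : measurable_fun setT celldef.
Proof.
apply: (measurableT_comp (@measurable_lnneg R)).
by apply: measurable_funM => //; exact: measurable_cellsize.
Qed.

Hypothesis size0 : forall x, U x -> (0 < cellsize x)%R.

Let L := (- ln (2 * eps))%R.

(** [xlnx_add] separates the two parts of the kernel. In the main part, [ln laplace] cancels
    [|y - x| / eps] and leaves [L - ln max (f x) (f y) <= L - ln (f x)]. All remaining errors carry
    a factor [kaux], hence a defect, or a factor [expR (- la)]. *)
Lemma kernel_xlnx (la x y : R) : (0 <= la)%R ->
  (phi (kernel (x, y)) + eps^-1 * (`|y - x| * kernel (x, y)) + kernel (x, y) * lnpos (f x) +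
     kernel (x, y) <=
   1 + kernel (x, y) * (L + lnneg (f x)) +
     kaux (x, y) * (4 + 2 * la + lnpos (f x) + celldef x) +
     kaux (x, y) * (expR (- la) * (cellsize x * rcm x)) + expR (- la) * kernel (x, y))%R.
Proof.
move=> la0.
have a0 := kmain_ge0 (x, y); have b0 := kaux_ge0 (x, y).
have H := xlnx_add a0 b0 la0.
have HA : (kmain (x, y) * ln (kmain (x, y)) + kmain (x, y) * (`|y - x| / eps) +
    kmain (x, y) * lnpos (f x) <= kmain (x, y) * (L + lnneg (f x)))%R.
  have [->|a1] := eqVneq (kmain (x, y)) 0%R; first by rewrite !mul0r !addr0.
  rewrite -!mulrDr ler_wpM2l//.
  move: a1; rewrite /kmain [(x, y).1]/= [(x, y).2]/= !indicE.
  have [/set_mem[_ /= fx]|_] := boolP (x \in Up); last by rewrite !mul0r eqxx.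
  have [/set_mem[_ /= fy]|_] := boolP (y \in Up); last by rewrite mulr0 !mul0r eqxx.
  rewrite !mul1r => _. rewrite lnM ?posrE ?expR_gt0 ?laplace_gt0//.
  rewrite expRK ln_laplace//.
  have : (ln (f x) <= ln (Num.max (f x) (f y)))%R.
    by rewrite ler_ln ?posrE ?lt_max ?fx// le_max lexx.
  have := lnposneg (f x); rewrite /L; lra.
have HB : (kaux (x, y) * ln (kaux (x, y)) + kaux (x, y) * (`|y - x| / eps) +
    kaux (x, y) * lnpos (f x) + kaux (x, y) * (la + 1) <=
    kaux (x, y) * (L + lnneg (f x)) + kaux (x, y) * (4 + 2 * la + lnpos (f x) + celldef x) +
    kaux (x, y) * (expR (- la) * (cellsize x * rcm x)))%R.
  have [->|b1] := eqVneq (kaux (x, y)) 0%R; first by rewrite !mul0r !addr0.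
  rewrite -!mulrDr ler_wpM2l//.
  move: b1; rewrite /kaux [(x, y).1]/= [(x, y).2]/= [\1_same_cell _]indicE.
  have [/set_mem xy|_] := boolP ((x, y) \in same_cell); last by rewrite !mul0r eqxx.
  rewrite mul1r => b1.
  have dx0 : (0 < defect x)%R.
    by rewrite lt_def defect_ge0 andbT; apply: contraNneq b1 => ->; rewrite !mul0r.
  have dy0 : (0 < defect y)%R.
    by rewrite lt_def defect_ge0 andbT; apply: contraNneq b1 => ->; rewrite mulr0 mul0r.
  have xU : U x.
    move: dx0; rewrite /defect indicE.
    by have [/set_mem[]//|_] := boolP (x \in Up); rewrite mul0r ltxx.
  have C0 := size0 xU.
  have r0 : (0 < rcm x)%R by exact: expR_gt0.
  have lnE : (ln (defect x * defect y * expR (- ln (cellmass x))) =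
      ln (defect x) + ln (defect y) + ln (rcm x))%R.
    have aux (a b c : R) : (0 < a)%R -> (0 < b)%R -> (0 < c)%R ->
        ln (a * b * c) = (ln a + ln b + ln c)%R.
      by move=> a1 b1' c1; rewrite lnM ?posrE ?mulr_gt0// lnM.
    by rewrite aux// expR_gt0.
  rewrite lnE.
  have ldx : (ln (defect x) <= 0)%R by rewrite ln_le0// defect_le1.
  have ldy : (ln (defect y) <= 0)%R by rewrite ln_le0// defect_le1.
  have hc : (`|y - x| / eps <= 1)%R by rewrite ler_pdivrMr// mul1r same_cell_dist.
  (* [- ln cellmass] is split as [ln (cellsize / cellmass) - ln cellsize]: the tangent inequality
     handles the first term, and the second is at most [- ln eps + celldef]. *)
  have := ln_le_lin la (mulr_gt0 C0 r0); rewrite lnM ?posrE// => h1.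
  have h2 : (ln eps - ln (cellsize x) <= celldef x)%R.
    by rewrite /celldef /lnneg ln_div ?posrE// opprB le_max lexx.
  have h3 : (L = - ln 2 - ln eps)%R by rewrite /L lnM ?posrE// opprD.
  have h4 : (ln 2 <= 2 :> R)%R by have := @ln_le_lin R 2 0 (ltr0n _ 2); rewrite oppr0 expR0 add0r mul1r.
  have n0 := lnneg_ge0 (f x).
  (* The 4 collects 2 for [ln 2], 1 for the cell diameter over [eps] and 1 from [xlnx_add]. Of the
     two [la], one comes from [xlnx_add] and one from [ln_le_lin]. *)
  exact: (kaux_arith _ ldx ldy hc h1 h2 h3 h4 n0).
exact: (kernel_arith H HA HB).
Qed.

Variable nu : probability Rm R.
Hypothesis nuU : forall B, measurable B -> B `<=` U -> nu B = mu B.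

Let intnuU (h : Rm -> R) : measurable_fun setT h -> (forall y, (0 <= h y)%R) ->
  (forall y, ~ U y -> h y = 0%R) -> \int[nu]_y (h y)%:E = \int[mu]_y (h y)%:E.
Proof.
move=> mh h0 hU.
have e (m : probability Rm R) : \int[m]_y (h y)%:E = \int[m]_(y in U) (h y)%:E.
  rewrite -[RHS]integral_indicM//; apply: eq_integral => y _; rewrite indicE.
  by have [_|/negP yU] := boolP (y \in U); rewrite ?mul1r// mul0r hU// => /mem_set.
rewrite !e; apply: eq_measure_integral => B mB BU; exact: nuU.
Qed.

(** The marginals agree inside [U], so functions supported in [U x U] do not distinguish [mu x nu]
    from [mu x mu], the measure for which the kernel was built. *)
Lemma int_prod_mu (k : Rm * Rm -> R) : measurable_fun setT k -> (forall p, (0 <= k p)%R) ->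
  (forall p, ~ (U `*` U) p -> k p = 0%R) ->
  \int[mu \x nu]_p (k p)%:E = \int[mu]_x \int[mu]_y (k (x, y))%:E.
Proof.
move=> mk k0 kU.
rewrite (@fubini_tonelli1 _ _ _ _ _ mu nu (EFin \o k)); last 2 first.
- exact/measurable_EFinP.
- by move=> p; rewrite lee_fin.
apply: eq_integral => x _; apply: (@intnuU (fun y => k (x, y))) => //.
- exact: measurable_curry1.
- by move=> y nU; apply: kU => -[].
Qed.

Let intD (m : {measure set (Rm * Rm)%type -> \bar R}) (u v : Rm * Rm -> R) :
  measurable_fun setT u -> measurable_fun setT v ->
  (forall p, (0 <= u p)%R) -> (forall p, (0 <= v p)%R) ->
  \int[m]_p (u p + v p)%:E = \int[m]_p (u p)%:E + \int[m]_p (v p)%:E.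
Proof.
move=> m1 m2 u0 v0; under eq_integral do rewrite EFinD.
have mu2 : measurable_fun setT (EFin \o u) by exact/measurable_EFinP.
have mv2 : measurable_fun setT (EFin \o v) by exact/measurable_EFinP.
by apply: ge0_integralD => //; move=> p _; rewrite lee_fin.
Qed.

Let rho : {measure set (Rm * Rm)%type -> \bar R} := mu \x nu.

Let intZ (c : R) (u : Rm * Rm -> R) : (0 <= c)%R -> measurable_fun setT u ->
  (forall p, (0 <= u p)%R) -> \int[rho]_p (c * u p)%:E = c%:E * \int[rho]_p (u p)%:E.
Proof.
move=> c0 m1 u0; under eq_integral do rewrite EFinM.
apply: ge0_integralZl_EFin => //; first by move=> p _; rewrite lee_fin.
exact/measurable_EFinP.
Qed.

Let mkU p : ~ (U `*` U) p -> kaux p = 0%R.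
Proof.
move=> nU; have := kernel_supp nU; rewrite /kernel.
have := kmain_ge0 p; have := kaux_ge0 p.
by move: (kmain p) (kaux p) => a b *; apply/le_anti/andP; split => //; lra.
Qed.

Let int_kernel_h (h : Rm -> R) : measurable_fun setT h -> (forall x, (0 <= h x)%R) ->
  \int[rho]_p (kernel p * h p.1)%:E = \int[mu]_(x in U) (h x)%:E.
Proof.
move=> mh h0; rewrite (@int_prod_mu (fun p => kernel p * h p.1)%R).
- exact (int_kernel_fst mh h0).
- exact: mkh measurable_kernel mh.
- by move=> p; exact: mulr_ge0 (kernel_ge0 p) (h0 _).
- by move=> p /kernel_supp ->; rewrite mul0r.
Qed.

Let int_kaux_h (h : Rm -> R) : measurable_fun setT h -> (forall x, (0 <= h x)%R) ->
  \int[rho]_p (kaux p * h p.1)%:E <= \int[mu]_x (defect x * h x)%:E.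
Proof.
move=> mh h0; rewrite (@int_prod_mu (fun p => kaux p * h p.1)%R).
- exact (int_kaux_fst mh h0).
- exact: mkh measurable_kaux mh.
- by move=> p; exact: mulr_ge0 (kaux_ge0 p) (h0 _).
- by move=> p /mkU ->; rewrite mul0r.
Qed.

Lemma int_kernel_rho : \int[rho]_p (kernel p)%:E = mu U.
Proof.
have := @int_kernel_h (cst 1%R) (measurable_cst _) (fun=> ler01).
rewrite (integral_cst mu mU 1%:E) mul1e => <-.
by apply: eq_integral => p _; rewrite mulr1.
Qed.

(** Integrated form of [kernel_xlnx]: the first marginal of the kernel is [mu] on [U], which turns
    the factor [L] into the singular term [L * mu U]. The last three summands are the errors, made
    small later by a large [la] and a small defect. *)
Lemma kernel_entropy (la : R) : (2 * eps <= 1)%R -> (0 <= la)%R ->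
  \int[rho]_p (phi (kernel p))%:E +
  (eps^-1)%:E * \int[rho]_p (`|p.2 - p.1| * kernel p)%:E +
  \int[mu]_(x in U) (lnpos (f x))%:E + mu U <=
  1 + (L%:E * mu U + \int[mu]_(x in U) (lnneg (f x))%:E) +
  \int[mu]_x (defect x * (4 + 2 * la + lnpos (f x) + celldef x))%:E +
  (expR (- la))%:E * leb U + (expR (- la))%:E * mu U.
Proof.
move=> e1 la0.
have L0 : (0 <= L)%R by rewrite oppr_ge0 ln_le0.
have E0 : (0 <= expR (- la))%R by exact: expR_ge0.
have mk := measurable_kernel; have k0 := kernel_ge0.
have ma := measurable_kaux; have a0 := kaux_ge0.
have mlp : measurable_fun setT (fun x => lnpos (f x)).
  exact: (measurableT_comp (@measurable_lnpos R)).
have mlm : measurable_fun setT (fun x => L + lnneg (f x))%R.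
  by apply: measurable_funD => //; exact: (measurableT_comp (@measurable_lnneg R)).
have mcd := measurable_celldef.
have mh3 : measurable_fun setT (fun x => 4 + 2 * la + lnpos (f x) + celldef x)%R.
  by apply: measurable_funD => //; exact: measurable_funD.
have h30 x : (0 <= 4 + 2 * la + lnpos (f x) + celldef x)%R.
  by rewrite !addr_ge0 ?lnpos_ge0 ?lnneg_ge0 ?mulr_ge0.
have mh4 : measurable_fun setT (fun x => expR (- la) * (cellsize x * rcm x))%R.
  by apply: measurable_funM => //; apply: measurable_funM => //; exact: measurable_cellsize.
have h40 x : (0 <= expR (- la) * (cellsize x * rcm x))%R.
  exact: mulr_ge0 E0 (mulr_ge0 (cellsize_ge0 x) (expR_ge0 _)).
have h20 x : (0 <= L + lnneg (f x))%R by rewrite addr_ge0 ?lnneg_ge0.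
pose A1 (p : Rm * Rm) : R := phi (kernel p).
pose A2' (p : Rm * Rm) : R := (`|p.2 - p.1| * kernel p)%R.
pose A2 (p : Rm * Rm) : R := (eps^-1 * A2' p)%R.
pose A3 (p : Rm * Rm) : R := (kernel p * lnpos (f p.1))%R.
pose B2 (p : Rm * Rm) : R := (kernel p * (L + lnneg (f p.1)))%R.
pose B3 (p : Rm * Rm) : R := (kaux p * (4 + 2 * la + lnpos (f p.1) + celldef p.1))%R.
pose B4 (p : Rm * Rm) : R := (kaux p * (expR (- la) * (cellsize p.1 * rcm p.1)))%R.
pose B5 (p : Rm * Rm) : R := (expR (- la) * kernel p)%R.
have mA1 : measurable_fun setT A1 by exact: (measurableT_comp (@measurable_phi R)).
have mA2' : measurable_fun setT A2'.
  by apply: measurable_funM => //; apply: measurableT_comp => //; exact: measurable_funB.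
have mA2 : measurable_fun setT A2 by exact: measurable_funM.
have mA3 : measurable_fun setT A3 by exact: (mkh mk mlp).
have mB2 : measurable_fun setT B2 by exact: (mkh mk mlm).
have mB3 : measurable_fun setT B3 by exact: (mkh ma mh3).
have mB4 : measurable_fun setT B4 by exact: (mkh ma mh4).
have mB5 : measurable_fun setT B5 by exact: measurable_funM.
have pA1 p : (0 <= A1 p)%R by exact: phi_ge0 (k0 p).
have pA2' p : (0 <= A2' p)%R by exact: mulr_ge0 (normr_ge0 _) (k0 p).
have ei : (0 <= eps^-1)%R by rewrite invr_ge0 ltW.
have pA2 p : (0 <= A2 p)%R by exact: mulr_ge0 ei (pA2' p).
have pA3 p : (0 <= A3 p)%R by exact: mulr_ge0 (k0 p) (lnpos_ge0 _).
have pB2 p : (0 <= B2 p)%R by exact: mulr_ge0 (k0 p) (h20 _).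
have pB3 p : (0 <= B3 p)%R by exact: mulr_ge0 (a0 p) (h30 _).
have pB4 p : (0 <= B4 p)%R by exact: mulr_ge0 (a0 p) (h40 _).
have pB5 p : (0 <= B5 p)%R by exact: mulr_ge0 E0 (k0 p).
have D (u v : Rm * Rm -> R) : measurable_fun setT u -> measurable_fun setT v ->
  measurable_fun setT (fun p => u p + v p)%R by exact: measurable_funD.
have P (u v : Rm * Rm -> R) : (forall p, (0 <= u p)%R) -> (forall p, (0 <= v p)%R) ->
  forall p, (0 <= u p + v p)%R by move=> u0 v0 p; exact: addr_ge0.
have m1 : measurable_fun setT (cst 1%R : Rm * Rm -> R) by exact: measurable_cst.
have p1 : forall p : Rm * Rm, (0 <= (cst 1%R : Rm * Rm -> R) p)%R by move=> p; exact: ler01.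
have EL : \int[rho]_p (A1 p + A2 p + A3 p + kernel p)%:E =
    \int[rho]_p (A1 p)%:E + (eps^-1)%:E * \int[rho]_p (A2' p)%:E +
    \int[mu]_(x in U) (lnpos (f x))%:E + mu U.
  rewrite (intD rho (D _ _ (D _ _ mA1 mA2) mA3) mk (P _ _ (P _ _ pA1 pA2) pA3) k0).
  rewrite (intD rho (D _ _ mA1 mA2) mA3 (P _ _ pA1 pA2) pA3) (intD rho mA1 mA2 pA1 pA2).
  by rewrite (intZ ei mA2' pA2') (int_kernel_h mlp (fun x => lnpos_ge0 _)) int_kernel_rho.
have r1 : rho setT = 1 by exact: prodT.
have ER : \int[rho]_p (1 + B2 p + B3 p + B4 p + B5 p)%:E =
    1 + \int[rho]_p (B2 p)%:E + \int[rho]_p (B3 p)%:E + \int[rho]_p (B4 p)%:E +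
    (expR (- la))%:E * mu U.
  rewrite (intD rho (D _ _ (D _ _ (D _ _ m1 mB2) mB3) mB4) mB5
    (P _ _ (P _ _ (P _ _ p1 pB2) pB3) pB4) pB5).
  rewrite (intD rho (D _ _ (D _ _ m1 mB2) mB3) mB4 (P _ _ (P _ _ p1 pB2) pB3) pB4).
  rewrite (intD rho (D _ _ m1 mB2) mB3 (P _ _ p1 pB2) pB3) (intD rho m1 mB2 p1 pB2).
  rewrite (intZ E0 mk k0) int_kernel_rho (integral_cst rho measurableT 1%:E) mul1e.
  by rewrite r1.
have I2 : \int[rho]_p (B2 p)%:E = L%:E * mu U + \int[mu]_(x in U) (lnneg (f x))%:E.
  rewrite (int_kernel_h mlm h20); under eq_integral do rewrite EFinD.
  rewrite ge0_integralD//.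
  - by rewrite (integral_cst mu mU L%:E).
  - by move=> x _; rewrite lee_fin lnneg_ge0.
  - apply/measurable_EFinP; apply: measurable_funTS.
    exact: (measurableT_comp (@measurable_lnneg R)).
have I3 := int_kaux_h mh3 h30.
have I4 : \int[rho]_p (B4 p)%:E <= (expR (- la))%:E * leb U.
  apply: (le_trans (int_kaux_h mh4 h40)).
  have -> : \int[mu]_x (defect x * (expR (- la) * (cellsize x * rcm x)))%:E =
      \int[mu]_x ((expR (- la))%:E * (defect x * (cellsize x * rcm x))%:E).
    by apply: eq_integral => x _; rewrite -EFinM mulrCA.
  rewrite ge0_integralZl_EFin//.
  - by rewrite lee_wpmul2l ?lee_fin ?int_defect_cellsize.
  - move=> x _; rewrite lee_fin.
    exact: mulr_ge0 (defect_ge0 x) (mulr_ge0 (cellsize_ge0 x) (expR_ge0 _)).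
  - apply/measurable_EFinP; apply: measurable_funM; first exact: measurable_defect.
    by apply: measurable_funM => //; exact: measurable_cellsize.
have LE : \int[rho]_p (A1 p + A2 p + A3 p + kernel p)%:E <=
    \int[rho]_p (1 + B2 p + B3 p + B4 p + B5 p)%:E.
  apply: ge0_le_integral.
  - by [].
  - by move=> p _; rewrite lee_fin; exact: P (P _ _ (P _ _ pA1 pA2) pA3) k0 p.
  - by apply/measurable_EFinP; exact: D (D _ _ (D _ _ mA1 mA2) mA3) mk.
  - by apply/measurable_EFinP; exact: D (D _ _ (D _ _ (D _ _ m1 mB2) mB3) mB4) mB5.
  - by move=> [x y] _; rewrite lee_fin; exact: kernel_xlnx.
rewrite -/(A2' _) in EL.
rewrite EL ER I2 in LE; apply: (le_trans LE).
have fin3 (a b c d a' b' : \bar R) : a <= a' -> b <= b' -> d + a + b + c <= d + a' + b' + c.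
  by move=> aa bb; rewrite leeD2r// leeD// leeD2l.
exact: fin3.
Qed.

End recovery_kernel.

Ltac nneg := solve [repeat first [ exact: normr_ge0 | exact: expR_ge0 | solve [auto]
  | rewrite indicE; exact: ler0n | apply: mulr_ge0 | apply: addr_ge0 ]].
Ltac side := solve [ exact/measurable_EFinP | apply/measurable_EFinP; exact: measurable_funTS
  | apply: measurable_funeM; apply/measurable_EFinP; exact: measurable_funTS
  | by move=> *; rewrite -?EFinM -?EFinD lee_fin; nneg ].

(** Dominated convergence, as each point eventually leaves the sets [S n]. It serves both for
    boundary layers of [U] and for the large values of [lnpos f]. *)
Lemma integral_tail_small d (T : measurableType d) (R : realType)
    (m : {measure set T -> \bar R}) (S : nat -> set T) (h : T -> R) (e : R) :
  (forall n, measurable (S n)) -> (forall x, exists N, forall n, (N <= n)%N -> ~ S n x) ->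
  measurable_fun setT h -> (forall x, (0 <= h x)%R) -> \int[m]_x (h x)%:E < +oo ->
  (0 < e)%R -> exists n, \int[m]_(x in S n) (h x)%:E <= e%:E.
Proof.
move=> mS S0 mh h0 hfin e0.
have mi n : measurable_fun setT (fun x => \1_(S n) x * h x)%R.
  by apply: measurable_funM => //; exact: measurable_indic.
have c : (fun n => \int[m]_x (\1_(S n) x * h x)%:E) @ \oo --> \int[m]_x (cst 0 x : \bar R).
  have := @dominated_cvg _ _ _ m setT measurableT (fun n x => (\1_(S n) x * h x)%:E)
    (cst 0) (fun x => (h x)%:E); apply => //.
  - by move=> n; apply/measurable_EFinP.
  - move=> x _; have [N Nn] := S0 x.
    apply: cvg_near_cst; exists N => // n /= Nln.
    by rewrite indicE memNset ?mul0r//; exact: Nn.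
  - apply/integrableP; split; first exact/measurable_EFinP.
    by under eq_integral => x _ do rewrite gee0_abs ?lee_fin//.
  - move=> n x _; rewrite gee0_abs ?lee_fin ?mulr_ge0//; rewrite ?indicE//.
    by case: (_ \in _); rewrite ?mul1r ?mul0r.
rewrite integral0 in c.
have /fine_cvgP[nf /cvgrPdist_le/(_ _ e0)[N _ /(_ N (leqnn N))]] := c.
case: nf => N' _ nf _.
have := c => /fine_cvgP[_ /cvgrPdist_le/(_ _ e0)[N2 _ H]].
exists (maxn N' N2).
have := H (maxn N' N2) (leq_maxr _ _); rewrite /= sub0r normrN => He.
rewrite -integral_indicM// -[leLHS]fineK; last by apply: nf; exact: leq_maxl.
by rewrite lee_fin (le_trans (ler_norm _)).
Qed.

(** * Smallness of the defect *)

Section open_set.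
Context {R : realType}.
Local Notation Rm := (measurableTypeR R).
Local Notation leb := (@lebesgue_measure R).
Variable U : set R.
Hypothesis oU : open U.

Let mU : measurable (U : set Rm). Proof. exact: open_measurable. Qed.

Definition near_compl (r : R) : set R := U `&` \bigcup_(y in ~` U) ball y r.

Lemma measurable_near_compl r : measurable (near_compl r : set Rm).
Proof.
apply: measurableI => //; apply: open_measurable.
by apply: bigcup_open => y _; exact: ball_open.
Qed.

Lemma near_complN r x : U x -> ~ near_compl r x -> ball x r `<=` U.
Proof.
move=> Ux nx y xy; apply: contrapT => nUy; apply: nx; split => //.
by exists y => //; exact: ball_sym.
Qed.

Lemma near_compl_out x : exists N, forall n, (N <= n)%N -> ~ near_compl (harmonic n) x.
Proof.
have [Ux|nUx] := pselect (U x); last by exists 0%N => n _ [].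
have /nbhs_ballP[r /= r0 rU] : nbhs x U by exact: open_nbhs_nbhs.
have [N _ HN] : \forall n \near \oo, (harmonic n < r)%R by exact: (cvgr_lt _ cvg_harmonic).
exists N => n Nn [_ [y nUy xy]]; apply: nUy; apply: rU.
apply: ball_sym; apply: le_ball xy; apply: ltW; exact: HN.
Qed.

Variables (mu : probability Rm R) (f : Rm -> R) (M : R).
Hypothesis df : is_density leb mu f.
Hypothesis M0 : (0 <= M)%R.
Hypothesis UM : U `<=` `[(- M)%R, M]%classic.

Let mf : measurable_fun setT f. Proof. by case: df. Qed.
Let f0 x : (0 <= f x)%R. Proof. by case: df => _ + _; apply. Qed.

Lemma leb_bounded : leb U <= (2 * M)%:E.
Proof.
apply: (@le_trans _ _ (leb (`[(- M)%R, M]%classic : set R))).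
  by apply: le_measure; rewrite ?inE//; exact: measurable_itv.
rewrite lebesgue_measure_itv/= lte_fin; case: ifP => _; rewrite ?lee_fin ?mulr_ge0//.
lra.
Qed.

Section fixed_eps.
Variable eps : R.
Hypothesis e0 : (0 < eps)%R.
Let K (x y : R) : R := laplace eps (y - x).
Let K0 x y : (0 <= K x y)%R. Proof. exact/ltW/laplace_gt0. Qed.
Let mK : measurable_fun setT (fun p : Rm * Rm => K p.1 p.2).
Proof. exact: measurable_laplace. Qed.
Let mK1 x : measurable_fun setT (fun y : Rm => K x y). Proof. exact: measurable_laplace1. Qed.
Let iU : measurable_fun setT (\1_U : Rm -> R). Proof. exact: measurable_indic. Qed.

Let intU_le1 x : \int[leb]_(y in U) (K x y)%:E <= 1.
Proof.
apply: le_trans (integral_laplace_le1 x e0).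
by apply: ge0_subset_integral => //; [exact/measurable_EFinP|move=> y _; rewrite lee_fin].
Qed.

(** The closed interval of radius [r / 2] lies in [U]; the Laplace mass outside it is [exp (- t)]
    with [t = r / (2 eps)], at most [1 / t]. *)
Let intU_laplace_ge x (r : R) : (0 < r)%R -> U x -> ~ near_compl r x ->
  (1 - 2 * eps / r)%:E <= \int[leb]_(y in U) (K x y)%:E.
Proof.
move=> r0 Ux nx; have bU := near_complN Ux nx.
have r2 : (0 < r / 2)%R by rewrite divr_gt0.
apply: le_trans (integral_laplace_ge mU e0 r2 _); last first.
  by move=> y /=; rewrite in_itv/= => xy; apply: bU; rewrite /ball/= ltr_norml; lra.
rewrite lee_fin lerD2l lerN2 expRN.
have : (1 + r / 2 / eps <= expR (r / 2 / eps))%R by exact: expR_ge1Dx.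
move=> h; have t0 : (0 < r / 2 / eps)%R by rewrite divr_gt0.
apply: (@le_trans _ _ (r / 2 / eps)^-1%R).
  by rewrite lef_pV2 ?posrE ?expR_gt0//; lra.
by rewrite !invf_div mulrA (mulrC eps).
Qed.

Let Up : set Rm := U `&` [set x | (0 < f x)%R].

(** Three sources of missing mass: the boundary layer, where the defect is only known to be at most
    1; the Laplace tail at interior points; and the replacement of [f y / max (f x) (f y)] by 1,
    which after multiplication by [f x] costs at most [|f x - f y|]. *)
Let defect_pointwise x (r : R) : (0 < r)%R ->
  (defect mu f U eps x * f x)%:E <=
  (\1_(near_compl r) x * f x)%:E + ((2 * eps / r) * f x)%:E +
    \int[leb]_(y in U) (\1_U x * (K x y * `|f x - f y|))%:E.
Proof.
move=> r0.
have er : (0 <= 2 * eps / r)%R by rewrite divr_ge0 ?mulr_ge0 ?ltW.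
have mKf : measurable_fun setT (fun y : Rm => K x y * `|f x - f y|)%R.
  by apply: measurable_funM => //; apply: measurableT_comp => //; exact: measurable_funB.
have mU1 : measurable_fun U (fun y : Rm => (K x y * `|f x - f y|)%:E).
  by apply/measurable_EFinP; exact: measurable_funTS.
have I0 : 0 <= \int[leb]_(y in U) (\1_U x * (K x y * `|f x - f y|))%:E.
  by apply: integral_ge0 => y _; rewrite lee_fin; nneg.
rewrite /defect indicE; have [/set_mem[Ux /= fx]|_] := boolP (x \in _); last first.
  by rewrite !mul0r adde_ge0// adde_ge0// lee_fin mulr_ge0 ?indicE.
rewrite mul1r; move: I0; rewrite indicE mem_set//.
under eq_integral do rewrite mul1r.
move=> I0.
have H : (f x)%:E * \int[leb]_(y in U) (K x y)%:E <=
    (f x * kmass mu f U eps x)%:E + \int[leb]_(y in U) (K x y * `|f x - f y|)%:E.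
  have mkm := measurable_curry1 x (measurable_kmain eps df mU).
  have mkf : measurable_fun setT (fun y => (kmain f U eps (x, y) * f y))%R by exact: measurable_funM.
  have -> : (f x * kmass mu f U eps x)%:E =
      (f x)%:E * \int[leb]_(y in U) (kmain f U eps (x, y) * f y)%:E.
    rewrite EFinM (kmassE df mU e0); congr (_ * _).
    rewrite (ge0_integral_density df)//; last 2 first.
      exact/measurable_EFinP.
      by move=> y _; rewrite lee_fin (kmain_ge0 _ _ e0).
    rewrite -[RHS]integral_indicM//; apply: eq_integral => y _; rewrite -EFinM; congr EFin.
    have [yU|nyU] := pselect (U y); first by rewrite indicE mem_set// mul1r.
    rewrite [in RHS]indicE memNset// mul0r /kmain [(x, y).2]/= [\1__ y]indicE.
    by rewrite memNset ?mulr0 ?mul0r//; case.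
  have km0 p : (0 <= kmain f U eps p)%R by exact: kmain_ge0.
  rewrite -!ge0_integralZl_EFin//; try side.
  rewrite -ge0_integralD//; try side.
  apply: ge0_le_integral => //.
  - by move=> y _; rewrite -EFinM lee_fin mulr_ge0.
  - by apply: measurable_funeM; apply/measurable_EFinP; exact: measurable_funTS.
  - apply: emeasurable_funD => //.
    by apply: measurable_funeM; apply/measurable_EFinP; exact: measurable_funTS.
  move=> y Uy; rewrite -!EFinM -EFinD lee_fin /kmain [(x, y).1]/= [(x, y).2]/= !indicE.
  rewrite (@mem_set _ _ x) ?mul1r//.
  have [/set_mem[_ /= fy]|nyU] := boolP (y \in _); last first.
    have -> : f y = 0%R.
      apply/eqP; rewrite eq_le f0 andbT leNgt; apply/negP => fy.
      by move/negP: nyU; apply; rewrite inE.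
    by rewrite mulr0 mulr0 add0r subr0 ger0_norm// mulrC.
  rewrite mul1r -/(K x y) expRN lnK ?posrE ?lt_max ?fx//.
  have k0 := K0 x y; move: (K x y) k0 => k k0.
  have [fxy|fxy] := leP (f x) (f y).
    by rewrite mulfVK ?gt_eqF// lerDl mulr_ge0.
  rewrite gtr0_norm ?subr_gt0//.
  have -> : (f x * (k / f x * f y) = k * f y)%R by field; rewrite gt_eqF.
  lra.
have km1 := kmass_le1 df mU e0 x.
have [nx|nx] := pselect (near_compl r x).
  rewrite indicE (mem_set nx) mul1r -addeA lee_paddr//.
    by rewrite adde_ge0// lee_fin mulr_ge0.
  by rewrite lee_fin ler_piMl// gerBl (kmass_ge0 _ _ _ e0).
rewrite indicE memNset// mul0r add0e.
have G := intU_laplace_ge r0 Ux nx.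
have : (f x * (1 - 2 * eps / r))%:E <= (f x * kmass mu f U eps x)%:E +
    \int[leb]_(y in U) (K x y * `|f x - f y|)%:E.
  by apply: le_trans H; rewrite EFinM lee_wpmul2l// lee_fin.
have aux (I : \bar R) (a b c d : R) : 0 <= I -> a%:E <= b%:E + I -> (d = c + a - b)%R ->
    d%:E <= c%:E + I.
  case: I => [I| |].
  - by move=> _; rewrite -!EFinD !lee_fin => h ->; lra.
  - by move=> *; rewrite /= leey.
  - by [].
by move=> h; apply: (aux _ _ _ _ _ I0 h); ring.
Qed.

(** As [f] is merely integrable, [|f x - f y|] is compared with an auxiliary [h]. The kernel has
    mass at most 1 in either variable, so each replacement of [f] by [h] costs one [L^1] distance;
    the increments of [h] are paid by the mass and the first moment of the kernel. *)
Lemma int_defect_le (h : R -> R) (r dl Lh : R) : (0 < r)%R -> (0 <= dl)%R -> (0 <= Lh)%R ->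
  measurable_fun setT (h : Rm -> R) ->
  (forall x y, U x -> U y -> (`|h x - h y| <= dl + Lh * `|y - x|)%R) ->
  \int[mu]_x (defect mu f U eps x)%:E <=
  mu (near_compl r) + (2 * eps / r)%:E +
  (\int[leb]_(x in U) (`|f x - h x|)%:E + \int[leb]_(x in U) (`|f x - h x|)%:E +
   ((dl + Lh * (2 * eps)) * (2 * M))%:E).
Proof.
move=> r0 dl0 Lh0 mh hL.
have mN := measurable_near_compl r.
have er : (0 <= 2 * eps / r)%R by rewrite divr_ge0 ?mulr_ge0 ?ltW.
have md := measurable_defect df mU e0.
have d0 := defect_ge0 df mU e0.
pose A x := `|f x - h x|%R.
have mA : measurable_fun setT A by apply: measurableT_comp => //; exact: measurable_funB.
have miN : measurable_fun setT (\1_(near_compl r) : Rm -> R) by exact: measurable_indic.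
pose W (p : Rm * Rm) : R := (\1_U p.1 * (\1_U p.2 * (K p.1 p.2 * `|f p.1 - f p.2|)))%R.
have mX (u : Rm -> R) : measurable_fun setT u -> measurable_fun setT (fun p : Rm * Rm => u p.1).
  by move=> mu1; exact: measurableT_comp.
have mY (u : Rm -> R) : measurable_fun setT u -> measurable_fun setT (fun p : Rm * Rm => u p.2).
  by move=> mu1; exact: measurableT_comp.
have mW : measurable_fun setT W.
  apply: measurable_funM; first exact: mX.
  apply: measurable_funM; first exact: mY.
  apply: measurable_funM => //; apply: measurableT_comp => //.
  by apply: measurable_funB; [exact: mX|exact: mY].
have W0 p : (0 <= W p)%R by rewrite /W; nneg.
have tonF (k : Rm * Rm -> R) : measurable_fun setT k -> (forall p, (0 <= k p)%R) ->
    measurable_fun setT (fun x => \int[leb]_y (k (x, y))%:E).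
  move=> mk k0; apply: (@measurable_fun_fubini_tonelli_F _ _ _ _ _ leb (EFin \o k)).
    exact/measurable_EFinP.
  by move=> p; rewrite lee_fin.
pose V1 (p : Rm * Rm) : R := (\1_U p.1 * (\1_U p.2 * (K p.1 p.2 * A p.1)))%R.
pose V2 (p : Rm * Rm) : R := (\1_U p.1 * (\1_U p.2 * (K p.1 p.2 * A p.2)))%R.
pose V3 (p : Rm * Rm) : R := (\1_U p.1 * (\1_U p.2 * (K p.1 p.2 * (dl + Lh * `|p.2 - p.1|))))%R.
have mV u : measurable_fun setT u ->
    measurable_fun setT (fun p : Rm * Rm => \1_U p.1 * (\1_U p.2 * (K p.1 p.2 * u p)))%R.
  move=> mu1; apply: measurable_funM; first exact: mX.
  by apply: measurable_funM; [exact: mY|exact: measurable_funM].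
have mV1 : measurable_fun setT V1 by apply: mV; exact: mX.
have mV2 : measurable_fun setT V2 by apply: mV; exact: mY.
have mc : measurable_fun setT (fun p : Rm * Rm => dl + Lh * `|p.2 - p.1|)%R.
  apply: measurable_funD => //; apply: measurable_funM => //.
  by apply: measurableT_comp => //; exact: measurable_funB.
have mV3 : measurable_fun setT V3 by exact: mV.
have V10 p : (0 <= V1 p)%R by rewrite /V1; nneg.
have V20 p : (0 <= V2 p)%R by rewrite /V2; nneg.
have V30 p : (0 <= V3 p)%R by rewrite /V3; nneg.
have WV p : (W p <= V1 p + V2 p + V3 p)%R.
  rewrite /W /V1 /V2 /V3 !indicE.
  have [/set_mem U1|_] := boolP (p.1 \in U); last by rewrite !mul0r !addr0.
  have [/set_mem U2|_] := boolP (p.2 \in U); last by rewrite !mul0r !mulr0 !addr0.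
  rewrite !mul1r -!mulrDr ler_wpM2l// /A.
  have := hL _ _ U1 U2; have n1 := ler_norm (f p.1 - f p.2)%R.
  rewrite (_ : f p.1 - f p.2 = (f p.1 - h p.1) + (h p.1 - h p.2) - (f p.2 - h p.2))%R; last lra.
  move=> hh; rewrite (le_trans (ler_normB _ _))// (le_trans (lerD (ler_normD _ _) (lexx _)))//; lra.
have IK x : \int[leb]_y (\1_U y * K x y)%:E <= 1 by rewrite integral_indicM.
have KC x y : K x y = K y x by rewrite /K -laplaceN opprB.
have mKU x : measurable_fun setT (fun y => (\1_U y * K x y)%:E).
  by apply/measurable_EFinP; exact: (measurable_funM iU (mK1 x)).
have KU0 x y : (0 <= \1_U y * K x y)%R by nneg.
have inner (u : Rm -> R) x : measurable_fun setT u -> (forall x, (0 <= u x)%R) ->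
    \int[leb]_y (u x * (\1_U y * K x y))%:E <= (u x)%:E.
  move=> mu1 u0; under eq_integral do rewrite EFinM.
  rewrite ge0_integralZl_EFin//; try side; last exact: mKU.
  by rewrite -[leRHS]mule1 lee_wpmul2l ?lee_fin.
have mUA : measurable_fun setT (fun x => \1_U x * A x)%R by exact: measurable_funM.
have UA0 x : (0 <= \1_U x * A x)%R by nneg.
have J1 : \int[leb]_x \int[leb]_y (V1 (x, y))%:E <= \int[leb]_(x in U) (A x)%:E.
  rewrite -[leRHS]integral_indicM//; apply: ge0_le_integral.
  - by [].
  - by move=> x _; apply: integral_ge0 => y _; rewrite lee_fin.
  - exact: tonF mV1 V10.
  - exact/measurable_EFinP.
  - move=> x _; apply: le_trans (inner _ x mUA UA0); rewrite le_eqVlt; apply/orP; left; apply/eqP.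
    by apply: eq_integral => y _; congr EFin; rewrite /V1/=; ring.
have J2 : \int[leb]_x \int[leb]_y (V2 (x, y))%:E <= \int[leb]_(x in U) (A x)%:E.
  rewrite (@fubini_tonelli _ _ _ _ _ leb leb (EFin \o V2)); last 2 first.
  - exact/measurable_EFinP.
  - by move=> p; rewrite lee_fin.
  rewrite -[leRHS]integral_indicM//; apply: ge0_le_integral.
  - by [].
  - by move=> x _; apply: integral_ge0 => y _; rewrite lee_fin.
  - apply: (@measurable_fun_fubini_tonelli_G _ _ _ _ _ leb (EFin \o V2)).
      exact/measurable_EFinP.
    by move=> p; rewrite lee_fin.
  - exact/measurable_EFinP.
  - move=> x _; apply: le_trans (inner _ x mUA UA0); rewrite le_eqVlt; apply/orP; left; apply/eqP.
    by apply: eq_integral => y _; congr EFin; rewrite /V2/= (KC y x); ring.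
have c0 : (0 <= dl + Lh * (2 * eps))%R by rewrite addr_ge0// !mulr_ge0// ltW.
have J3 : \int[leb]_x \int[leb]_y (V3 (x, y))%:E <= ((dl + Lh * (2 * eps)) * (2 * M))%:E.
  apply: (@le_trans _ _ (\int[leb]_x (\1_U x * (dl + Lh * (2 * eps)))%:E)); last first.
    rewrite integral_indicM// (integral_cst leb mU (dl + Lh * (2 * eps))%:E) EFinM.
    by rewrite lee_wpmul2l ?lee_fin ?leb_bounded.
  apply: ge0_le_integral.
  - by [].
  - by move=> x _; apply: integral_ge0 => y _; rewrite lee_fin.
  - exact: tonF mV3 V30.
  - by apply/measurable_EFinP; exact: measurable_funM.
  move=> x _.
  have mdx : measurable_fun setT (fun y : Rm => `|y - x| * K x y)%R.
    by apply: measurable_funM => //; apply: measurableT_comp => //; exact: measurable_funB.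
  apply: (@le_trans _ _ (\int[leb]_y ((\1_U x * dl) * K x y + (\1_U x * Lh) * (`|y - x| * K x y))%:E)).
    apply: ge0_le_integral => //.
    - by move=> y _; rewrite lee_fin.
    - by apply/measurable_EFinP; exact: measurable_curry1.
    - by apply/measurable_EFinP; apply: measurable_funD; exact: measurable_funM.
    - move=> y _; rewrite lee_fin /V3/= [\1_U y]indicE.
      have e1 : (K x y * (dl + Lh * `|y - x|) = dl * K x y + Lh * (`|y - x| * K x y))%R by ring.
      rewrite e1 -[(_ * dl * _)%R]mulrA -[(_ * Lh * _)%R]mulrA -mulrDr.
      rewrite ler_wpM2l ?indicE// ler_piMl//; last by case: (_ \in _).
      nneg.
  under eq_integral do rewrite EFinD EFinM (EFinM (\1_U x * Lh)).
  have u0 : (0 <= \1_U x :> R)%R by rewrite indicE.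
  rewrite ge0_integralD//; try side.
  rewrite !ge0_integralZl_EFin ?mulr_ge0//; try side.
  rewrite mulrDr EFinD leeD//.
    by rewrite -[leRHS]mule1 lee_wpmul2l ?lee_fin ?mulr_ge0// integral_laplace_le1.
  rewrite (mulrA (\1_U x)%R) [leRHS]EFinM; apply: lee_wpmul2l.
    by rewrite lee_fin mulr_ge0.
  exact: integral_laplace_moment.
have JW : \int[leb]_x \int[leb]_y (W (x, y))%:E <=
   \int[leb]_(x in U) (A x)%:E + \int[leb]_(x in U) (A x)%:E + ((dl + Lh * (2 * eps)) * (2 * M))%:E.
  apply: (@le_trans _ _ (\int[leb]_x (\int[leb]_y (V1 (x, y))%:E + \int[leb]_y (V2 (x, y))%:E +
      \int[leb]_y (V3 (x, y))%:E))).
    apply: ge0_le_integral => //.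
    - by move=> x _; apply: integral_ge0 => y _; rewrite lee_fin.
    - exact: tonF mW W0.
    - by apply: emeasurable_funD; [apply: emeasurable_funD|]; exact: tonF.
    move=> x _; have m1 := measurable_curry1 x mV1; have m2 := measurable_curry1 x mV2.
    have m3 := measurable_curry1 x mV3.
    rewrite -ge0_integralD//; [|by move=> y _; rewrite lee_fin|exact/measurable_EFinP|
      by move=> y _; rewrite lee_fin|exact/measurable_EFinP].
    rewrite -ge0_integralD//; [|by move=> y _; rewrite -EFinD lee_fin addr_ge0|
      by apply: emeasurable_funD; exact/measurable_EFinP|by move=> y _; rewrite lee_fin|
      exact/measurable_EFinP].
    apply: ge0_le_integral => //.
    - by move=> y _; rewrite lee_fin.
    - by apply/measurable_EFinP; exact: measurable_curry1.
    - by apply: emeasurable_funD; [apply: emeasurable_funD|]; exact/measurable_EFinP.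
    - by move=> y _; rewrite -!EFinD lee_fin.
  have g0 k : (forall p, (0 <= k p)%R) -> forall x : Rm, 0 <= \int[leb]_y (k (x, y))%:E.
    by move=> k0 x; apply: integral_ge0 => y _; rewrite lee_fin.
  rewrite ge0_integralD//; [|by move=> x _; apply: adde_ge0; exact: g0|
    by apply: emeasurable_funD; exact: tonF|by move=> x _; exact: g0|exact: tonF].
  rewrite ge0_integralD//; [|by move=> x _; exact: g0|exact: tonF|by move=> x _; exact: g0|exact: tonF].
  by apply: leeD => //; exact: leeD.
have md' : measurable_fun setT (fun x => defect mu f U eps x * f x)%R by exact: measurable_funM.
have mNf : measurable_fun setT (fun x => \1_(near_compl r) x * f x)%R by exact: measurable_funM.
rewrite (ge0_integral_density df)//; last 2 first.
  exact/measurable_EFinP.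
  by move=> x _; rewrite lee_fin.
have fE : \int[leb]_x (f x)%:E = 1.
  by have [_ _ /(_ setT measurableT) <-] := df; exact: probability_setT.
apply: (@le_trans _ _ (\int[leb]_x ((\1_(near_compl r) x * f x)%:E + ((2 * eps / r) * f x)%:E +
    \int[leb]_y (W (x, y))%:E))).
  apply: ge0_le_integral => //.
  - by move=> x _; rewrite -EFinM lee_fin mulr_ge0.
  - by under eq_fun do rewrite -EFinM; exact/measurable_EFinP.
  - apply: emeasurable_funD; last exact: tonF mW W0.
    by apply: emeasurable_funD; apply/measurable_EFinP => //; exact: measurable_funM.
  move=> x _; rewrite -EFinM; apply: (le_trans (defect_pointwise x r0)).
  rewrite leeD2l// -integral_indicM// le_eqVlt; apply/orP; left; apply/eqP.
  by apply: eq_integral => y _; congr EFin; rewrite /W/=; ring.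
rewrite ge0_integralD//; first last.
- exact: tonF mW W0.
- by move=> x _; apply: integral_ge0 => y _; rewrite lee_fin.
- by apply: emeasurable_funD; apply/measurable_EFinP => //; exact: measurable_funM.
- by move=> x _; rewrite -EFinD lee_fin; nneg.
have mcf : measurable_fun setT (fun x => 2 * eps / r * f x)%R by exact: measurable_funM.
rewrite ge0_integralD//; try side.
apply: leeD => //; apply: leeD.
  by rewrite integral_indicM//; have [_ _ <-] := df.
under eq_integral do rewrite EFinM.
rewrite ge0_integralZl_EFin//; first by rewrite fE mule1.
- by move=> x _; rewrite lee_fin.
- exact/measurable_EFinP.
Qed.
End fixed_eps.
End open_set.

Lemma defect_arith (R : realFieldType) (la dd cd lp b1 b2 T : R) : (cd <= b2)%R ->
  (lp <= T + b1)%R -> (0 <= b1)%R -> (0 <= b2)%R -> (dd <= 1)%R -> (0 <= dd)%R ->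
  (dd * (4 + 2 * la + lp + cd) <= (4 + 2 * la + T) * dd + b1 + b2)%R.
Proof.
move=> Hcd Hlp b10 b20 dd1 dd0.
have k1 : (dd * lp <= dd * (T + b1))%R by rewrite ler_wpM2l.
have k2 : (dd * cd <= dd * b2)%R by rewrite ler_wpM2l.
have k3 : (dd * b1 <= b1)%R by rewrite ler_piMl.
have k4 : (dd * b2 <= b2)%R by rewrite ler_piMl.
lra.
Qed.

Section kernel_error.
Context {R : realType}.
Local Notation Rm := (measurableTypeR R).
Local Notation leb := (@lebesgue_measure R).
Variables (mu : probability Rm R) (f : Rm -> R) (U : set R) (M : R).
Hypothesis df : is_density leb mu f.
Hypothesis oU : open U.
Hypothesis M0 : (0 <= M)%R.
Hypothesis UM : U `<=` `[(- M)%R, M]%classic.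

Let mU : measurable (U : set Rm). Proof. exact: open_measurable. Qed.
Let mf : measurable_fun setT f. Proof. by case: df. Qed.
Let f0 x : (0 <= f x)%R. Proof. by case: df => _ + _; apply. Qed.

Lemma leb_lty : leb U < +oo.
Proof. by rewrite (le_lt_trans (leb_bounded oU M0 UM))// ltry. Qed.

(** Inside []a, b[] the cell of [x] is an interval. Either it is complete, of length [eps], or an
    endpoint [a] or [b] cuts it, and then its length is at least the distance from [x] to one of
    these endpoints. *)
Lemma cellsize_ge (eps x a b : R) : (0 < eps)%R -> `]a, b[%classic `<=` U ->
  (a < x < b)%R -> (Num.min eps (Num.min (x - a) (b - x)) <= cellsize U eps x)%R.
Proof.
move=> e0 abU /andP[ax xb].
pose k : R := (Num.floor (x / eps))%:~R.
have /andP[k1 k2] := floor_itv (x / eps)%R; rewrite intrD -/k in k1 k2.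
rewrite ler_pdivlMr// in k1; rewrite ltr_pdivrMr// in k2.
pose lo := Num.max a (k * eps)%R; pose hi := Num.min b ((k + 1) * eps)%R.
have lohi : (Num.min eps (Num.min (x - a) (b - x)) <= hi - lo)%R.
  rewrite /lo /hi; have [?|?] := leP a (k * eps)%R; have [?|?] := leP b ((k + 1) * eps)%R;
  rewrite !ge_min; apply/orP; [right|left|right|right];
  try (apply/orP; first [left; lra | right; lra]); lra.
have lolt : (lo < hi)%R.
  by rewrite /lo /hi lt_min !gt_max; apply/andP; split; apply/andP; split; lra.
apply: (le_trans lohi).
rewrite -lee_fin (cellsizeE mU e0 leb_lty).
pose B : set Rm := `]lo, hi[%classic.
have mB : measurable B by exact: measurable_itv.
have lB : leb B = (hi - lo)%:E.
  by have := @lebesgue_measure_itv R `]lo, hi[; rewrite /= lte_fin lolt -EFinB; apply.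
apply: (@le_trans _ _ (\int[leb]_z (\1_B z)%:E)).
  by rewrite -lB integral_indic// setIT; exact: lexx.
apply: ge0_le_integral => //.
- by apply/measurable_EFinP; exact: measurable_indic.
- apply/measurable_EFinP; apply: measurable_funM; last exact: measurable_indic.
  apply: measurable_curry1; apply: measurable_indic; exact: measurable_same_cell.
move=> z _; rewrite lee_fin indicE.
have [/set_mem|_] := boolP (z \in _); last by rewrite mulr_ge0// indicE.
rewrite /B /= in_itv/= /lo /hi gt_max lt_min => /andP[/andP[z1 z2] /andP[z3 z4]].
rewrite !indicE !mem_set ?mulr1//; first by apply: abU; rewrite /= in_itv/= z1.
rewrite /same_cell/= /cellno; congr (_%:~R); apply/esym/floor_def.
by rewrite intrD -/k ler_pdivlMr// ltr_pdivrMr// (ltW z2) z4.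
Qed.

Lemma cellsize_gt0 (eps x : R) : (0 < eps)%R -> U x -> (0 < cellsize U eps x)%R.
Proof.
move=> e0 Ux; have /nbhs_ballP[r /= r0 rU] : nbhs x U by exact: open_nbhs_nbhs.
apply: lt_le_trans (@cellsize_ge eps x (x - r) (x + r) e0 _ _); last by apply/andP; split; lra.
  by rewrite !lt_min e0/=; apply/andP; split; lra.
by move=> y; rewrite /= in_itv/= => ?; apply: rU; rewrite /ball/= ltr_norml; lra.
Qed.

Lemma celldef_near (eps r x : R) : (0 < eps)%R -> (eps <= r)%R -> U x -> ~ near_compl U r x ->
  celldef U eps x = 0%R.
Proof.
move=> e0 er Ux nx.
have r0 : (0 < r)%R by exact: lt_le_trans er.
have h : (eps <= cellsize U eps x)%R.
  apply: le_trans (@cellsize_ge eps x (x - r) (x + r) e0 _ _); last by apply/andP; split; lra.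
    by rewrite !le_min lexx/=; apply/andP; split; lra.
  move=> y; rewrite /= in_itv/= => ?; apply: (near_complN Ux nx).
  by rewrite /ball/= ltr_norml; lra.
rewrite /celldef /lnneg max_r// oppr_le0 ln_ge0// ler_pdivlMr// mul1r//.
Qed.

(** The link with (H1): since [eps <= 1], the ratio [cellsize / eps] is at least the minimum of 1
    and the distance to the endpoints, a bound that no longer involves [eps]. *)
Lemma celldef_itv (eps x a b : R) : (0 < eps)%R -> (eps <= 1)%R -> `]a, b[%classic `<=` U ->
  (a < x < b)%R -> (celldef U eps x <= lnneg (Num.min (x - a) (b - x)))%R.
Proof.
move=> e0 e1 abU axb; have h := cellsize_ge e0 abU axb.
set d := Num.min (x - a)%R (b - x)%R in h *.
have d0 : (0 < d)%R by rewrite lt_min; case/andP: axb => *; apply/andP; split; lra.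
rewrite /celldef; set t := (cellsize U eps x / eps)%R.
have c0 : (0 < cellsize U eps x)%R by apply: lt_le_trans h; rewrite lt_min e0.
have t0 : (0 < t)%R by rewrite divr_gt0.
have td : (Num.min 1 d <= t)%R.
  rewrite /t ler_pdivlMr//; apply: le_trans h; rewrite le_min.
  have [d1|d1] := leP 1%R d.
    by rewrite mul1r lexx/= (le_trans e1).
  by rewrite ler_piMl ?(ltW e0) ?(ltW d1)//= ler_piMr// ltW.
rewrite /lnneg ge_max le_max [X in _ && X]le_max lexx orbT andbT.
move: td; rewrite ge_min => /orP[t1|dt].
  by rewrite oppr_le0 ln_ge0// orbT.
by rewrite lerN2 ler_ln ?posrE// dt.
Qed.

(** Five errors of size [e / 5]: the boundary layer, the Laplace tail, twice the [L^1] distance from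
    [f] to a continuous [h] ([e / 10] each), and the constant and linear parts of the modulus of [h]
    on [[-M, M]]. *)
Lemma defect_small (e : R) : (0 < e)%R -> exists2 d : R, (0 < d)%R &
  forall eps, (0 < eps)%R -> (eps < d)%R -> \int[mu]_x (defect mu f U eps x)%:E <= e%:E.
Proof.
move=> e0.
have e5 : (0 < e / 5)%R by rewrite divr_gt0.
have e10 : (0 < e / 10)%R by rewrite divr_gt0.
have [n Hn] : exists n, \int[mu]_(x in near_compl U (harmonic n)) (cst 1%R x)%:E <= (e / 5)%:E.
  apply: integral_tail_small => //.
  - by move=> n; exact: measurable_near_compl.
  - exact: near_compl_out.
  - rewrite (integral_cst mu measurableT 1%:E) mul1e.
    by rewrite (le_lt_trans (probability_le1 _ _))// ltry.
rewrite (integral_cst mu (measurable_near_compl oU _) 1%:E) mul1e in Hn.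
pose I : set R := `[(- M)%R, M]%classic.
have mI : measurable (I : set Rm) by exact: measurable_itv.
have Ifin : leb I < +oo.
  by rewrite /I lebesgue_measure_itv/=; case: ifP => _; rewrite -?EFinB ltry.
have fi : leb.-integrable I (EFin \o f).
  apply/integrableP; split; first by apply/measurable_EFinP; exact: measurable_funTS.
  under eq_integral => x _ do rewrite /= ger0_norm//.
  have [_ _ <-//] := df; by rewrite (le_lt_trans (probability_le1 _ _))// ltry.
have [h [ch ih hc]] := approximation_continuous_integrable mI Ifin fi.
have [m Hm] : exists m, \int[leb]_(z in I) `|(f z - h m z)%:E| <= (e / 10)%:E.
  have /fine_cvgP[[N1 _ nf] /cvgrPdist_le/(_ _ e10)[N2 _ H]] := hc.
  exists (maxn N1 N2).
  have := H (maxn N1 N2) (leq_maxr _ _); rewrite /= sub0r normrN => He.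
  rewrite -[leLHS]fineK; last by apply: nf; exact: leq_maxl.
  by rewrite lee_fin (le_trans (ler_norm _)).
have mh : measurable_fun setT (h m : Rm -> R) by exact: continuous_measurable_fun.
have HU : \int[leb]_(x in U) (`|f x - h m x|)%:E <= (e / 10)%:E.
  apply: le_trans Hm; under [leRHS]eq_integral => x _ do rewrite abse_EFin.
  apply: ge0_subset_integral => //; apply/measurable_EFinP; apply: measurable_funTS.
  by apply: measurableT_comp => //; exact: measurable_funB.
have [C HC] : exists C : R, forall y, I y -> (`|h m y| <= C)%R.
  have cI : compact I by exact: segment_compact.
  have := @continuous_compact _ _ (h m) I (continuous_subspaceT (ch m)) cI.
  move=> /compact_bounded[B [_ HB]]; exists (B + 1)%R => y Iy.
  by apply: (HB (B + 1)%R); [lra|exists y].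
pose dl := (e / (10 * (M + 1)))%R.
have M1 : (0 < M + 1)%R by rewrite ltr_wpDl.
have dl0 : (0 < dl)%R by rewrite divr_gt0// mulr_gt0.
have [L L0 HL] := @diagonal_modulus R (fun p => h m p.2) M C dl
  (fun p => continuous_comp cvg_snd (ch m _)) dl0 (fun p pI => HC _ pI.2).
have r0 : (0 < harmonic n :> R)%R by exact: harmonic_gt0.
pose r : R := harmonic n.
have L1 : (0 < L + 1)%R by rewrite ltr_wpDl.
have ML : (0 < 20 * (M + 1) * (L + 1))%R by rewrite !mulr_gt0.
exists (Num.min (r * e / 10) (e / (20 * (M + 1) * (L + 1))))%R.
  by rewrite lt_min !divr_gt0// mulr_gt0.
move=> eps ep; rewrite lt_min => /andP[ed1 ed2].
have hL x y : U x -> U y -> (`|h m x - h m y| <= dl + L * `|y - x|)%R.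
  by move=> Ux Uy; rewrite distrC; exact: (HL x y (UM Ux) (UM Uy)).
apply: (le_trans (int_defect_le oU df M0 UM ep r0 (ltW dl0) L0 mh hL)).
have s1 : (2 * eps / r <= e / 5)%R.
  by rewrite ler_pdivrMr//; move: ed1; rewrite -/r; lra.
have s2 : (dl * (2 * M) <= e / 5)%R.
  rewrite /dl mulrAC ler_pdivrMr ?mulr_gt0//.
  have : (0 <= e * M)%R by rewrite mulr_ge0// ltW.
  lra.
have s3 : (L * (2 * eps) * (2 * M) <= e / 5)%R.
  move: ed2; rewrite ltr_pdivlMr// => ed2.
  have p1 : (0 <= eps * M)%R by rewrite mulr_ge0// ltW.
  have p2 : (0 <= eps * L)%R by rewrite mulr_ge0// ltW.
  have p3 : (0 <= eps * M * L)%R by rewrite mulr_ge0.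
  have : (eps * (20 * (M + 1) * (L + 1)) = 20 * (eps * M * L) + 20 * (eps * M) + 20 * (eps * L) + 20 * eps)%R by ring.
  have : (L * (2 * eps) * (2 * M) = 4 * (eps * M * L))%R by ring.
  lra.
apply: (@le_trans _ _ ((e / 5)%:E + (e / 5)%:E + ((e / 10)%:E + (e / 10)%:E + (e / 5 + e / 5)%:E))).
  apply: leeD; first by apply: leeD => //; rewrite lee_fin.
  apply: leeD; first exact: leeD.
  by rewrite lee_fin mulrDl; lra.
by rewrite -!EFinD lee_fin; lra.
Qed.

Variable W : Rm -> R.
Hypothesis mW : measurable_fun setT W.
Hypothesis W0 : forall x, (0 <= W x)%R.
Hypothesis Wfin : \int[mu]_x (W x)%:E < +oo.
Hypothesis WU : forall eps x, (0 < eps)%R -> (eps <= 1)%R -> U x -> (celldef U eps x <= W x)%R.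
Hypothesis lpfin : \int[mu]_x (lnpos (f x))%:E < +oo.

(** The order of the choices matters: first [la], to make the [expR (- la)] terms small; then the
    boundary layer and the level [T] beyond which [W] and [lnpos f] have small integrals, the defect
    being at most 1 there; last [eps], to beat the resulting constant [4 + 2 la + T] by the total
    defect. *)
Lemma kernel_error (e : R) : (0 < e)%R -> exists2 d : R, (0 < d)%R &
  forall eps, (0 < eps)%R -> (eps < d)%R -> exists2 la : R, (0 <= la)%R &
  \int[mu]_x (defect mu f U eps x * (4 + 2 * la + lnpos (f x) + celldef U eps x))%:E +
  (expR (- la))%:E * leb U + (expR (- la))%:E * mu U <= e%:E.
Proof.
move=> e0.
have e4 : (0 < e / 4)%R by rewrite divr_gt0.
have mlp : measurable_fun setT (fun x => lnpos (f x)).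
  exact: (measurableT_comp (@measurable_lnpos R)).
pose la := Num.max 0%R (- ln (e / (4 * (2 * M + 1))))%R.
have M1 : (0 < 2 * M + 1)%R by rewrite ltr_wpDl// mulr_ge0.
have la0 : (0 <= la)%R by rewrite le_max lexx.
have Hla : (expR (- la) * (2 * M + 1) <= e / 4)%R.
  have p0 : (0 < e / (4 * (2 * M + 1)))%R by rewrite divr_gt0// mulr_gt0.
  have : (expR (- la) <= e / (4 * (2 * M + 1)))%R.
    by rewrite -[leRHS]lnK ?posrE// ler_expR lerNl le_max lexx orbT.
  by move=> h; rewrite -ler_pdivlMr//; apply: (le_trans h); rewrite invfM mulrA.
have [n Hn] : exists n, \int[mu]_(x in near_compl U (harmonic n)) (W x)%:E <= (e / 4)%:E.
  apply: integral_tail_small => //.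
  - by move=> n; exact: measurable_near_compl.
  - exact: near_compl_out.
pose S n := [set x : Rm | (n%:R < lnpos (f x))%R].
have mS n' : measurable (S n').
  rewrite (_ : S n' = setT `&` (fun x => lnpos (f x)) @^-1` `]n'%:R%R, +oo[%classic).
    by apply: mlp => //; exact: measurable_itv.
  by rewrite setTI; apply/seteqP; split => x; rewrite /S/= in_itv/= andbT.
have [T HT] : exists T, \int[mu]_(x in S T) (lnpos (f x))%:E <= (e / 4)%:E.
  apply: integral_tail_small => //; last by move=> x; exact: lnpos_ge0.
  move=> x; exists (Num.bound (lnpos (f x))) => k kn; apply/negP; rewrite -leNgt.
  apply: (@le_trans _ _ (Num.bound (lnpos (f x)))%:R); last by rewrite ler_nat.
  exact/ltW/archi_boundP/lnpos_ge0.
pose c : R := (4 + 2 * la + T%:R)%R.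
have c0 : (0 < c)%R by rewrite ltr_wpDr// ltr_wpDr// mulr_ge0.
have ec : (0 < e / 4 / c)%R by rewrite divr_gt0.
have [d d0 Hd] := defect_small ec.
have h0 : (0 < harmonic n :> R)%R by exact: harmonic_gt0.
exists (Num.min 1 (Num.min d (harmonic n)))%R; first by rewrite !lt_min ltr01 d0.
move=> eps ep; rewrite !lt_min => /and3P[ep1 epd epr].
exists la => //.
have md := measurable_defect df mU ep.
have d00 x := defect_ge0 df mU ep x.
have d01 x := defect_le1 mu f U ep x.
have mN : measurable (near_compl U (harmonic n) : set Rm) by exact: measurable_near_compl.
have miN : measurable_fun setT (\1_(near_compl U (harmonic n)) : Rm -> R) by exact: measurable_indic.
have miS : measurable_fun setT (\1_(S T) : Rm -> R) by exact: measurable_indic.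
have mcd := measurable_celldef mU ep.
have H1 : \int[mu]_x (defect mu f U eps x * (4 + 2 * la + lnpos (f x) + celldef U eps x))%:E <=
    (e / 4 + e / 4 + e / 4)%:E.
  apply: (@le_trans _ _ (\int[mu]_x (c * defect mu f U eps x + \1_(S T) x * lnpos (f x) +
      \1_(near_compl U (harmonic n)) x * W x)%:E)).
    apply: ge0_le_integral => //.
    - by move=> x _; rewrite lee_fin mulr_ge0// !addr_ge0 ?lnpos_ge0 ?lnneg_ge0 ?mulr_ge0.
    - apply/measurable_EFinP; apply: measurable_funM => //; apply: measurable_funD => //.
      by apply: measurable_funD.
    - apply/measurable_EFinP; apply: measurable_funD; last exact: measurable_funM.
      by apply: measurable_funD; exact: measurable_funM.
    move=> x _; rewrite lee_fin !indicE.
    have lp0 := lnpos_ge0 (f x); have := d00 x; have := d01 x.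
    have cd0 : (0 <= celldef U eps x)%R by exact: lnneg_ge0.
    have [Ux|nUx] := pselect (U x); last first.
      have -> : defect mu f U eps x = 0%R.
        by rewrite /defect indicE memNset ?mul0r//; case.
      by rewrite mul0r mulr0 add0r => _ _; rewrite addr_ge0 ?mulr_ge0.
    have Hcd : (celldef U eps x <= (x \in near_compl U (harmonic n))%:R * W x)%R.
      have [/set_mem nx|/negP nx] := boolP (x \in near_compl U (harmonic n)).
        by rewrite mul1r WU// ltW.
      by rewrite mul0r (@celldef_near eps (harmonic n))// ?ltW// => /mem_set.
    have Hlp : (lnpos (f x) <= T%:R + (x \in S T)%:R * lnpos (f x))%R.
      have [_|/negP nx] := boolP (x \in S T); first by rewrite mul1r lerDr.
      by rewrite mul0r addr0 leNgt; apply/negP => h; apply: nx; rewrite inE.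
    have q0 : (0 <= (x \in S T)%:R * lnpos (f x))%R by rewrite mulr_ge0.
    have q1 := le_trans cd0 Hcd.
    by move=> dd1 dd0; exact: (defect_arith la Hcd Hlp q0 q1 dd1 dd0).
  under eq_integral do rewrite EFinD EFinD EFinM.
  have i1 x : 0 <= c%:E * (defect mu f U eps x)%:E by rewrite -EFinM lee_fin mulr_ge0 ?(ltW c0).
  have i2 x : 0 <= (\1_(S T) x * lnpos (f x))%:E by rewrite lee_fin mulr_ge0 ?lnpos_ge0 ?indicE.
  have i3 x : 0 <= (\1_(near_compl U (harmonic n)) x * W x)%:E by rewrite lee_fin mulr_ge0 ?indicE.
  have m1 : measurable_fun setT (fun x => c%:E * (defect mu f U eps x)%:E).
    by apply: measurable_funeM; exact/measurable_EFinP.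
  have m2 : measurable_fun setT (fun x => (\1_(S T) x * lnpos (f x))%:E).
    by apply/measurable_EFinP; exact: measurable_funM.
  have m3 : measurable_fun setT (fun x => (\1_(near_compl U (harmonic n)) x * W x)%:E).
    by apply/measurable_EFinP; exact: measurable_funM.
  rewrite (ge0_integralD mu measurableT (fun x _ => adde_ge0 (i1 x) (i2 x)) (emeasurable_funD m1 m2)
    (fun x _ => i3 x) m3).
  rewrite (ge0_integralD mu measurableT (fun x _ => i1 x) m1 (fun x _ => i2 x) m2).
  rewrite !EFinD; apply: leeD; last by rewrite integral_indicM.
  apply: leeD; last by rewrite integral_indicM.
  rewrite ge0_integralZl_EFin ?(ltW c0)//; last 2 first.
  - by move=> x _; rewrite lee_fin.
  - exact/measurable_EFinP.
  apply: (@le_trans _ _ (c%:E * (e / 4 / c)%:E)).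
    by rewrite lee_wpmul2l ?lee_fin ?(ltW c0)// Hd.
  by rewrite -EFinM mulrC divfK// gt_eqF.
have E0 : (0 <= expR (- la))%R by exact: expR_ge0.
have H2 : (expR (- la))%:E * leb U + (expR (- la))%:E * mu U <= (e / 4)%:E.
  apply: (@le_trans _ _ ((expR (- la))%:E * (2 * M)%:E + (expR (- la))%:E * 1%:E)).
    apply: leeD; apply: lee_wpmul2l; rewrite ?lee_fin//; first exact: leb_bounded.
    exact: probability_le1.
  by rewrite -!EFinM -EFinD lee_fin mulr1; lra.
have aux (a b b' : \bar R) : a <= (e / 4 + e / 4 + e / 4)%:E -> b + b' <= (e / 4)%:E -> a + b + b' <= e%:E.
  move=> h1 h2; rewrite -addeA (le_trans (leeD h1 h2))// -EFinD lee_fin; lra.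
exact: aux.
Qed.
End kernel_error.

(** * An integrable bound from the distances in (H1) *)

Section interval_distance.
Context {R : realType}.
Local Notation Rm := (measurableTypeR R).
Variables (mu : probability Rm R) (U : set R) (M : R) (a b : nat -> R).
Hypothesis M0 : (0 <= M)%R.
Hypothesis UM : U `<=` `[(- M)%R, M]%classic.
Let I i : set Rm := `](a i), (b i)[%classic.
Hypothesis UI : U = \bigcup_i I i.
Hypothesis dI : forall i j, i <> j -> I i `&` I j = set0.
Let d i (x : R) : R := Num.min (x - a i)%R (b i - x)%R.
Hypothesis H1 : \sum_(0 <= i <oo) (- \int[mu]_(x in I i) (ln (d i x))%:E) < +oo.

Let mI i : measurable (I i). Proof. exact: measurable_itv. Qed.
Let w i (x : Rm) : R := (\1_(I i) x * lnneg (d i x))%R.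
Let w0 i x : (0 <= w i x)%R. Proof. by rewrite mulr_ge0 ?lnneg_ge0 ?indicE. Qed.
Let md i : measurable_fun setT (d i : Rm -> R).
Proof. by apply: measurable_minr; exact: measurable_funB. Qed.
Let mw i : measurable_fun setT (w i).
Proof.
apply: measurable_funM; first exact: measurable_indic.
exact: (measurableT_comp (@measurable_lnneg R)).
Qed.

Let in_one i j x : I i x -> I j x -> i = j.
Proof.
by move=> Ii Ij; apply: contrapT => ij; have := dI ij; move/seteqP => [/(_ x (conj Ii Ij))].
Qed.

(** [W] is the sum of the negative parts of [ln (d i)] on the disjoint intervals. (H1) controls the
    signed integrals only; the positive parts are bounded because the intervals lie in [[-M, M]], so
    the negative parts have a finite sum as well. *)
Lemma exists_distance_bound : exists W : Rm -> R, [/\ measurable_fun setT W,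
  forall x, (0 <= W x)%R, \int[mu]_x (W x)%:E < +oo &
  forall i x, (a i < x < b i)%R -> (lnneg (d i x) <= W x)%R].
Proof.
pose WE (x : Rm) : \bar R := \sum_(0 <= i <oo) (w i x)%:E.
have wE0 i x : 0 <= (w i x)%:E by rewrite lee_fin.
have out i x : ~ I i x -> w i x = 0%R by move=> nI; rewrite /w indicE memNset// mul0r.
have WEin i x : I i x -> WE x = (lnneg (d i x))%:E.
  move=> Ii; rewrite /WE (@nneseriesD1 _ _ i)// eseries0 ?adde0.
    by rewrite /w indicE mem_set// mul1r.
  by move=> j _ /= ji; rewrite out// => Ij; move/eqP: ji; apply; exact: in_one Ij Ii.
have WEout x : ~ U x -> WE x = 0.
  by move=> nU; rewrite /WE eseries0// => j _ _; rewrite out// => Ij; apply: nU; rewrite UI; exists j.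
have Wfin x : WE x \is a fin_num.
  have [Ux|nU] := pselect (U x); last by rewrite WEout.
  by move: Ux; rewrite UI => -[i _ Ii]; rewrite (WEin i).
have mWE : measurable_fun setT WE.
  apply: (@ge0_emeasurable_sum _ _ _ setT (fun i x => (w i x)%:E) xpredT) => //.
  by move=> i _; exact/measurable_EFinP.
exists (fine \o WE); split.
- exact: measurableT_comp.
- by move=> x; apply: fine_ge0; apply: nneseries_ge0.
- have -> : \int[mu]_x ((fine \o WE) x)%:E = \sum_(0 <= i <oo) \int[mu]_x (w i x)%:E.
    rewrite -integral_nneseries//; last by move=> i; exact/measurable_EFinP.
    by apply: eq_integral => x _; rewrite /= fineK.
  pose s i := - \int[mu]_(x in I i) (ln (d i x))%:E.
  (* [s i] may be negative, through points where [d i > 1]. Since [lnpos d <= d <= 2 M], adding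
     [c i] makes the terms nonnegative, and disjointness makes the series of [c i] finite. *)
  pose c i := (2 * M)%:E * mu (I i).
  have muf i : mu (I i) \is a fin_num by rewrite fin_num_measure.
  have cf i : c i \is a fin_num by rewrite fin_numM.
  have c0 i : 0 <= c i by rewrite mule_ge0// lee_fin mulr_ge0.
  have mlp i : measurable_fun setT (fun x : Rm => lnpos (d i x)).
    exact: (measurableT_comp (@measurable_lnpos R)).
  have lpc i : \int[mu]_(x in I i) (lnpos (d i x))%:E <= c i.
    rewrite /c -(integral_cst mu (mI i) (2 * M)%:E); apply: ge0_le_integral => //.
    - by move=> x _; rewrite lee_fin lnpos_ge0.
    - by apply/measurable_EFinP; exact: measurable_funTS.
    move=> x Ix; rewrite /= lee_fin /lnpos ge_max mulr_ge0// andbT.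
    have Ux : U x by rewrite UI; exists i.
    move: (Ix); rewrite /I/= in_itv/= => /andP[x1 x2].
    have d0 : (0 < d i x)%R by rewrite lt_min; apply/andP; split; lra.
    have := @ln_le_lin R (d i x) 0 d0; rewrite oppr0 expR0 add0r mul1r => h.
    apply: (le_trans h).
    have U1 : U ((a i + x) / 2)%R by rewrite UI; exists i => //; rewrite /I/= in_itv/=; lra.
    pose t := Num.max ((a i + x) / 2)%R (x - d i x / 2)%R.
    have dd1 : (d i x <= x - a i)%R by rewrite /d ge_min lexx.
    have dd2 : (d i x <= b i - x)%R by rewrite /d ge_min lexx orbT.
    have V1 : U (x - d i x / 2)%R by rewrite UI; exists i => //; rewrite /I/= in_itv/=; lra.
    have V2 : U (x + d i x / 2)%R by rewrite UI; exists i => //; rewrite /I/= in_itv/=; lra.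
    by have := UM V1; have := UM V2; rewrite /= !in_itv/= => /andP[? ?] /andP[? ?]; lra.
  have lpf i : \int[mu]_(x in I i) (lnpos (d i x))%:E \is a fin_num.
    rewrite ge0_fin_numE ?(le_lt_trans (lpc i)) ?ltey_eq ?cf//.
    by apply: integral_ge0 => x _; rewrite lee_fin lnpos_ge0.
  have sE i : \int[mu]_x (w i x)%:E = s i + \int[mu]_(x in I i) (lnpos (d i x))%:E.
    have -> : \int[mu]_x (w i x)%:E = \int[mu]_(x in I i) (lnneg (d i x))%:E by rewrite integral_indicM.
    have IE : \int[mu]_(x in I i) (ln (d i x))%:E =
        \int[mu]_(x in I i) (lnpos (d i x))%:E - \int[mu]_(x in I i) (lnneg (d i x))%:E.
      rewrite integralE; congr (_ - _); apply: eq_integral => x _.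
        by rewrite funeposE /lnpos EFin_max.
      by rewrite funenegE /lnneg EFin_max EFinN.
    rewrite /s IE.
    have aux (p q : \bar R) : p \is a fin_num -> q = - (p - q) + p.
      by move: p q => [p| |] [q| |] //= _; congr EFin; lra.
    exact: aux (lpf i).
  have wsc i : \int[mu]_x (w i x)%:E <= s i + c i by rewrite sE leeD2l.
  have sc0 i : 0 <= s i + c i by apply: le_trans (wsc i); exact: integral_ge0.
  have Cfin : \sum_(0 <= i <oo) c i \is a fin_num.
    rewrite /c nneseriesZl//.
    rewrite fin_numM// -measure_semi_bigcup//.
    - by rewrite fin_num_measure//; exact: bigcupT_measurable.
    - apply/trivIsetP => i j _ _ ij; apply: dI; exact/eqP.
    - exact: bigcupT_measurable.
  apply: (@le_lt_trans _ _ (\sum_(0 <= i <oo) (s i + c i))).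
    by apply: lee_nneseries => [i _ _|i _]; [apply: integral_ge0 => x _; exact: wE0|exact: wsc].
  (* The partial sums of [s i] are differences of those of two nonnegative series; were the first
     series infinite, the second being finite, (H1) would fail. *)
  rewrite ltNge leye_eq; apply/negP => /eqP Too.
  have cT : (fun n => \sum_(0 <= i < n) (s i + c i)) @ \oo --> +oo.
    by rewrite -Too; apply: is_cvg_nneseries => i _ _.
  have cC : (fun n => \sum_(0 <= i < n) c i) @ \oo --> \sum_(0 <= i <oo) c i.
    by apply: is_cvg_nneseries => i _ _.
  have cS : (fun n => \sum_(0 <= i < n) s i) @ \oo --> +oo.
    have -> : (fun n => \sum_(0 <= i < n) s i) =
        ((fun n => \sum_(0 <= i < n) (s i + c i)) \- (fun n => \sum_(0 <= i < n) c i)).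
      apply/funext => n /=.
      have Cn : \sum_(0 <= i < n) c i \is a fin_num by apply: (big_ind (fun x => x \is a fin_num)) => // x y xf yf; rewrite fin_numD xf.
      by rewrite big_split/= addeK.
    have -> : +oo = +oo - \sum_(0 <= i <oo) c i :> \bar R.
      have aux (x : \bar R) : x \is a fin_num -> +oo = +oo - x by case: x.
      exact: aux.
    by apply: cvgeB => //; rewrite fin_num_adde_defl// fin_numN.
  by move: H1; rewrite (cvg_lim (@ereal_hausdorff _) cS) ltxx.
- move=> i x xi; rewrite /= (WEin i)//; by rewrite /I/= in_itv/=.
Qed.
End interval_distance.

Lemma recovery_arith (R : realFieldType) (ei L a lp lm e F err c w : R) (S C EG : \bar R) :
  (0 < ei)%R -> 0 <= S -> 0 <= C -> c%:E <= w%:E + C -> EG + 1 = F%:E + S ->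
  S + ei%:E * C + lp%:E + a%:E <= 1 + (L%:E * a%:E + lm%:E) + err%:E ->
  (e + 1 = F + (1 - a))%R ->
  ei%:E * (c%:E - w%:E) + EG - L%:E * a%:E <= (e - (lp - lm) + err)%:E.
Proof.
move=> ei0; case: S => [S S0|_|//]; case: C => [C C0|_|//].
- case: EG => [EG| |] // cw EF H eF.
  have cw' : (c <= w + C)%R by rewrite -lee_fin.
  have EF' : (EG + 1 = F + S)%R := congr1 fine EF.
  have H' : (S + ei * C + lp + a <= 1 + (L * a + lm) + err)%R by rewrite -lee_fin; exact: H.
  have k : (ei * (c - w) <= ei * C)%R by rewrite ler_wpM2l ?(ltW ei0)//; lra.
  have G : (ei * (c - w) + EG - L * a <= e - (lp - lm) + err)%R by lra.
  by rewrite -lee_fin in G; exact: G.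
- by move=> _ _; rewrite gt0_muley ?lte_fin.
- move=> _ _ H.
  by have : +oo <= (1 + (L * a + lm) + err)%:E := H; rewrite leye_eq.
- by move=> _ _; rewrite gt0_muley ?lte_fin.
Qed.

(** The product sigma-algebra is generated by rectangles. A continuous function is the pointwise
    limit of functions constant on the squares of a grid of mesh [1 / (n + 1)], which are measurable
    as countable gluings. *)
Lemma continuous_measurable_prod (R : realType) (phi : R * R -> R) : continuous phi ->
  measurable_fun setT (phi : measurableTypeR R * measurableTypeR R -> R).
Proof.
move=> cphi.
pose J (n : nat) (x : R) : R := ((Num.floor (x * n.+1%:R))%:~R / n.+1%:R)%R.
have n0 (n : nat) : (0 < n.+1%:R :> R)%R by [].
have JP n x : (`|x - J n x| <= harmonic n)%R.
  rewrite /J; have /andP[k1 k2] := floor_itv (x * n.+1%:R)%R.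
  rewrite intrD in k2; move: k1 k2; move: (_%:~R)%R => k k1 k2.
  have -> : (x - k / n.+1%:R = (x * n.+1%:R - k) / n.+1%:R)%R by field; rewrite gt_eqF.
  rewrite normrM (ger0_norm (_ : 0 <= n.+1%:R^-1)%R) ?invr_ge0// ger0_norm; last lra.
  by rewrite -[leRHS]mul1r ler_wpM2r ?invr_ge0//; lra.
apply: (@measurable_fun_cvg _ _ _ _ (fun n (p : measurableTypeR R * measurableTypeR R) => phi (J n p.1, J n p.2))).
- move=> n _ B mB; rewrite setTI.
  pose F (k : nat) : set (measurableTypeR R * measurableTypeR R) :=
    match unpickle k with
    | Some (i, j) => if pselect (B (phi (i%:~R / n.+1%:R, j%:~R / n.+1%:R)%R)) then
        [set x : measurableTypeR R | Num.floor (x * n.+1%:R)%R = i] `*`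
        [set x : measurableTypeR R | Num.floor (x * n.+1%:R)%R = j] else set0
    | None => set0
    end.
  have mfl (i : int) : measurable [set x : measurableTypeR R | Num.floor (x * n.+1%:R)%R = i].
    have -> : [set x : measurableTypeR R | Num.floor (x * n.+1%:R)%R = i] =
        `[(i%:~R / n.+1%:R)%R, ((i + 1)%:~R / n.+1%:R)%R[%classic.
      apply/seteqP; split => x; rewrite /= in_itv/= ler_pdivrMr// ltr_pdivlMr//.
        by move/eqP; rewrite floor_eq.
      by move=> ?; apply/eqP; rewrite floor_eq.
    exact: measurable_itv.
  have -> : (fun p : measurableTypeR R * measurableTypeR R => phi (J n p.1, J n p.2)) @^-1` B = \bigcup_k F k.
    apply/seteqP; split => -[x y].
      move=> /= Bp; have [k kE] : exists k, unpickle k =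
          Some (Num.floor (x * n.+1%:R)%R, Num.floor (y * n.+1%:R)%R) :> option (int * int).
        by exists (pickle (Num.floor (x * n.+1%:R)%R, Num.floor (y * n.+1%:R)%R)); exact: pickleK.
      by exists k; [exact: I|rewrite /F kE; case: pselect].
    move=> [k _]; rewrite /F; case: (unpickle k) => [[i j]|//].
    by case: pselect => //= Bp [/= xi yj]; rewrite /J xi yj.
  apply: bigcupT_measurable => k; rewrite /F; case: (unpickle k) => [[i j]|//].
  by case: pselect => ?; [exact: measurableX|exact: measurable0].
- move=> [x y] _ /=.
  apply/cvgrPdist_lt => e e0.
  have /cvgrPdist_lt /(_ _ e0) /nbhs_ballP[r /= r0 rP] := cphi (x, y).
  have : \forall n \near \oo, (harmonic n < r)%R by exact: (cvgr_lt _ cvg_harmonic).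
  apply: filterS => n hn; apply: rP.
  by split; rewrite /ball/=; exact: le_lt_trans (JP n _) hn.
Qed.

(** * The recovery plans *)

Section recovery_sequence.
Context {R : realType}.
Local Notation Rm := (measurableTypeR R).
Local Notation leb := (@lebesgue_measure R).
Variables (mu nu : probability Rm R) (M : R) (f fn : Rm -> R).
Hypothesis M0 : (0 <= M)%R.
Hypothesis muM : mu (~` `[(- M)%R, M]%classic) = 0.
Hypothesis nuM : nu (~` `[(- M)%R, M]%classic) = 0.
Hypothesis df : is_density leb mu f.
Hypothesis dfn : is_density leb nu fn.
Hypothesis Emu : Ent mu leb < +oo.
Variable U : set R.
Hypothesis oU : open U.
Hypothesis UM : U `<=` `[(- M)%R, M]%classic.
Hypothesis UA : U `<=` Aset mu nu.
Hypothesis muAU : mu (Aset mu nu `\` U) = 0.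
Variable g : probability (Rm * Rm)%type R.
Hypothesis gO : Opt1 mu nu g.

Let A : set Rm := Aset mu nu.
Let mA : measurable A. Proof. exact: measurable_Aset. Qed.
Let mAC : measurable (~` A). Proof. exact: measurableC. Qed.
Let E : set (Rm * Rm) := ~` A `*` ~` A.
Let mE : measurable E. Proof. exact: measurableX. Qed.
Let mU : measurable (U : set Rm). Proof. exact: open_measurable. Qed.
Let rho : {measure set (Rm * Rm)%type -> \bar R} := mu \x nu.
Let rho1 : rho setT = 1. Proof. exact: prodT. Qed.
Let gP : Plans mu nu g. Proof. by case: gO. Qed.
Let gap0 : \int[g]_p gapA A p = 0. Proof. exact (opt_gap0 M0 muM nuM gO). Qed.
Let mul := density_null df.
Let nul := density_null dfn.
Let gmix1 : g (A `*` ~` A) = 0. Proof. exact: plan_mixed1 gP mul nul gap0. Qed.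
Let gmix2 : g (~` A `*` A) = 0. Proof. exact: plan_mixed2 gP mul nul gap0. Qed.

Lemma nu_sub_eq B : measurable B -> B `<=` A -> nu B = mu B.
Proof. by move=> mB BA; rewrite (plan_marginal_eq mA gP mul nul gap0 mB BA). Qed.

Let nuU B : measurable B -> B `<=` U -> nu B = mu B.
Proof. by move=> mB BU; apply: nu_sub_eq => // x /BU /UA. Qed.

Let split_mu (m : probability Rm R) (B C D : set Rm) : measurable B -> measurable C -> measurable D ->
  D `<=` C -> m (C `\` D) = 0 -> m B = m (B `&` ~` C) + m (B `&` D).
Proof.
move=> mB mC mD DC CD0.
have Z : m (B `&` (C `\` D)) = 0.
  apply: (@subset_measure0 _ _ _ m _ (C `\` D)) => //.
  - by apply: measurableI => //; exact: measurableD.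
  - exact: measurableD.
transitivity (m (B `&` ~` C) + (m (B `&` D) + m (B `&` (C `\` D)))); last by rewrite Z adde0.
have mBD : measurable (B `&` D) by exact: measurableI.
have mBCD : measurable (B `&` (C `\` D)) by apply: measurableI => //; exact: measurableD.
have mBC : measurable (B `&` ~` C) by apply: measurableI => //; exact: measurableC.
transitivity (m (B `&` ~` C) + m ((B `&` D) `|` (B `&` (C `\` D)))).
  transitivity (m ((B `&` ~` C) `|` ((B `&` D) `|` (B `&` (C `\` D))))).
    congr (m _); apply/seteqP; split => x.
      move=> Bx; have [Cx|nC] := pselect (C x); last by left.
      by right; have [Dx|nD] := pselect (D x); [left|right].
    by case=> [[]|[[]|[]]].
  apply: measureU => //; first exact: measurableU.
  by apply/seteqP; split => // x [[_ nC] [[_ /DC]|[_ []]]].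
congr (_ + _); apply: measureU => //.
by apply/seteqP; split => // x [[_ Dx] [_ [_]]].
Qed.

Let muB B : measurable B -> mu B = mu (B `&` ~` A) + mu (B `&` U).
Proof. by move=> mB; exact: split_mu. Qed.

Let nuB B : measurable B -> nu B = nu (B `&` ~` A) + mu (B `&` U).
Proof.
move=> mB; rewrite -nuU; [|exact: measurableI|by move=> x []].
apply: split_mu => //; rewrite nu_sub_eq//; first [exact: measurableD|by move=> x []].
Qed.

Lemma mu_U : mu U = mu A.
Proof.
rewrite (muB mA); have -> : A `&` ~` A = set0 by rewrite setICr.
by rewrite measure0 add0e setIC; congr (mu _); apply/esym/setIidPl.
Qed.

Let gX1 B : measurable B -> g ((B `*` setT) `&` E) = mu (B `&` ~` A).
Proof.
move=> mB; transitivity (g ((B `&` ~` A) `*` setT)); last by apply: gP.1; exact: measurableI.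
have mBA : measurable (B `&` ~` A) by exact: measurableI.
have -> : (B `&` ~` A) `*` setT = ((B `*` setT) `&` E) `|` ((B `&` ~` A) `*` A).
  apply/seteqP; split => -[x y] /=.
    by move=> [[Bx nAx] _]; have [Ay|nAy] := pselect (A y); [right|left].
  by case=> [[[Bx _] [nAx _]]|[[Bx nAx] _]].
have Z : g ((B `&` ~` A) `*` A) = 0.
  apply: (@subset_measure0 _ _ _ g _ (~` A `*` A)) => //.
  - exact: measurableX.
  - exact: measurableX.
  - by move=> -[x y] /= [[_ ?] ?].
transitivity (g ((B `*` setT) `&` E) + g ((B `&` ~` A) `*` A)); first by rewrite Z adde0.
apply/esym; apply: measureU; first (by apply: measurableI => //; exact: measurableX);
  first exact: measurableX.
by apply/seteqP; split => // -[x y] /= [[_ [_ nAy]] [_ Ay]].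
Qed.

Let gX2 B : measurable B -> g ((setT `*` B) `&` E) = nu (B `&` ~` A).
Proof.
move=> mB; transitivity (g (setT `*` (B `&` ~` A))); last by apply: gP.2; exact: measurableI.
have mBA : measurable (B `&` ~` A) by exact: measurableI.
have -> : setT `*` (B `&` ~` A) = ((setT `*` B) `&` E) `|` (A `*` (B `&` ~` A)).
  apply/seteqP; split => -[x y] /=.
    by move=> [_ [By nAy]]; have [Ax|nAx] := pselect (A x); [right|left].
  by case=> [[[_ By] [_ nAy]]|[_ [By nAy]]].
have Z : g (A `*` (B `&` ~` A)) = 0.
  apply: (@subset_measure0 _ _ _ g _ (A `*` ~` A)) => //.
  - exact: measurableX.
  - exact: measurableX.
  - by move=> -[x y] /= [? [_ ?]].
transitivity (g ((setT `*` B) `&` E) + g (A `*` (B `&` ~` A))); first by rewrite Z adde0.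
apply/esym; apply: measureU; first (by apply: measurableI => //; exact: measurableX);
  first exact: measurableX.
by apply/seteqP; split => // -[x y] /= [[_ [nAx _]] [Ax _]].
Qed.

Section fixed_eps.
Variable eps : R.
Hypothesis e0 : (0 < eps)%R.

Let s := kernel mu f U eps.
Let ms : measurable_fun setT s. Proof. exact: measurable_kernel. Qed.
Let s0 p : (0 <= s p)%R. Proof. exact: kernel_ge0. Qed.
Let sU p : ~ (U `*` U) p -> s p = 0%R. Proof. exact: kernel_supp. Qed.

(** Expressed by the action on nonnegative test functions, the form in which cost and narrow
    convergence are computed; masses of sets follow by testing with indicators. *)
Definition spliced (G : probability (Rm * Rm)%type R) := forall psi : Rm * Rm -> R,
  measurable_fun setT psi -> (forall p, (0 <= psi p)%R) ->
  \int[G]_p (psi p)%:E = \int[g]_(p in E) (psi p)%:E + \int[rho]_p (psi p * s p)%:E.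

Let int_s1 (h : Rm -> R) : measurable_fun setT h -> (forall x, (0 <= h x)%R) ->
  \int[rho]_p (h p.1 * s p)%:E = \int[mu]_(x in U) (h x)%:E.
Proof.
move=> mh h0; rewrite -(int_kernel_fst df mU e0 mh h0).
under eq_integral do rewrite mulrC.
apply: (int_prod_mu mU nuU (k := fun p => s p * h p.1)%R).
- by apply: measurable_funM => //; exact: measurableT_comp.
- by move=> p; exact: mulr_ge0.
- by move=> p /sU ->; rewrite mul0r.
Qed.

Let int_s2 (h : Rm -> R) : measurable_fun setT h -> (forall x, (0 <= h x)%R) ->
  \int[rho]_p (h p.2 * s p)%:E = \int[mu]_(x in U) (h x)%:E.
Proof.
move=> mh h0; rewrite -(int_kernel_fst df mU e0 mh h0).
have mk : measurable_fun setT (fun p : Rm * Rm => h p.2 * s p)%R.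
  by apply: measurable_funM => //; exact: measurableT_comp.
have k0 p : (0 <= h p.2 * s p)%R by exact: mulr_ge0.
rewrite (int_prod_mu mU nuU mk k0); last by move=> p /sU ->; rewrite mulr0.
rewrite (@fubini_tonelli _ _ _ _ _ mu mu (fun p => (h p.2 * s p)%:E)); last 2 first.
- exact/measurable_EFinP.
- by move=> p; rewrite lee_fin.
apply: eq_integral => y _; apply: eq_integral => x _ /=.
by rewrite /s kernelC mulrC.
Qed.

(** The total mass is 1: [g] has mass [mu (~A)] over [E] because it does not charge the mixed
    rectangles, and the kernel has mass [mu U], equal to [mu A]. *)
Lemma exists_spliced : exists G, spliced G.
Proof.
pose m := measure_add (mrestr g mE) (dmeas rho ms s0).
have mT : m setT = 1.
  transitivity (g (setT `&` E) + \int[rho]_p (s p)%:E); first by rewrite /m measure_addE.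
  have -> : \int[rho]_p (s p)%:E = mu U.
    have := @int_s1 (cst 1%R) (measurable_cst _) (fun=> ler01).
    rewrite (integral_cst mu mU 1%:E) mul1e => <-.
    by apply: eq_integral => p _; rewrite mul1r.
  have := gX1 measurableT; rewrite setXTT => ->.
  have := muB measurableT; rewrite !setTI => <-; exact: probability_setT.
have [G GE] := measure_probability mT.
exists G => psi mpsi psi0.
have mp : measurable_fun setT (fun p => (psi p)%:E) by exact/measurable_EFinP.
have p0 p : 0 <= (psi p)%:E by rewrite lee_fin.
transitivity (\int[m]_p (psi p)%:E); first by apply: eq_measure_integral => B mB _; exact: GE.
rewrite ge0_integral_measure_add// ge0_integral_mrestr//.
rewrite (ge0_integral_dmeas rho ms s0)//.
Qed.

Variable G : probability (Rm * Rm)%type R.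
Hypothesis GS : spliced G.

Let GX (B : set (Rm * Rm)) : measurable B ->
  G B = g (B `&` E) + \int[rho]_p (\1_B p * s p)%:E.
Proof.
move=> mB; have mi : measurable_fun setT (\1_B : Rm * Rm -> R) by exact: measurable_indic.
have i0 p : (0 <= \1_B p :> R)%R by rewrite indicE.
by have := GS mi i0; rewrite !integral_indic// setIT.
Qed.

Lemma spliced_plan : Plans mu nu G.
Proof.
split => B mB.
  rewrite GX; last exact: measurableX.
  rewrite gX1// (muB mB); congr (_ + _).
  have mi : measurable_fun setT (\1_B : Rm -> R) by exact: measurable_indic.
  have i0 p : (0 <= \1_B p :> R)%R by rewrite indicE.
  have := int_s1 mi i0; rewrite integral_indic// => <-.
  apply: eq_integral => p _; congr (_ * _)%:E; rewrite !indicE.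
  by congr (_ (nat_of_bool _)); apply/idP/idP; rewrite !inE/=; [case|].
rewrite GX; last exact: measurableX.
rewrite gX2// (nuB mB); congr (_ + _).
have mi : measurable_fun setT (\1_B : Rm -> R) by exact: measurable_indic.
have i0 p : (0 <= \1_B p :> R)%R by rewrite indicE.
have := int_s2 mi i0; rewrite integral_indic// => <-.
apply: eq_integral => p _; congr (_ * _)%:E; rewrite !indicE.
by congr (_ (nat_of_bool _)); apply/idP/idP; rewrite !inE/=; [case|].
Qed.

Let md : measurable_fun setT (fun p : Rm * Rm => `|p.2 - p.1|%R).
Proof. by apply: measurableT_comp => //; exact: measurable_funB. Qed.

Let C := \int[rho]_p (`|p.2 - p.1| * s p)%:E.
Let C0 : 0 <= C. Proof. by apply: integral_ge0 => p _; rewrite lee_fin mulr_ge0. Qed.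

Lemma spliced_moment : C <= (3 * eps)%:E.
Proof.
apply: le_trans (kernel_cost df mU e0); rewrite /C (@int_prod_mu _ mu U mU nu nuU (fun p => `|p.2 - p.1| * s p)%R)//.
- by apply: measurable_funM.
- by move=> p; rewrite mulr_ge0.
- by move=> p /sU ->; rewrite mulr0.
Qed.

Lemma spliced_cost : cost G <= W1 mu nu + C.
Proof.
have [_ <-] := gO; rewrite /cost (GS md (fun=> normr_ge0 _)) leeD2r//.
apply: ge0_subset_integral => //; exact/measurable_EFinP.
Qed.

(* Convergence to [g]: on [U x U] the plan [G] lies within [O(eps)] of the
   diagonal, where [g] is concentrated. *)
Lemma spliced_close (psi : R * R -> R) (dl L : R) : (0 <= dl)%R -> (0 <= L)%R ->
  measurable_fun setT (psi : Rm * Rm -> R) -> (forall p, (0 <= psi p)%R) ->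
  (forall x y, U x -> U y -> (`|psi (x, y) - psi (x, x)| <= dl + L * `|y - x|)%R) ->
  \int[G]_p (psi p)%:E <= \int[g]_p (psi p)%:E + (dl + L * (3 * eps))%:E /\
  \int[g]_p (psi p)%:E <= \int[G]_p (psi p)%:E + (dl + L * (3 * eps))%:E.
Proof.
move=> dl0 L0 mpsi psi0 H.
have mdg : measurable_fun setT (fun x : Rm => psi (x, x)).
  by apply: (measurableT_comp mpsi); exact: measurable_fun_pair.
have mdg1 : measurable_fun setT (fun p : Rm * Rm => psi (p.1, p.1)).
  exact: (measurableT_comp mdg).
have mA1 : measurable_fun setT (\1_A : Rm -> R) by exact: measurable_indic.
have iA x : (0 <= \1_A x :> R)%R by rewrite indicE.
pose D := \int[mu]_(x in U) (psi (x, x))%:E.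
have mpE (B : set (Rm * Rm)) : measurable B -> measurable_fun B (fun p => (psi p)%:E).
  by move=> mB; apply/measurable_EFinP; exact: measurable_funTS.
(* Off [E] the plan [g] sits on the diagonal over [A], and [U] fills [A] up to a [mu]-null set. *)
have gE : \int[g]_p (psi p)%:E = \int[g]_(p in E) (psi p)%:E + D.
  have mEC : measurable (~` E) by exact: measurableC.
  have -> : \int[g]_p (psi p)%:E = \int[g]_(p in E) (psi p)%:E + \int[g]_(p in ~` E) (psi p)%:E.
    rewrite -ge0_integral_setU ?setUv//.
    - exact: mpE.
    - by move=> p _; rewrite lee_fin.
    - by apply/disj_setPS => p [].
  congr (_ + _).
  have -> : D = \int[mu]_x (\1_A x * psi (x, x))%:E.
    rewrite /D -[LHS]integral_indicM//.
    have mU1 : measurable_fun setT (\1_U : Rm -> R) by exact: measurable_indic.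
    apply: ge0_ae_eq_integral.
    - by [].
    - by apply/measurable_EFinP; exact: measurable_funM.
    - by apply/measurable_EFinP; exact: measurable_funM.
    - by move=> x _; rewrite lee_fin mulr_ge0 ?indicE.
    - by move=> x _; rewrite lee_fin mulr_ge0.
    exists (A `\` U); split => //; first exact: measurableD.
    move=> x /= nx; apply: contrapT => nAU; apply: nx => _; rewrite !indicE.
    have [Ux|nU] := pselect (U x); first by rewrite !mem_set//; exact: UA.
    by rewrite !memNset// => Ax; apply: nAU.
  have mAd : measurable_fun setT (fun x => (\1_A x * psi (x, x))%:E).
    by apply/measurable_EFinP; exact: measurable_funM.
  have Ad0 x : 0 <= (\1_A x * psi (x, x))%:E by rewrite lee_fin mulr_ge0.
  rewrite -(plan_integral1 gP mAd Ad0).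
  rewrite -[LHS]integral_indicM//.
  have mEi : measurable_fun setT (\1_(~` E) : Rm * Rm -> R) by exact: measurable_indic.
  apply: ge0_ae_eq_integral => //.
  - by apply/measurable_EFinP; exact: measurable_funM.
  - exact: (measurableT_comp mAd).
  - by move=> p _; rewrite lee_fin mulr_ge0 ?indicE.
  have [N [mN N0 sN]] := plan_diagonal mA gP mul nul gap0.
  exists (N `|` (A `*` ~` A)); split.
  - by apply: measurableU => //; exact: measurableX.
  - by apply: null_set_setU => //; exact: measurableX.
  move=> [x y] /= nxy; have [xy|xy] := eqVneq x y; last first.
    have [AA|nA] := pselect (A x \/ A y).
      by left; apply: sN; split => //=; exact/eqP.
    exfalso; apply: nxy => _; rewrite !indicE memNset; last first.
      by move=> /= nE; apply: nE; split => h; apply: nA; [left|right].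
    by rewrite memNset ?mul0r// => h; apply: nA; left.
  exfalso; apply: nxy => _; rewrite -xy !indicE.
  have [Ax|nAx] := pselect (A x).
    by rewrite !mem_set// => -[].
  by rewrite !memNset// => nE; apply: nE; split.
have GE : \int[G]_p (psi p)%:E = \int[g]_(p in E) (psi p)%:E + \int[rho]_p (psi p * s p)%:E.
  exact: GS.
have DE : D = \int[rho]_p (psi (p.1, p.1) * s p)%:E by rewrite (int_s1 mdg).
have m1 : measurable_fun setT (fun p => psi p * s p)%R by exact: measurable_funM.
have m2 : measurable_fun setT (fun p : Rm * Rm => psi (p.1, p.1) * s p)%R by exact: measurable_funM.
have m3 : measurable_fun setT (fun p => dl * s p)%R by exact: measurable_funM.
have m4 : measurable_fun setT (fun p : Rm * Rm => L * (`|p.2 - p.1| * s p))%R.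
  by apply: measurable_funM => //; exact: measurable_funM.
have p1 p : (0 <= psi p * s p)%R by rewrite mulr_ge0.
have p2 (p : Rm * Rm) : (0 <= psi (p.1, p.1) * s p)%R by rewrite mulr_ge0.
have p3 p : (0 <= dl * s p)%R by rewrite mulr_ge0.
have p4 (p : Rm * Rm) : (0 <= L * (`|p.2 - p.1| * s p))%R by rewrite !mulr_ge0.
have Is : \int[rho]_p (dl * s p)%:E <= dl%:E.
  under eq_integral do rewrite EFinM.
  rewrite ge0_integralZl_EFin//; [|by move=> p _; rewrite lee_fin|exact/measurable_EFinP].
  rewrite -[leRHS]mule1 lee_wpmul2l ?lee_fin// (int_kernel_rho df mU e0 nuU).
  exact: probability_le1.
have Im : \int[rho]_p (L * (`|p.2 - p.1| * s p))%:E <= (L * (3 * eps))%:E.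
  under eq_integral do rewrite EFinM.
  rewrite ge0_integralZl_EFin//; first by rewrite EFinM lee_wpmul2l ?lee_fin ?spliced_moment.
  - by move=> p _; rewrite lee_fin mulr_ge0.
  - by apply/measurable_EFinP; exact: measurable_funM.
have cmp (u v : Rm * Rm -> R) : measurable_fun setT u -> measurable_fun setT v ->
    (forall p, (0 <= u p)%R) -> (forall p, (0 <= v p)%R) ->
    (forall p, (u p <= v p + dl * s p + L * (`|p.2 - p.1| * s p))%R) ->
    \int[rho]_p (u p)%:E <= \int[rho]_p (v p)%:E + (dl + L * (3 * eps))%:E.
  move=> mu1 mv1 u0 v0 uv.
  apply: (@le_trans _ _ (\int[rho]_p ((v p)%:E + (dl * s p)%:E + (L * (`|p.2 - p.1| * s p))%:E))).
    apply: ge0_le_integral => //.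
    - by move=> p _; rewrite lee_fin.
    - exact/measurable_EFinP.
    - by apply: emeasurable_funD; [apply: emeasurable_funD|]; exact/measurable_EFinP.
    - by move=> p _; rewrite -!EFinD lee_fin.
  have n1 p : [set: Rm * Rm] p -> 0 <= (v p)%:E + (dl * s p)%:E by move=> _; rewrite adde_ge0// lee_fin.
  have n2 (p : Rm * Rm) : [set: Rm * Rm] p -> 0 <= (L * (`|p.2 - p.1| * s p))%:E by rewrite lee_fin.
  have n3 p : [set: Rm * Rm] p -> 0 <= (v p)%:E by rewrite lee_fin.
  have n4 p : [set: Rm * Rm] p -> 0 <= (dl * s p)%:E by rewrite lee_fin.
  have q1 : measurable_fun setT (fun p => (v p)%:E) by exact/measurable_EFinP.
  have q2 : measurable_fun setT (fun p => (dl * s p)%:E) by exact/measurable_EFinP.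
  have q3 : measurable_fun setT (fun p : Rm * Rm => (L * (`|p.2 - p.1| * s p))%:E) by exact/measurable_EFinP.
  rewrite (ge0_integralD rho measurableT n1 (emeasurable_funD q1 q2) n2 q3).
  rewrite (ge0_integralD rho measurableT n3 q1 n4 q2).
  have aux (x y z : \bar R) (b c : R) : y <= b%:E -> z <= c%:E -> x + y + z <= x + (b + c)%:E.
    by move=> yb zc; rewrite -addeA leeD2l// EFinD leeD.
  exact: aux.
have pt p : (`|psi p - psi (p.1, p.1)| * s p <= dl * s p + L * (`|p.2 - p.1| * s p))%R.
  have [[U1 U2]|nU] := pselect ((U `*` U) p); last by rewrite sU// !mulr0 addr0.
  rewrite mulrA -mulrDl ler_wpM2r//; have := H _ _ U1 U2.
  by rewrite -surjective_pairing.
rewrite GE gE DE; split; rewrite -addeA leeD2l//; apply: cmp => // p.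
  have := pt p; have := ler_norm (psi p - psi (p.1, p.1))%R; have := s0 p.
  move: (psi p) (psi (p.1, p.1)) (s p) => a b c c0 h1 h2.
  have : ((a - b) * c <= `|a - b| * c)%R by rewrite ler_wpM2r.
  lra.
have := pt p; have := ler_norm (psi (p.1, p.1) - psi p)%R; have := s0 p; rewrite distrC.
move: (psi p) (psi (p.1, p.1)) (s p) => a b c c0 h1 h2.
have : ((b - a) * c <= `|a - b| * c)%R by rewrite ler_wpM2r.
lra.
Qed.

Let int_UA (h : Rm -> R) : measurable_fun setT h -> (forall x, (0 <= h x)%R) ->
  \int[mu]_(x in U) (h x)%:E = \int[mu]_(x in A) (h x)%:E.
Proof.
move=> mh h0; rewrite -[LHS]integral_indicM// -[RHS]integral_indicM//.
have mU1 : measurable_fun setT (\1_U : Rm -> R) by exact: measurable_indic.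
have mA1 : measurable_fun setT (\1_A : Rm -> R) by exact: measurable_indic.
apply: ge0_ae_eq_integral.
- by [].
- by apply/measurable_EFinP; exact: measurable_funM.
- by apply/measurable_EFinP; exact: measurable_funM.
- by move=> x _; rewrite lee_fin mulr_ge0 ?indicE.
- by move=> x _; rewrite lee_fin mulr_ge0 ?indicE.
exists (A `\` U); split => //; first exact: measurableD.
move=> x /= nx; apply: contrapT => nAU; apply: nx => _; rewrite !indicE.
have [Ux|nU] := pselect (U x); first by rewrite !mem_set//; exact: UA.
by rewrite !memNset// => Ax; apply: nAU.
Qed.

Hypothesis Efin : Ent (restr g E) rho < +oo.

(** The two pieces live on disjoint sets, so their entropies add. [kernel_entropy] evaluates the
    kernel piece; its singular term has factor [mu U = mu A] and is cancelled exactly by the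
    normalisation of [Feps]. *)
Lemma spliced_Feps (la err : R) : (2 * eps <= 1)%R -> (0 <= la)%R ->
  \int[mu]_x (defect mu f U eps x * (4 + 2 * la + lnpos (f x) + celldef U eps x))%:E +
  (expR (- la))%:E * leb U + (expR (- la))%:E * mu U <= err%:E ->
  Feps mu nu eps G <= Ent (restr g E) rho - (logp mu nu f - logm mu nu f) + err%:E.
Proof.
move=> e1 la0 Herr.
pose gE : {measure set (Rm * Rm)%type -> \bar R} := mrestr g mE.
have [q0 dq0] := has_density_Ent Efin.
have [mq0 q00 qE0] := dq0.
(* A density of the restricted plan vanishes off [E] only almost everywhere; the indicator makes
   this exact, as the pointwise splitting below requires. *)
pose q p := (\1_E p * q0 p)%R.
have mi : measurable_fun setT (\1_E : Rm * Rm -> R) by exact: measurable_indic.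
have mq : measurable_fun setT q by exact: measurable_funM.
have q_0 p : (0 <= q p)%R by rewrite mulr_ge0 ?indicE.
have dq : is_density rho gE q.
  split => // B mB.
  have mBE : measurable (B `&` E) by exact: measurableI.
  transitivity (restr g E (B `&` E)); first by rewrite /restr -setIA setIid.
  rewrite qE0// -[LHS]integral_indicM// -[RHS]integral_indicM//.
  by apply: eq_integral => p _; rewrite indicI /q mulrA.
have mqs : measurable_fun setT (fun p => q p + s p)%R by exact: measurable_funD.
have dG : is_density rho G (fun p => q p + s p)%R.
  split => // [p|B mB]; first by rewrite addr_ge0.
  rewrite GX//; under eq_integral do rewrite EFinD.
  rewrite ge0_integralD//; first last.
  - by apply/measurable_EFinP; exact: measurable_funTS.
  - by move=> p _; rewrite lee_fin.
  - by apply/measurable_EFinP; exact: measurable_funTS.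
  - by move=> p _; rewrite lee_fin.
  have [_ _ /(_ B mB) <-] := dq.
  by rewrite -[X in _ = _ + X]integral_indicM.
have gEoo : gE setT < +oo.
  by rewrite /gE /= /mrestr (le_lt_trans (probability_le1 _ _)) ?ltry//; exact: measurableI.
have e1E := Ent_phi rho1 gEoo dq.
have mph (u : Rm * Rm -> R) : measurable_fun setT u -> measurable_fun setT (fun p => (phi (u p))%:E).
  by move=> mu1; apply/measurable_EFinP; exact: (measurableT_comp (@measurable_phi R)).
have pph (u : Rm * Rm -> R) : (forall p, (0 <= u p)%R) -> forall p, 0 <= (phi (u p))%:E.
  by move=> u0 p; rewrite lee_fin phi_ge0.
have phi0 : (phi 0 = 1 :> R)%R by rewrite /phi mul0r subr0 add0r.
(* At every point [q] or [s] is 0, and [phi 0 = 1]; hence [phi (q + s) + 1 = phi q + phi s]. *)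
have EGE : Ent G rho + 1 = \int[rho]_p (phi (q p))%:E + \int[rho]_p (phi (s p))%:E.
  rewrite (Ent_plan_phi dG).
  have one : \int[rho]_p (cst 1%:E p) = 1 by rewrite (integral_cst rho measurableT 1%:E) rho1 mule1.
  have m3 := mph _ mqs; have p3 := pph _ (fun p => addr_ge0 (q_0 p) (s0 p)).
  rewrite -{1}one -ge0_integralD//; try exact: m3; try (by move=> p _; exact: p3).
  rewrite -ge0_integralD//; try (by move=> p _; exact: pph); try exact: mph.
  apply: eq_integral => p _; rewrite /= -!EFinD; congr EFin.
  have [Ep|nE] := pselect (E p).
    by rewrite sU ?addr0 ?phi0//; move=> [/UA U1 _]; case: Ep.
  have -> : q p = 0%R by rewrite /q indicE memNset// mul0r.
  by rewrite add0r phi0 addrC.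
have gET : gE setT = 1 - mu A.
  rewrite /gE /= /mrestr -setXTT gX1// setTI; exact: probability_setC.
have KE := kernel_entropy df mU e0 (leb_lty oU M0 UM) (fun x => cellsize_gt0 oU M0 UM e0) nuU e1 la0.
have mlp : measurable_fun setT (fun x => lnpos (f x)) by case: df => mf _ _; exact: (measurableT_comp (@measurable_lnpos R)).
have mlm : measurable_fun setT (fun x => lnneg (f x)) by case: df => mf _ _; exact: (measurableT_comp (@measurable_lnneg R)).
rewrite (int_UA mlp (fun x => lnpos_ge0 _)) (int_UA mlm (fun x => lnneg_ge0 _)) mu_U in KE.
rewrite mu_U in Herr.
have lpf := logp_fin nu muM df Emu; have lmf := logm_fin nu muM df.
rewrite -/(logp mu nu f) -/(logm mu nu f) -/rho -/s in KE.
have Wf := W1_fin M0 muM nuM; have cf := cost_fin M0 muM nuM spliced_plan.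
have af : mu A \is a fin_num by rewrite fin_num_measure.
have S0 : 0 <= \int[rho]_p (phi (s p))%:E by apply: integral_ge0 => p _; exact: pph.
have F0 : 0 <= \int[rho]_p (phi (q p))%:E by apply: integral_ge0 => p _; exact: pph.
have ei0 : (0 < eps^-1)%R by rewrite invr_gt0.
have L0 : `|ln (2 * eps)|%R = (- ln (2 * eps))%R by rewrite ler0_norm// ln_le0.
rewrite /Feps L0 -/rho -/A.
have HC := spliced_cost; have HC0 := C0.
move: Efin e1E; rewrite -[Ent (restr g E) rho]/(Ent gE rho) gET => Ef e1E.
have KE' : \int[rho]_p (phi (s p))%:E + (eps^-1)%:E * C + logp mu nu f + mu A <=
    1 + ((- ln (2 * eps))%:E * mu A + logm mu nu f) + err%:E.
  have aux (x d1 d2 d3 z : \bar R) : d1 + d2 + d3 <= z -> x + d1 + d2 + d3 <= x + z.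
    by move=> h; rewrite -!addeA leeD2l// addeA.
  exact: (le_trans KE (aux _ _ _ _ _ Herr)).
move: KE' HC HC0 S0 F0 EGE e1E Ef Wf cf af lpf lmf.
move: (\int[rho]_p (phi (s p))%:E) (C) (logp _ _ _) (logm _ _ _) (mu A) (cost G) (W1 _ _) (Ent G rho)
  (\int[rho]_p (phi (q p))%:E) (Ent gE rho) => S1 C1 lp lm a c w EG F e.
move=> KE' HC HC0 S0 F0 EGE e1E Ef /fineK wE /fineK cE /fineK aE /fineK lpE /fineK lmE.
rewrite -wE -cE -aE -lpE -lmE in KE' HC e1E *.
case: F F0 EGE e1E => [F| |] // F0 EGE e1E; last first.
  by move: e1E Ef; case: e.
case: e Ef e1E => [e| |] // Ef [e1E].
have := recovery_arith ei0 S0 HC0 HC EGE KE' e1E.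
by rewrite -!EFinD; apply.
Qed.
End fixed_eps.

Variable W : Rm -> R.
Hypothesis mW : measurable_fun setT W.
Hypothesis W0 : forall x, (0 <= W x)%R.
Hypothesis Wfin : \int[mu]_x (W x)%:E < +oo.
Hypothesis WU : forall eps x, (0 < eps)%R -> (eps <= 1)%R -> U x -> (celldef U eps x <= W x)%R.
Hypothesis fE : f = dens leb mu.
Hypothesis Efin : Ent (restr g E) rho < +oo.

Lemma exists_recovery : exists G : R -> probability (Rm * Rm)%type R,
  [/\ forall e, (0 < e)%R -> Plans mu nu (G e), narrow_cvg0 G g &
      limsup0 (fun e => Feps mu nu e (G e)) <= Flim mu nu g].
Proof.
have ex eps : exists G, (0 < eps)%R -> spliced eps G.
  have [e0|e0] := ltP 0%R eps; last by exists g; lra.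
  by have [G GS] := exists_spliced e0; exists G.
have [G GS] := choice ex.
exists G; split.
- by move=> e e0; have H := GS e e0; apply: spliced_plan H.
- move=> ph cph [B0 HB0]; pose B := `|B0|%R.
  have HB p : (`|ph p| <= B)%R by rewrite (le_trans (HB0 p))// ler_norm.
  have mph := continuous_measurable_prod cph.
  have IB (P : probability (Rm * Rm)%type R) : \int[P]_p (cst B%:E p) = B%:E.
    rewrite (integral_cst P measurableT B%:E) [X in _ * X](_ : _ = 1) ?mule1//.
    exact: probability_setT.
  have iph (P : probability (Rm * Rm)%type R) : P.-integrable setT (EFin \o (ph : Rm * Rm -> R)).
    apply/integrableP; split; first exact/measurable_EFinP.
    apply: (@le_lt_trans _ _ (\int[P]_p (cst B%:E p))).
      by apply: ge0_le_integral => //;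
        [apply: measurableT_comp => //; exact/measurable_EFinP|move=> p _; rewrite /= lee_fin].
    by rewrite IB ltry.
  have fph (P : probability (Rm * Rm)%type R) : \int[P]_p (ph p)%:E \is a fin_num.
    exact: integrable_fin_num (iph P).
  (* Narrow convergence tests signed functions whereas [spliced_close] needs nonnegative ones: the
     bound [B] is added, and cancels in the difference of the two integrals. *)
  have sh (P : probability (Rm * Rm)%type R) : \int[P]_p (B + ph p)%:E = B%:E + \int[P]_p (ph p)%:E.
    rewrite (ge0_integralD_integrable (m := P) (f := cst B) (g := ph))//; last exact: iph.
    by rewrite IB.
  have ps0 p : (0 <= B + ph p)%R by have := HB p; rewrite ler_norml; lra.
  have mps : measurable_fun setT (fun p : Rm * Rm => B + ph p)%R by exact: measurable_funD.
  suff cv : (fun eps => \int[G eps]_p (ph p)%:E) @ 0%R^'+ --> (fine (\int[g]_p (ph p)%:E))%:E.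
    by rewrite (fineK (fph g)) in cv; exact: cv.
  apply/fine_cvgP; split; first exact: nearW.
  apply/cvgrPdist_le => e e0 /=.
  have e2 : (0 < e / 2)%R by rewrite divr_gt0.
  have [L L0 HL] := diagonal_modulus cph e2 (fun p _ => HB p) (M := M).
  near=> eps.
  have ep : (0 < eps)%R by near: eps; exact: nbhs_right_gt.
  have ed : (L * (3 * eps) <= e / 2)%R.
    have : (eps < e / (6 * (L + 1)))%R.
      by near: eps; apply: nbhs_right_lt; rewrite divr_gt0// mulr_gt0// ltr_wpDl.
    rewrite ltr_pdivlMr; last by rewrite mulr_gt0// ltr_wpDl.
    lra.
  have Hd x y : U x -> U y -> (`|(B + ph (x, y)) - (B + ph (x, x))| <= e / 2 + L * `|y - x|)%R.
    move=> Ux Uy; rewrite (_ : (B + ph (x, y)) - (B + ph (x, x)) = ph (x, y) - ph (x, x))%R; last lra.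
    exact: HL (UM Ux) (UM Uy).
  have aux (I J : \bar R) (b c : R) : I \is a fin_num -> J \is a fin_num ->
      b%:E + I <= b%:E + J + c%:E -> b%:E + J <= b%:E + I + c%:E -> (`|fine J - fine I| <= c)%R.
    move: I J => [I| |] [J| |] //= _ _; rewrite -!EFinD !lee_fin => h1 h2.
    by rewrite ler_norml; lra.
  have [h1 h2] := spliced_close ep (GS eps ep) (ltW e2) L0 mps ps0 Hd.
  rewrite !sh in h1 h2.
  apply: (le_trans (aux _ _ _ _ (fph (G eps)) (fph g) h1 h2)).
  by move: ed; lra.
- have lpf := logp_fin nu muM df Emu; have lmf := logm_fin nu muM df.
  have FE : Flim mu nu g = Ent (restr g E) rho - (logp mu nu f - logm mu nu f).
    rewrite /Flim; case: pselect => [?|/(_ gO)//]; rewrite -fE; congr (_ - _).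
    rewrite integralE; congr (_ - _); apply: eq_integral => x _.
      by rewrite funeposE /lnpos EFin_max.
    by rewrite funenegE /lnneg EFin_max EFinN.
  rewrite FE; apply/lee_addgt0Pr => e e0.
  have lpi := integral_lnpos_lty df muM Emu.
  have [d d0 Hd] := kernel_error df oU M0 UM mW W0 Wfin WU lpi e0.
  (* Below [1 / 2] the number [ln (2 eps)] is nonpositive, so its absolute value is
     [- ln (2 eps)]. *)
  pose d' := Num.min d (1 / 2)%R.
  apply: (@le_trans _ _ (ereal_sup [set Feps mu nu t (G t) | t in `]0%R, d'[%classic])).
    apply: ereal_inf_lbound; exists d' => //=.
    by rewrite in_itv/= andbT lt_min d0/= divr_gt0.
  apply: ge_ereal_sup => _ [eps /= + <-]; rewrite in_itv/= lt_min => /andP[ep /andP[ed eh]].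
  have [la la0 Hla] := Hd eps ep ed.
  by apply: (spliced_Feps ep (GS eps ep) Efin _ la0 Hla); lra.
Unshelve. all: by end_near.
Qed.
End recovery_sequence.

(** * Assembly of the two inequalities *)

Unset Implicit Arguments.
Set Strict Implicit.
Theorem mainTheorem6 (R : realType) (mu nu : probability (measurableTypeR R) R)
  (* bounded supports *)
  (hmu_b : exists M : R, supp mu `<=` `[(- M)%R, M]%classic)
  (hnu_b : exists M : R, supp nu `<=` `[(- M)%R, M]%classic)
  (* finite entropy w.r.t. Lebesgue *)
  (hmu_E : Ent mu (@lebesgue_measure R) < +oo)
  (hnu_E : Ent nu (@lebesgue_measure R) < +oo)
  (* (H1) *)
  (H1_bd : lebesgue_measure.-negligible
             (closure (Aset mu nu `&` supp mu) `\` interior (Aset mu nu `&` supp mu)))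
  (H1_int : exists a b : nat -> R,
     [/\ interior (Aset mu nu `&` supp mu) = \bigcup_i `](a i), (b i)[%classic,
         (forall i j, i <> j -> `](a i), (b i)[%classic `&` `](a j), (b j)[%classic = set0) &
         \sum_(0 <= i <oo)
            (- \int[mu]_(x in `](a i), (b i)[%classic)
                  (ln (Num.min (x - a i) (b i - x)))%:E) < +oo])
  (* (H2) *)
  (H2 : exists g, Opt1 mu nu g /\
          Ent (restr g (~` Aset mu nu `*` ~` Aset mu nu)) (mu \x nu) < +oo) :
  Gamma_cvg0 (Plans mu nu) (Feps mu nu) (Flim mu nu).
Proof.
have [M1 HM1] := hmu_b; have [M2 HM2] := hnu_b.
pose M := Num.max 0%R (Num.max M1 M2).
have M0 : (0 <= M)%R by rewrite le_max lexx.
have M1M : (M1 <= M)%R by rewrite !le_max lexx orbT.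
have M2M : (M2 <= M)%R by rewrite !le_max lexx !orbT.
have sub (K : R) : (K <= M)%R -> `[(- K)%R, K]%classic `<=` `[(- M)%R, M]%classic.
  by move=> KM x; rewrite /= !in_itv/= => /andP[? ?]; apply/andP; split; lra.
have muS : supp mu `<=` `[(- M)%R, M]%classic by apply: subset_trans HM1 _; exact: sub.
have nuS : supp nu `<=` `[(- M)%R, M]%classic by apply: subset_trans HM2 _; exact: sub.
have muM := supp_bounded_null muS; have nuM := supp_bounded_null nuS.
have df := density_dens (has_density_Ent hmu_E).
have dfn := density_dens (has_density_Ent hnu_E).
split=> [g gP G GP Gg|g gP].
  exact: (liminf_inequality M0 muM nuM df dfn hmu_E gP GP Gg).
(* Where the limit functional is infinite the constant family already recovers it. Otherwise [g] is
   optimal, and as the logarithmic term is finite its entropy off [A] is finite too: such a [g] can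
   be spliced. *)
have [Foo|Foo] := eqVneq (Flim mu nu g) +oo.
  exists (fun=> g); split => //; last by rewrite Foo leey.
  by move=> phi _ _; exact: cvg_cst.
have gO : Opt1 mu nu g.
  by apply: contrapT => nO; move/eqP: Foo; apply; rewrite /Flim; case: pselect.
pose f := dens (@lebesgue_measure R) mu.
have Efin : Ent (restr g (~` Aset mu nu `*` ~` Aset mu nu)) (mu \x nu) < +oo.
  rewrite ltey; apply: contra_neq Foo => Eoo.
  rewrite /Flim; case: pselect => [?|//]; rewrite Eoo.
  have lpf := logp_fin nu muM df hmu_E; have lmf := logm_fin nu muM df.
  have -> : \int[mu]_(x in Aset mu nu) (ln (f x))%:E = logp mu nu f - logm mu nu f.
    rewrite integralE; congr (_ - _); apply: eq_integral => x _.
      by rewrite funeposE /lnpos EFin_max.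
    by rewrite funenegE /lnneg EFin_max EFinN.
  by move: lpf lmf; rewrite -/f; case: (logp _ _ _) => // ?; case: (logm _ _ _).
pose U := interior (Aset mu nu `&` supp mu).
have oU : open U by exact: open_interior.
have UA : U `<=` Aset mu nu by move=> x /interior_subset[].
have UM : U `<=` `[(- M)%R, M]%classic by move=> x /interior_subset[_ /muS].
have mA := measurable_Aset mu nu.
have mU : measurable (U : set (measurableTypeR R)) by exact: open_measurable.
(* What [U] misses of [A] lies in the boundary set of (H1), Lebesgue-null and hence [mu]-null, or
   outside the support of [mu]. *)
have muAU : mu (Aset mu nu `\` U) = 0.
  apply: measure_negligible; first exact: measurableD.
  have [N [mN N0 sN]] := H1_bd.
  have [N' [mN' N'0 sN']] := supp_null mu.
  exists (N `|` N'); split; first exact: measurableU.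
    apply: null_set_setU => //; exact: density_null df _ mN N0.
  move=> x [Ax nUx]; have [sx|nsx] := pselect (supp mu x); last by right; apply: sN'.
  by left; apply: sN; split => //; apply: subset_closure.
have [a [b [UI dI H1]]] := H1_int.
have [W [mW W0 Wfin WI]] := exists_distance_bound M0 UM UI dI H1.
have WU eps x : (0 < eps)%R -> (eps <= 1)%R -> U x -> (celldef U eps x <= W x)%R.
  move=> e0 e1; rewrite {1}/U UI => -[i _]; rewrite /= in_itv/= => xi.
  have IU : `](a i), (b i)[%classic `<=` U by rewrite /U UI => y yi; exists i.
  exact: le_trans (celldef_itv oU M0 UM e0 e1 IU xi) (WI i x xi).
exact: (exists_recovery M0 muM nuM df dfn hmu_E oU UM UA muAU gO mW W0 Wfin WU erefl Efin).
Qed.
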